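(* Let $\Lambda$ be a hereditary artin algebra. Then the following hold. (1) Let $P$ be a rigid $\Lambda$-module. Then $\mathsf{cok}\,P$ is a torsion class in $\langle P\rangle_{\mathsf{wide}}$, and thus is an ICE-closed subcategory of $\mathsf{mod}\,\Lambda$. Moreover, $P$ is an $\operatorname{Ext}$-progenerator of $\mathsf{cok}\,P$. (2) We have mutually inverse bijections $\mathsf{cok}\colon \mathsf{rigid}\,\Lambda\rightleftarrows \mathsf{ice_p}\,\Lambda\colon P(-)$. (3) Every ICE-closed subcategory of $\mathsf{mod}\,\Lambda$ with enough $\operatorname{Ext}$-projectives is a functorially finite torsion class in some wide subcategory of $\mathsf{mod}\,\Lambda$ which is equivalent to $\mathsf{mod}\,\Gamma$ for some hereditary artin algebra $\Gamma$. (4) If $\Lambda$ is representation-finite, then a subcategory $\mathcal{C}$ of $\mathsf{mod}\,\Lambda$ is ICE-closed if and only if $\mathcal{C}$ is a torsion class in some wide subcategory of $\mathsf{mod}\,\Lambda$.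
   Context: An artin algebra is an algebra over a commutative artinian ring $R$ which is finitely generated as an $R$-module. $\mathsf{mod}\,\Lambda$ is the category of finitely generated right $\Lambda$-modules; all modules are finitely generated right modules. $\Lambda$ is representation-finite if $\mathsf{mod}\,\Lambda$ has finitely many indecomposables up to isomorphism. All subcategories are assumed to be full and closed under isomorphisms, direct sums and direct summands. $\mathsf{add}\,U$ is the subcategory of direct summands of finite direct sums of copies of $U$. A module is basic if it is a direct sum of pairwise non-isomorphic indecomposables (the zero module is basic). $U$ is rigid if $\operatorname{Ext}^1_\Lambda(U,U)=0$. $\mathsf{rigid}\,\Lambda$ is the set of isomorphism classes of basic rigid $\Lambda$-modules. $\mathsf{cok}\,U$ is the subcategory of $\mathsf{mod}\,\Lambda$ consisting of cokernels of maps in $\mathsf{add}\,U$. A subcategory $\mathcal{C}$ of $\mathsf{mod}\,\Lambda$ is ICE-closed if it is closed under images, cokernels (of maps between objects of $\mathcal{C}$) and extensions. It is wide if it is closed under kernels, cokernels (of maps between objects of $\mathcal{C}$) and extensions; a wide subcategory is an abelian category. $\langle P\rangle_{\mathsf{wide}}$ is the smallest wide subcategory of $\mathsf{mod}\,\Lambda$ containing $P$. A torsion class in an abelian category $\mathcal{A}$ is a subcategory of $\mathcal{A}$ closed under quotients and extensions in $\mathcal{A}$. Functorially finite means both covariantly and contravariantly finite (every object of the ambient abelian category has a left and a right approximation by objects of the subcategory). For an extension-closed subcategory $\mathcal{C}$, an object $X\in\mathcal{C}$ is $\operatorname{Ext}$-projective in $\mathcal{C}$ if $\operatorname{Ext}^1_\Lambda(X,C)=0$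 for all $C\in\mathcal{C}$. $\mathcal{C}$ has enough $\operatorname{Ext}$-projectives if for every $X\in\mathcal{C}$ there is a short exact sequence $0\to Y\to P\to X\to 0$ with $P$ $\operatorname{Ext}$-projective in $\mathcal{C}$ and $Y\in\mathcal{C}$. An object $P\in\mathcal{C}$ is an $\operatorname{Ext}$-progenerator of $\mathcal{C}$ if $\mathsf{add}\,P$ is exactly the class of $\operatorname{Ext}$-projective objects in $\mathcal{C}$ and $\mathcal{C}$ has enough $\operatorname{Ext}$-projectives. $P(\mathcal{C})$ denotes the basic $\operatorname{Ext}$-progenerator of $\mathcal{C}$ (unique up to isomorphism). $\mathsf{ice_p}\,\Lambda$ is the set of ICE-closed subcategories of $\mathsf{mod}\,\Lambda$ with enough $\operatorname{Ext}$-projectives. *)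

(* Defs.v *)
From HB Require Import structures.
From mathcomp Require Import all_boot all_order all_algebra.

Set Implicit Arguments.
Unset Strict Implicit.
Unset Printing Implicit Defensive.

Import GRing.Theory.
Local Open Scope ring_scope.

Definition ideal (R : comPzRingType) (I : R -> Prop) : Prop :=
  [/\ I 0, forall x y, I x -> I y -> I (x + y) & forall a x, I x -> I (a * x)].

Definition artinian (R : comPzRingType) : Prop :=
  forall I : nat -> R -> Prop,
    (forall n, ideal (I n)) -> (forall n x, I n.+1 x -> I n x) ->
    exists N, forall n, (N <= n)%N -> forall x, I n x <-> I N x.

(* An R-algebra is a ring morphism from R with central image. The library's
   algType is not used because it excludes the zero algebra. *)
Definition artin_algebra (A : pzRingType) : Prop :=
  exists (R : comPzRingType) (phi : {rmorphism R -> A}),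
    [/\ artinian R,
        forall r a, phi r * a = a * phi r
      & exists n (g : 'I_n -> A), forall a, exists c : 'I_n -> R,
          a = \sum_(i < n) phi (c i) * g i].

Definition finitely_generated (B : pzRingType) (M : lmodType B) : Prop :=
  exists n (g : 'I_n -> M), forall m, exists c : 'I_n -> B,
    m = \sum_(i < n) c i *: g i.

(* Right A-modules are left modules over the converse ring A^c. *)
Record rmod (A : pzRingType) := RMod {
  rmod_sort :> lmodType A^c;
  rmod_fg : finitely_generated rmod_sort }.

Definition isomorphic (B : pzRingType) (M N : lmodType B) : Prop :=
  exists f : {linear M -> N}, bijective f.

Definition surjective (S T : Type) (f : S -> T) : Prop :=
  forall y, exists x, f x = y.

Definition exact_at (B : pzRingType) (L M N : lmodType B)
    (f : {linear L -> M}) (g : {linear M -> N}) : Prop :=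
  forall m, g m = 0 <-> exists l, f l = m.

Definition short_exact (B : pzRingType) (L M N : lmodType B)
    (f : {linear L -> M}) (g : {linear M -> N}) : Prop :=
  [/\ injective f, exact_at f g & surjective g].

Definition projective (B : pzRingType) (P : lmodType B) : Prop :=
  forall (M N : lmodType B) (g : {linear M -> N}) (h : {linear P -> N}),
    surjective g -> exists l : {linear P -> M}, g \o l =1 h.

(* Right ideals, i.e. submodules of the regular right module, are projective.
   (For artin algebras the left and right conditions agree.) *)
Definition hereditary (A : pzRingType) : Prop :=
  forall (I : lmodType A^c) (f : {linear I -> (A^c)^o}),
    injective f -> projective I.

(* Ext^1(X, Y) = 0 for the Yoneda Ext^1: every extension of X by Y is
   equivalent to the split one. *)
Definition Ext1_zero (B : pzRingType) (X Y : lmodType B) : Prop :=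
  forall (E : lmodType B) (i : {linear Y -> E}) (p : {linear E -> X}),
    short_exact i p ->
    exists phi : {linear E -> (Y * X)%type},
      [/\ bijective phi, forall y, phi (i y) = (y, 0)
        & forall e, (phi e).2 = p e].

Section Modules.
Variable A : pzRingType.
Implicit Types (I K M P U X Y Z : rmod A) (C D W T : rmod A -> Prop).

(* The case n = 0 says that M is zero. *)
Definition direct_sum n (F : 'I_n -> rmod A) M : Prop :=
  exists iota : forall i, {linear F i -> M},
    forall m, exists! x : (forall i, F i), m = \sum_(i < n) iota i (x i).

Definition summand X M : Prop :=
  exists Y, isomorphic (X * Y)%type M.

Definition is_zero M : Prop := forall m : M, m = 0.

Definition indecomposable M : Prop :=
  ~ is_zero M /\
  forall X Y, isomorphic (X * Y)%type M -> is_zero X \/ is_zero Y.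

Definition basic M : Prop :=
  exists n (F : 'I_n -> rmod A),
    [/\ forall i, indecomposable (F i),
        forall i j, isomorphic (F i) (F j) -> i = j
      & direct_sum F M].

Definition representation_finite : Prop :=
  exists n (F : 'I_n -> rmod A),
    forall M, indecomposable M -> exists i, isomorphic M (F i).

Definition rigid U : Prop := Ext1_zero U U.

(* Closure under empty direct sums puts the zero modules in C. *)
Definition subcategory C : Prop :=
  [/\ forall X Y, C X -> isomorphic X Y -> C Y,
      forall n (F : 'I_n -> rmod A) M,
        (forall i, C (F i)) -> direct_sum F M -> C M
    & forall X M, C M -> summand X M -> C X].

Definition closed_kernels C : Prop :=
  forall K X Y (k : {linear K -> X}) (f : {linear X -> Y}),
    C X -> C Y -> injective k -> exact_at k f -> C K.

Definition closed_cokernels C : Prop :=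
  forall X Y Z (f : {linear X -> Y}) (q : {linear Y -> Z}),
    C X -> C Y -> exact_at f q -> surjective q -> C Z.

Definition closed_images C : Prop :=
  forall X I Y (f : {linear X -> Y}) (e : {linear X -> I})
         (m : {linear I -> Y}),
    C X -> C Y -> surjective e -> injective m -> f =1 m \o e -> C I.

Definition closed_extensions C : Prop :=
  forall X Y Z (f : {linear X -> Y}) (g : {linear Y -> Z}),
    C X -> C Z -> short_exact f g -> C Y.

Definition ICE_closed C : Prop :=
  [/\ subcategory C, closed_images C, closed_cokernels C
    & closed_extensions C].

Definition wide W : Prop :=
  [/\ subcategory W, closed_kernels W, closed_cokernels W
    & closed_extensions W].

Definition wide_generated P X : Prop := forall W, wide W -> W P -> W X.

(* To be used with W wide: kernels and cokernels in W are then those of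
   modules, so epimorphisms of W are the surjections and exact sequences of W
   are exact sequences of modules. *)
Definition torsion_class W T : Prop :=
  [/\ subcategory T, forall X, T X -> W X,
      forall X Y (q : {linear X -> Y}), T X -> W Y -> surjective q -> T Y
    & forall X Y Z (f : {linear X -> Y}) (g : {linear Y -> Z}),
        T X -> W Y -> T Z -> short_exact f g -> T Y].

Definition covariantly_finite W T : Prop :=
  forall M, W M -> exists X (f : {linear M -> X}),
    T X /\ forall X' (g : {linear M -> X'}), T X' ->
      exists h : {linear X -> X'}, h \o f =1 g.

Definition contravariantly_finite W T : Prop :=
  forall M, W M -> exists X (f : {linear X -> M}),
    T X /\ forall X' (g : {linear X' -> M}), T X' ->
      exists h : {linear X' -> X}, f \o h =1 g.

Definition functorially_finite W T : Prop :=
  covariantly_finite W T /\ contravariantly_finite W T.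

Definition add U X : Prop :=
  exists n M, direct_sum (fun _ : 'I_n => U) M /\ summand X M.

Definition cok U X : Prop :=
  exists U1 U0 (f : {linear U1 -> U0}) (q : {linear U0 -> X}),
    [/\ add U U1, add U U0, exact_at f q & surjective q].

Definition Ext_projective C X : Prop :=
  C X /\ forall Y, C Y -> Ext1_zero X Y.

Definition enough_Ext_projectives C : Prop :=
  forall X, C X -> exists Y P (f : {linear Y -> P}) (g : {linear P -> X}),
    [/\ C Y, Ext_projective C P & short_exact f g].

Definition Ext_progenerator C P : Prop :=
  [/\ C P, forall X, add P X <-> Ext_projective C X
    & enough_Ext_projectives C].

Definition same C D : Prop := forall X, C X <-> D X.

(* Subcategories and isomorphism classes are both predicates on modules,
   compared by [same]. *)
Definition iso_class U V : Prop := isomorphic U V.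

Definition rigid_class (K : rmod A -> Prop) : Prop :=
  exists U, [/\ basic U, rigid U & same K (iso_class U)].

Definition ice_p C : Prop := ICE_closed C /\ enough_Ext_projectives C.

Definition cok_class (K : rmod A -> Prop) X : Prop :=
  exists2 U, K U & cok U X.

(* All basic Ext-progenerators of C; that they form exactly one isomorphism
   class is part of the assertion that P_class maps ice_p to rigid_class. *)
Definition P_class C P : Prop := basic P /\ Ext_progenerator C P.

End Modules.

(* Functors between the full subcategories on C and D. *)
Record functor (A B : pzRingType) (C : rmod A -> Prop) (D : rmod B -> Prop) :=
  Functor {
    fobj : {X | C X} -> {Y | D Y};
    fmap : forall X Y : {X | C X},
      {linear sval X -> sval Y} -> {linear sval (fobj X) -> sval (fobj Y)};
    fmap_id : forall X : {X | C X}, fmap (X := X) (Y := X) idfun =1 id;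
    fmap_comp : forall (X Y Z : {X | C X})
        (g : {linear sval Y -> sval Z}) (f : {linear sval X -> sval Y}),
      fmap (X := X) (Y := Z) (g \o f) =1 fmap g \o fmap f }.

(* [equiv_unit F G] : the identity is naturally isomorphic to G F. *)
Definition equiv_unit (A B : pzRingType) (C : rmod A -> Prop)
    (D : rmod B -> Prop) (F : functor C D) (G : functor D C) : Prop :=
  exists eta : forall X : {X | C X},
      {linear sval X -> sval (fobj G (fobj F X))},
    (forall X, bijective (eta X)) /\
    forall (X Y : {X | C X}) (f : {linear sval X -> sval Y}),
      eta Y \o f =1 fmap G (fmap F f) \o eta X.

Definition equivalent (A B : pzRingType) (C : rmod A -> Prop)
    (D : rmod B -> Prop) : Prop :=
  exists (F : functor C D) (G : functor D C),
    equiv_unit F G /\ equiv_unit G F.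

(* Main.v *)
(**
An ICE-closed subcategory C of mod A sits inside its wide hull, the category
of kernels of epimorphisms of C.  The hull is closed under kernels and
cokernels by pushing out along embeddings into C, and under extensions because
Ext^1 is right exact over a hereditary algebra; C is then a torsion class in it.

For P rigid, the key point is that the kernel of an add P-approximation of X is
generated by P as soon as P generates X and X embeds in an object of cok P.
This gives all closure properties of cok P and enough Ext-projectives.

An ICE-closed C with enough Ext-projectives has an Ext-progenerator because
Ext-projectives with the same class in the Grothendieck group of projectives
have the same additive closure, and this group has finite rank.

Finally, the reflection Q of the regular module in the wide hull of C
satisfies Hom(Q, X) = X for X in the hull, so Q is itself a ring B under A and
restriction along A -> B identifies mod B with the hull.
*)
From Stdlib Require List.
From HB Require Import structures.
From mathcomp Require Import all_boot all_order all_algebra.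
From mathcomp Require Import lra.
From mathcomp Require Import boolp classical_sets.
Require Import Defs.

Set Implicit Arguments.
Unset Strict Implicit.
Unset Printing Implicit Defensive.

Import Order.TTheory GRing.Theory Num.Theory.
Local Open Scope ring_scope.

(** * Submodules, quotients and linear maps *)

(** Ext^1 enters only through its vanishing, phrased by splittings; no Ext groups are built.
    Heredity is used in two forms: vanishing of Ext^1(X, Y) passes to quotients of Y and to
    submodules of X, in both cases because the relations in a free presentation are again
    projective. In particular Ext^1(P, -) vanishes on everything a rigid P generates, so what has to
    be proved about kernels is that P generates them.

    For Ext-progenerators the obstacle is that nothing bounds in advance the number of
    indecomposable Ext-projectives. There are no extensions between Ext-projectives, and the Euler
    form, length of Hom(X, N) minus length of Ext^1(X, N), sees only the class of X. Testing it on N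
    = M modulo the trace of X makes two Ext-projectives of equal class generate each other. A
    rational relation between classes becomes such an equality once denominators are cleared and
    negative terms are moved across.

    The reflection is obtained without an adjoint functor theorem: a module in C with a marked
    element that reaches every element of C is cut down, by the descending chain condition, to a
    minimal hull object containing that element. *)

Section LinearMaps.
Variable S : pzRingType.
Implicit Types E F K L M N Q U V W X Y Z : lmodType S.

Definition mk_linear U V (f : U -> V)
    (hf : forall a u v, f (a *: u + v) = a *: f u + f v) : {linear U -> V} :=
  HB.pack f (GRing.isLinear.Build S U V *:%R f hf).

Definition submod V (P : V -> Prop) : Prop :=
  P 0 /\ forall a u v, P u -> P v -> P (a *: u + v).

Lemma submodD V (P : V -> Prop) u v : submod P -> P u -> P v -> P (u + v).
Proof. by case=> _ h Pu Pv; rewrite -[u]scale1r; apply: h. Qed.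

Lemma submodZ V (P : V -> Prop) a u : submod P -> P u -> P (a *: u).
Proof. by case=> h0 h Pu; rewrite -[_ *: _]addr0; apply: h. Qed.

Lemma submodN V (P : V -> Prop) u : submod P -> P u -> P (- u).
Proof. by move=> h Pu; rewrite -scaleN1r; apply: submodZ. Qed.

Lemma submodB V (P : V -> Prop) u v : submod P -> P u -> P v -> P (u - v).
Proof. by move=> h Pu Pv; apply: submodD => //; apply: submodN. Qed.

Lemma submod_sum V (P : V -> Prop) (I : Type) (r : seq I) (Q : pred I)
    (F : I -> V) :
  submod P -> (forall i, Q i -> P (F i)) -> P (\sum_(i <- r | Q i) F i).
Proof.
move=> hP hF; apply: (big_ind P) => //; first by case: hP.
by move=> x y; apply: submodD.
Qed.

Section Sub.
Variables (V : lmodType S) (P : V -> Prop) (hP : submod P).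

Definition sub_pred : {pred V} := fun v => `[< P v >].

Lemma sub_pred_closed : submod_closed sub_pred.
Proof.
split; first by apply/asboolP; case: hP.
by move=> a u v /asboolP Pu /asboolP Pv; apply/asboolP; case: hP => _; apply.
Qed.

HB.instance Definition _ := GRing.isSubmodClosed.Build S V sub_pred sub_pred_closed.

Record sub_mod := SubMod { sub_val : V; _ : sub_val \in sub_pred }.
HB.instance Definition _ := [isSub for sub_val].
HB.instance Definition _ := [Choice of sub_mod by <:].
HB.instance Definition _ := [SubChoice_isSubLmodule of sub_mod by <:].

(** Submodules and quotients are used later only as maps with prescribed image or kernel, so no
    argument depends on their carriers. *)
Lemma sub_ex : exists (K : lmodType S) (k : {linear K -> V}),
  injective k /\ forall v, P v <-> exists x, k x = v.
Proof.
exists sub_mod, (\val : {linear sub_mod -> V}); split; first exact: val_inj.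
move=> v; split=> [Pv | [x <-]]; last exact/asboolP/(valP x).
have Pv' : v \in sub_pred by apply/asboolP.
by exists (SubMod Pv').
Qed.
End Sub.

Section Quot.
Variables (V : lmodType S) (P : V -> Prop) (hP : submod P).

Lemma coset_ex v : exists w, `[< P (v - w) >].
Proof. by exists v; apply/asboolP; rewrite subrr; case: hP. Qed.

(** [xchoose] depends only on the extension of its predicate, so congruent vectors get the same
    representative, and the quotient can live on the chosen representatives. *)
Definition coset_rep v := xchoose (coset_ex v).

Lemma coset_repP v : P (v - coset_rep v).
Proof. exact/asboolP/(xchooseP (coset_ex v)). Qed.

Lemma coset_rep_eq u v : P (u - v) -> coset_rep u = coset_rep v.
Proof.
move=> Puv; apply: eq_xchoose => w; apply/asboolP/asboolP => h.
  rewrite -(subrKA u) -(opprB u v).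
  by rewrite addrC; apply: submodB.
by rewrite -(subrKA v); apply: submodD.
Qed.

Lemma coset_rep_idem v : coset_rep (coset_rep v) = coset_rep v.
Proof.
apply: coset_rep_eq; rewrite -opprB; apply: submodN => //.
exact: coset_repP.
Qed.

Record quot_mod := QuotMod {
  quot_val : V; _ : quot_val \in [pred v | coset_rep v == v] }.
HB.instance Definition _ := [isSub for quot_val].
HB.instance Definition _ := [Choice of quot_mod by <:].

Lemma quot_pi_proof v : coset_rep v \in [pred v | coset_rep v == v].
Proof. by rewrite inE coset_rep_idem. Qed.
Definition quot_pi v : quot_mod := QuotMod (quot_pi_proof v).

Lemma quot_piP u v : (quot_pi u = quot_pi v) <-> P (u - v).
Proof.
split=> [[h] | h]; last by apply: val_inj; exact: coset_rep_eq.
rewrite -(subrKA (coset_rep u)) {2}h -(opprB v); apply: submodB => //;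
  exact: coset_repP.
Qed.

Lemma quot_piK x : quot_pi (val x) = x.
Proof. by apply: val_inj; apply/eqP; exact: (valP x). Qed.

Let add (x y : quot_mod) := quot_pi (val x + val y).
Let opp (x : quot_mod) := quot_pi (- val x).
Let scale a (x : quot_mod) := quot_pi (a *: val x).

Let pi_add u v : quot_pi (u + v) = add (quot_pi u) (quot_pi v).
Proof.
apply/quot_piP; rewrite opprD addrACA; apply: submodD => //; exact: coset_repP.
Qed.
Let pi_scale a u : quot_pi (a *: u) = scale a (quot_pi u).
Proof.
by apply/quot_piP; rewrite -scalerBr; apply: submodZ => //; exact: coset_repP.
Qed.
Let pi_opp u : quot_pi (- u) = opp (quot_pi u).
Proof.
by apply/quot_piP; rewrite -opprD; apply: submodN => //; exact: coset_repP.
Qed.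

Let addA : associative add.
Proof.
by move=> x y z; rewrite -(quot_piK x) -(quot_piK y) -(quot_piK z) -!pi_add addrA.
Qed.
Let addC : commutative add.
Proof. by move=> x y; rewrite /add addrC. Qed.
Let add0 : left_id (quot_pi 0) add.
Proof. by move=> x; rewrite -(quot_piK x) -pi_add add0r. Qed.
Let addN : left_inverse (quot_pi 0) opp add.
Proof. by move=> x; rewrite -(quot_piK x) -pi_opp -pi_add addNr. Qed.
HB.instance Definition _ := GRing.isZmodule.Build quot_mod addA addC add0 addN.

Let scaleA a b v : scale a (scale b v) = scale (a * b) v.
Proof. by rewrite -(quot_piK v) -!pi_scale scalerA. Qed.
Let scale1 : left_id 1 scale.
Proof. by move=> v; rewrite -(quot_piK v) -!pi_scale scale1r. Qed.
Let scaleDr : right_distributive scale +%R.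
Proof.
move=> a u v; rewrite -(quot_piK u) -(quot_piK v).
have e x y : quot_pi x + quot_pi y = quot_pi (x + y) by rewrite pi_add.
by rewrite e -!pi_scale scalerDr e.
Qed.
Let scaleDl v : {morph scale^~ v : a b / a + b}.
Proof.
by move=> a b; rewrite /= -(quot_piK v) -!pi_scale scalerDl pi_add.
Qed.
HB.instance Definition _ := GRing.Zmodule_isLmodule.Build S quot_mod
  scaleA scale1 scaleDr scaleDl.

Lemma quot_pi_linear a u v : quot_pi (a *: u + v) = a *: quot_pi u + quot_pi v.
Proof. by rewrite pi_add pi_scale. Qed.

Lemma quot_ex : exists (Q : lmodType S) (q : {linear V -> Q}),
  surjective q /\ forall v, q v = 0 <-> P v.
Proof.
exists quot_mod, (mk_linear quot_pi_linear); split.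
  by move=> y; exists (val y); exact: quot_piK.
by move=> v; rewrite -[v in P v]subr0 -quot_piP.
Qed.
End Quot.

(** Maps are often known only through a relation such as [k x = f u]. For a linear relation it
    suffices to be single-valued at 0, by subtracting two pairs; the values come from choice. *)
Lemma lin_graph U V (G : U -> V -> Prop) :
  (forall a u u' v v', G u v -> G u' v' -> G (a *: u + u') (a *: v + v')) ->
  (forall u, exists v, G u v) -> (forall v, G 0 v -> v = 0) ->
  exists f : {linear U -> V}, forall u, G u (f u).
Proof.
move=> Glin Gtot Gfun.
have uniq u v w : G u v -> G u w -> v = w.
  move=> h1 h2; apply/eqP; rewrite -subr_eq0; apply/eqP/Gfun.
  have := Glin (-1) _ _ _ _ h2 h1.
  by rewrite !scaleN1r addNr addrC.
pose f u := sval (cid (Gtot u)); have fP u : G u (f u) by apply: (svalP (cid _)).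
have f_lin a u v : f (a *: u + v) = a *: f u + f v.
  by apply: (uniq (a *: u + v)) => //; apply: Glin.
by exists (mk_linear f_lin).
Qed.

Lemma factor_inj K U V (k : {linear K -> V}) (f : {linear U -> V}) :
  injective k -> (forall u, exists x, k x = f u) ->
  exists g : {linear U -> K}, forall u, k (g u) = f u.
Proof.
move=> kinj h; apply: (@lin_graph U K (fun u x => k x = f u)) => //.
- by move=> a u u' v v' e e'; rewrite !linearP e e'.
- by move=> v; rewrite linear0 => h0; apply: kinj; rewrite h0 linear0.
Qed.

Lemma factor_surj Q U V (q : {linear U -> Q}) (f : {linear U -> V}) :
  surjective q -> (forall u, q u = 0 -> f u = 0) ->
  exists g : {linear Q -> V}, forall u, g (q u) = f u.
Proof.
move=> qsurj h.
have [||v [u [qu <-]]|g hg] :=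
    lin_graph (G := fun y v => exists u, q u = y /\ f u = v).
- move=> a y y' v v' [u [<- <-]] [u' [<- <-]].
  by exists (a *: u + u'); rewrite !linearP.
- by move=> y; have [u <-] := qsurj y; exists (f u), u.
- exact: h.
exists g => u; have [u' [e <-]] := hg (q u).
apply/eqP; rewrite -subr_eq0 -linearB h ?linearB ?e ?subrr//.
Qed.

Lemma inj0 U V (f : {linear U -> V}) : (forall u, f u = 0 -> u = 0) -> injective f.
Proof.
move=> h u v e; apply/eqP; rewrite -subr_eq0; apply/eqP/h.
by rewrite linearB e subrr.
Qed.

Lemma ker0 U V (f : {linear U -> V}) u : injective f -> f u = 0 -> u = 0.
Proof. by move=> h e; apply: h; rewrite linear0. Qed.

Lemma inj_surj_bij U V (f : {linear U -> V}) :
  injective f -> surjective f -> bijective f.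
Proof.
move=> fi fs; have [||g hg] := @factor_inj U V V f idfun => //.
exists g => //; exact: inj_can_sym.
Qed.

Lemma bij_inv U V (f : {linear U -> V}) : bijective f ->
  exists g : {linear V -> U}, cancel f g /\ cancel g f.
Proof.
move=> [g0 fg gf]; have [|v|g hg] := @factor_inj U V V f idfun.
- exact: can_inj fg.
- by exists (g0 v); rewrite gf.
by exists g; split=> //; apply: inj_can_sym hg (can_inj fg).
Qed.

Lemma bij_surj (U V : Type) (f : U -> V) : bijective f -> surjective f.
Proof. by move=> [g fg gf] y; exists (g y). Qed.

Lemma iso_sym U V : isomorphic U V -> isomorphic V U.
Proof. by move=> [f /bij_inv[g [fg gf]]]; exists g; exists f. Qed.

Lemma iso_refl U : isomorphic U U.
Proof. by exists (idfun : {linear U -> U}); exists idfun. Qed.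

Lemma iso_trans U V W : isomorphic U V -> isomorphic V W -> isomorphic U W.
Proof. by move=> [f fb] [g gb]; exists (g \o f : {linear U -> W}); apply: bij_comp. Qed.

Lemma iso_of U V (f : {linear U -> V}) (g : {linear V -> U}) :
  cancel f g -> cancel g f -> isomorphic U V.
Proof. by move=> fg gf; exists f; exists g. Qed.
End LinearMaps.

(** * Chain conditions *)

Section Finiteness.
Variable S : pzRingType.
Implicit Types E F K L M N Q U V W X Y Z : lmodType S.

Lemma fg_fin V (I : finType) (g : I -> V) :
  (forall v, exists c : I -> S, v = \sum_i c i *: g i) -> finitely_generated V.
Proof.
move=> h; exists #|I|, (g \o enum_val) => v; have [c ->] := h v.
exists (c \o enum_val); rewrite -(big_enum_val (fun i => c i *: g i)) /=.
by apply: eq_bigl => i; rewrite inE.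
Qed.

Lemma fg_surj V W (f : {linear V -> W}) :
  surjective f -> finitely_generated V -> finitely_generated W.
Proof.
move=> fs [n [g h]]; exists n, (f \o g) => w; have [v <-] := fs w.
have [c ->] := h v; exists c; rewrite linear_sum; apply: eq_bigr => i _.
by rewrite linearZ.
Qed.

Lemma fg_ext L M N (i : {linear L -> M}) (p : {linear M -> N}) :
  exact_at i p -> surjective p ->
  finitely_generated L -> finitely_generated N -> finitely_generated M.
Proof.
move=> ex ps [m [g hg]] [n [h hh]].
have [h' h'E] := choice (fun a => ps (h a)).
pose G (k : 'I_m + 'I_n) := match k with inl a => i (g a) | inr b => h' b end.
apply: (@fg_fin M ('I_m + 'I_n)%type G) => x.
have [d dE] := hh (p x).
have /ex[l lE] : p (x - \sum_b d b *: h' b) = 0.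
  rewrite linearB linear_sum dE; apply/eqP; rewrite subr_eq0; apply/eqP.
  by apply: eq_bigr => b _; rewrite linearZ h'E.
have [c cE] := hg l.
exists (fun k => match k with inl a => c a | inr b => d b end).
rewrite big_sumType /= -[LHS](subrK (\sum_b d b *: h' b)) -lE; congr (_ + _).
by rewrite cE linear_sum; apply: eq_bigr => a _; rewrite linearZ.
Qed.

Lemma fg_prod M N : finitely_generated M -> finitely_generated N ->
  finitely_generated (M * N)%type.
Proof.
have inlP a (u v : M) : (a *: u + v, 0 : N) = a *: (u, 0) + (v, 0).
  by congr pair => //=; rewrite scaler0 addr0.
apply: (@fg_ext _ _ _ (mk_linear inlP) (snd : {linear (M * N)%type -> N})).
  move=> [x y]; split=> /= [-> | [l [_ <-//]]]; by exists x.
by move=> y; exists (0, y).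
Qed.

(** Splits off one coordinate, so that properties stable under extensions reach finite free modules
    by induction on the rank. *)
Lemma ffunS_exact n V : exists (i : {linear {ffun 'I_n -> V} -> {ffun 'I_n.+1 -> V}})
    (p : {linear {ffun 'I_n.+1 -> V} -> V}), short_exact i p.
Proof.
pose i (f : {ffun 'I_n -> V}) : {ffun 'I_n.+1 -> V} :=
  [ffun k => if unlift ord0 k is Some j then f j else 0].
have i_lin a f g : i (a *: f + g) = a *: i f + i g.
  apply/ffunP => k; rewrite !ffunE; case: unliftP => [j|] _; rewrite ?ffunE//.
  by rewrite scaler0 addr0.
have p_lin a (f g : {ffun 'I_n.+1 -> V}) :
    (a *: f + g) ord0 = a *: f ord0 + g ord0 by rewrite !ffunE.
exists (mk_linear i_lin), (mk_linear p_lin); split.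
- move=> f g /ffunP e; apply/ffunP => j; have := e (lift ord0 j).
  by rewrite !ffunE liftK.
- move=> f; split=> /= [f0 | [g <-]]; last by rewrite ffunE unlift_none.
  exists [ffun j => f (lift ord0 j)]; apply/ffunP => k; rewrite !ffunE.
  by case: unliftP => [j ->|->]; rewrite ?ffunE ?f0.
- by move=> v; exists [ffun => v] => /=; rewrite ffunE.
Qed.

Lemma ffun0_zero V (f : {ffun 'I_0 -> V}) : f = 0.
Proof. by apply/ffunP => -[]. Qed.

Lemma fg_ffun n V : finitely_generated V -> finitely_generated {ffun 'I_n -> V}.
Proof.
move=> fgV; elim: n => [|n IHn].
  by exists 0%N, (fun=> 0) => v; exists (fun=> 0); rewrite (ffun0_zero v) big_ord0.
have [i [p [_ ex ps]]] := ffunS_exact n V; exact: fg_ext ex ps IHn fgV.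
Qed.

Lemma fg_regular : finitely_generated (S^o : lmodType S).
Proof.
exists 1%N, (fun=> 1) => v; exists (fun=> v).
by rewrite big_ord1 /GRing.scale /= mulr1.
Qed.

Definition of_coords n V (g : 'I_n -> V) (c : {ffun 'I_n -> S^o}) : V :=
  \sum_i (c i : S) *: g i.

Lemma of_coords_linear n V (g : 'I_n -> V) a c d :
  of_coords g (a *: c + d) = a *: of_coords g c + of_coords g d.
Proof.
rewrite /of_coords scaler_sumr -big_split; apply: eq_bigr => i _ /=.
by rewrite !ffunE scalerDl scalerA.
Qed.

Lemma fgP V : finitely_generated V <->
  exists n (f : {linear {ffun 'I_n -> S^o} -> V}), surjective f.
Proof.
split=> [[n [g h]] | [n [f fs]]].
  exists n, (mk_linear (of_coords_linear g)) => v; have [c ->] := h v.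
  by exists (finfun c); apply: eq_bigr => i _; rewrite ffunE.
by apply: fg_surj fs _; apply: fg_ffun; apply: fg_regular.
Qed.

Definition dcc V := forall I : nat -> V -> Prop,
  (forall n, submod (I n)) -> (forall n x, I n.+1 x -> I n x) ->
  exists N : nat, forall n, (N <= n)%N -> forall x, I n x <-> I N x.

(** Any finitely generated module mapping onto the submodule will do for [K]; in [noeth_ext] it is a
    product of two pieces, which need not embed. *)
Definition noeth V := forall P : V -> Prop, submod P ->
  exists K (k : {linear K -> V}), finitely_generated K /\
    forall v, P v <-> exists x, k x = v.

Lemma submod_preim V W (f : {linear V -> W}) (P : W -> Prop) :
  submod P -> submod (fun v => P (f v)).
Proof.
move=> [P0 Pl]; split; first by rewrite linear0.
by move=> a u v hu hv; rewrite linearP; apply: Pl.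
Qed.

Lemma submod_im V W (f : {linear V -> W}) (P : V -> Prop) :
  submod P -> submod (fun w => exists2 v, P v & f v = w).
Proof.
move=> [P0 Pl]; split; first by exists 0; rewrite ?linear0.
move=> a u v [x Px <-] [y Py <-].
by exists (a *: x + y); rewrite ?linearP//; apply: Pl.
Qed.

Lemma submod_range V W (f : {linear V -> W}) :
  submod (fun w => exists v, f v = w).
Proof.
split; first by exists 0; rewrite linear0.
by move=> a _ _ [x <-] [y <-]; exists (a *: x + y); rewrite linearP.
Qed.

Lemma submod_ker V W (f : {linear V -> W}) : submod (fun v => f v = 0).
Proof.
split; first by rewrite linear0.
by move=> a u v hu hv; rewrite linearP hu hv scaler0 addr0.
Qed.

Lemma chain_le V (I : nat -> V -> Prop) : (forall n x, I n.+1 x -> I n x) ->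
  forall m n, (m <= n)%N -> forall x, I n x -> I m x.
Proof.
move=> h m n /subnK <-; elim: (n - m)%N => //= k IH x.
by rewrite addSn => /h; apply: IH.
Qed.

Lemma dcc_surj V W (f : {linear V -> W}) : surjective f -> dcc V -> dcc W.
Proof.
move=> fs hV I hI hd; have [N hN] := hV (fun n v => I n (f v))
  (fun n => submod_preim f (hI n)) (fun n x => hd n (f x)).
by exists N => n le_n w; have [v <-] := fs w; apply: hN.
Qed.

(** Modular law: once images in N are stationary, an element of the larger submodule differs from
    one of the smaller by an element of L, and stationary traces on L put that difference into the
    smaller one. *)
Lemma dcc_ext L M N (i : {linear L -> M}) (p : {linear M -> N}) :
  exact_at i p -> dcc L -> dcc N -> dcc M.
Proof.
move=> ex hL hN I hI hd.
have [a ha] := hL (fun n v => I n (i v))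
  (fun n => submod_preim i (hI n)) (fun n x => hd n (i x)).
have [|b hb] := hN _ (fun n => submod_im p (hI n)).
  by move=> n w [v Iv <-]; exists v => //; apply: hd.
exists (maxn a b) => n; rewrite geq_max => /andP[le_a le_b] v.
split=> Iv; first by apply: (chain_le hd _ Iv); rewrite geq_max le_a.
have Ib : I b v by apply: (chain_le hd _ Iv); rewrite leq_maxr.
have [|x Ix xE] := (hb n le_b (p v)).2; first by exists v.
have /ex[l lE] : p (v - x) = 0 by rewrite linearB xE subrr.
have : I n (i l).
  apply/(ha n le_a)/(ha (maxn a b) (leq_maxl _ _)); rewrite lE.
  apply: submodB => //; apply: (chain_le hd _ Ix).
  by rewrite geq_max le_a.
by rewrite lE => h; rewrite -(subrK x v); apply: submodD.
Qed.

Lemma dcc_ffun n V : dcc V -> dcc {ffun 'I_n -> V}.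
Proof.
move=> hV; elim: n => [|n IHn].
  move=> I hI _; exists 0%N => n _ x; rewrite (ffun0_zero x).
  by split=> _; case: (hI 0%N); case: (hI n).
have [i [p [_ ex _]]] := ffunS_exact n V; exact: dcc_ext ex IHn hV.
Qed.

Lemma noeth_surj V W (f : {linear V -> W}) : surjective f -> noeth V -> noeth W.
Proof.
move=> fs hV P hP; have [K [k [fgK kE]]] := hV _ (submod_preim f hP).
exists K, (f \o k : {linear K -> W}); split=> // w; have [v <-] := fs w.
split=> [/kE[x <-] | [x <-]]; first by exists x.
by apply/kE; exists x.
Qed.

Lemma copair_linear U V W (f : {linear U -> W}) (g : {linear V -> W}) a
    (x y : (U * V)%type) :
  f (a *: x + y).1 + g (a *: x + y).2 = a *: (f x.1 + g x.2) + (f y.1 + g y.2).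
Proof. by rewrite !linearP scalerDr addrACA. Qed.

Definition copair U V W (f : {linear U -> W}) (g : {linear V -> W}) :
  {linear (U * V)%type -> W} := mk_linear (copair_linear f g).

Lemma pair_linear U V W (f : {linear W -> U}) (g : {linear W -> V}) a x y :
  (f (a *: x + y), g (a *: x + y)) = a *: (f x, g x) + (f y, g y).
Proof. by rewrite !linearP. Qed.

Definition pairl U V W (f : {linear W -> U}) (g : {linear W -> V}) :
  {linear W -> (U * V)%type} := mk_linear (pair_linear f g).

Lemma projective_ffun n : projective ({ffun 'I_n -> S^o} : lmodType S).
Proof.
move=> M N g h gs.
pose delta (i : 'I_n) : {ffun 'I_n -> S^o} := [ffun j => (j == i)%:R].
have [m mE] := choice (fun i => gs (h (delta i))).
exists (mk_linear (of_coords_linear m)) => c /=.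
have cE : c = \sum_i (c i : S) *: (delta i).
  apply/ffunP => j; rewrite sum_ffunE (bigD1 j)//= !ffunE eqxx.
  rewrite [_ *: _]mulr1 big1 ?addr0// => i ij; rewrite !ffunE eq_sym (negPf ij).
  by rewrite [_ *: _]mulr0.
rewrite /of_coords linear_sum [in RHS]cE linear_sum.
by apply: eq_bigr => i _; rewrite !linearZ /= mE.
Qed.

Lemma noeth_ext L M N (i : {linear L -> M}) (p : {linear M -> N}) :
  exact_at i p -> noeth L -> noeth N -> noeth M.
Proof.
move=> ex hL hN P hP.
have [K [k [fgK kE]]] := hL _ (submod_preim i hP).
have [J [j [fgJ jE]]] := hN _ (submod_im p hP).
have [T [t [ti tE]]] := sub_ex hP.
have [m [c cs]] := (fgP J).1 fgJ.
have jc_im (u : J) : exists v, (p \o t : {linear T -> N}) v = j u.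
  have /jE[v /tE[x <-] e] : exists u', j u' = j u by exists u.
  by exists x.
have [R [r [ri rE]]] := sub_ex (submod_range (p \o t : {linear T -> N})).
have [|h hE] := @factor_inj _ _ _ _ r (j \o c : {linear _ -> N}) ri.
  by move=> u; apply/rE/jc_im.
have [|pt ptE] := @factor_inj _ _ _ _ r (p \o t : {linear T -> N}) ri.
  by move=> u; apply/rE; exists u.
(* Freeness lifts the generators of the image in N to the submodule T all at once. *)
have [|l lE] := @projective_ffun m T R pt h.
  move=> y; have /rE[x xE] : exists x, r x = r y by exists y.
  by exists x; apply: ri; rewrite ptE.
exists (K * {ffun 'I_m -> S^o})%type,
  (copair (i \o k : {linear K -> M}) (t \o l : {linear _ -> M})).
split; first by apply: fg_prod => //; apply/fgP; exists m, idfun => x; exists x.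
move=> v; split=> [Pv | [[x y] <-] /=]; last first.
  apply: submodD => //; first by apply/kE; exists x.
  by apply/tE; exists (l y).
have /jE[u uE] : exists2 v', P v' & p v' = p v by exists v.
have [y yE] := cs u.
have pl : p (t (l y)) = p v.
  by have /(congr1 r) := lE y; rewrite /= ptE hE /= yE uE.
have /ex[z zE] : p (v - t (l y)) = 0 by rewrite linearB pl subrr.
have /kE[x xE] : P (i z).
  by rewrite zE; apply: submodB => //; apply/tE; exists (l y).
by exists (x, y); rewrite /= xE zE subrK.
Qed.

Lemma noeth_ffun n V : noeth V -> noeth {ffun 'I_n -> V}.
Proof.
move=> hV; elim: n => [|n IHn].
  move=> P [P0 _]; exists {ffun 'I_0 -> V}, idfun; split.
    exists 0%N, (fun=> 0) => v; exists (fun=> 0).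
    by rewrite (ffun0_zero v) big_ord0.
  by move=> v; split=> _; [exists v | rewrite (ffun0_zero v)].
have [i [p [_ ex _]]] := ffunS_exact n V; exact: noeth_ext ex IHn hV.
Qed.

Lemma noeth_fg V : noeth (S^o : lmodType S) -> finitely_generated V -> noeth V.
Proof.
by move=> h /fgP[n [f fs]]; apply: noeth_surj fs _; apply: noeth_ffun.
Qed.

Lemma dcc_fg V : dcc (S^o : lmodType S) -> finitely_generated V -> dcc V.
Proof.
by move=> h /fgP[n [f fs]]; apply: dcc_surj fs _; apply: dcc_ffun.
Qed.

(** Without a minimal member, choice would produce a strictly descending chain. Since [F] may record
    more than being a submodule, this yields minimal counterexamples as well as minimal objects of a
    subcategory. *)
Lemma dcc_min V (F : (V -> Prop) -> Prop) : dcc V ->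
  (forall P, F P -> submod P) -> (exists P, F P) ->
  exists P, F P /\ forall P', F P' -> (forall v, P' v -> P v) ->
    forall v, P v -> P' v.
Proof.
move=> hV Fsub [P0 F0]; apply: contrapT => hno.
have next (P : {P | F P}) : exists P' : {P | F P},
    (forall v, sval P' v -> sval P v) /\ exists2 v, sval P v & ~ sval P' v.
  case: P => P FP; apply: contrapT => hP; apply: hno; exists P; split=> //.
  move=> P' FP' sub v Pv; apply: contrapT => nv; apply: hP.
  by exists (exist _ P' FP'); split=> //=; exists v.
have [f fE] := choice next.
pose I n := sval (iter n f (exist _ P0 F0)).
have [|n x|N hN] := hV I.
- by move=> n; apply: Fsub; exact: svalP.
- by have [+ _] := fE (iter n f (exist _ P0 F0)); apply.
have [_ [v v1 v2]] := fE (iter N f (exist _ P0 F0)).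
by apply: v2; apply/(hN N.+1 (leqnSn N)).
Qed.

Lemma noeth_acc V (I : nat -> V -> Prop) : noeth V -> (forall n, submod (I n)) ->
  (forall n x, I n x -> I n.+1 x) -> exists N : nat, forall n x, I n x -> I N x.
Proof.
move=> hV hI hu.
have up m n x : (m <= n)%N -> I m x -> I n x.
  move=> /subnK <-; elim: (n - m)%N => //= k IH /IH; rewrite addSn.
  exact: hu.
have [|K [k [[n [g hg]] kE]]] := hV (fun x => exists n, I n x).
  split; first by exists 0%N; case: (hI 0%N).
  move=> a u v [m hm] [n hn]; exists (maxn m n); case: (hI (maxn m n)) => _.
  by apply; [apply: up hm; rewrite leq_maxl | apply: up hn; rewrite leq_maxr].
have /choice[d dE] (i : 'I_n) : exists m, I m (k (g i)).
  by apply/kE; exists (g i).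
exists (\max_i d i) => m x Ix.
have /kE[y <-] : exists n, I n x by exists m.
have [c ->] := hg y; rewrite linear_sum; apply: submod_sum => // i _.
rewrite linearZ; apply: submodZ => //; apply: up (dE i).
exact: leq_bigmax.
Qed.

Lemma iter_lin V (f : {linear V -> V}) n :
  exists g : {linear V -> V}, forall x, g x = iter n f x.
Proof.
elim: n => [|n [g gE]]; first by exists idfun.
by exists (f \o g : {linear V -> V}) => x /=; rewrite gE.
Qed.

(** The images of the powers of f become stationary, so f^N v = f^(N+1) x for some x, and f^N
    cancels. *)
Lemma inj_endo_surj V (f : {linear V -> V}) : dcc V -> injective f -> surjective f.
Proof.
move=> hV fi v.
pose I n v := exists x, iter n f x = v.
have [n|n x [y <-]|N hN] := hV I.
- have [g gE] := iter_lin f n; have [g0 gl] := submod_range g.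
  split; first by have [x xE] := g0; exists x; rewrite -gE.
  move=> a u w [x <-] [y <-]; rewrite -!gE.
  by have [||z zE] := gl a (g x) (g y); [exists x | exists y | exists z; rewrite -gE].
- by exists (f y); rewrite -iterSr.
have /(hN N.+1 (leqnSn N))[x] : I N (iter N f v) by exists v.
rewrite iterSr => e; exists x; move: e; elim: N {hN} => //= N IH /fi.
exact: IH.
Qed.

Lemma surj_endo_inj V (f : {linear V -> V}) : noeth V -> surjective f -> injective f.
Proof.
move=> hV fs; apply: inj0 => u fu0.
have [n|n x /= ->|N hN] := @noeth_acc V (fun n x => iter n f x = 0) hV.
- have [g gE] := iter_lin f n; have [g0 gl] := submod_ker g.
  by split=> [|a x y]; rewrite -!gE//; apply: gl.
- exact: linear0.
have [v vE] : exists v, iter N f v = u.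
  elim: {hN} N u {fu0} => [|N IH] u; first by exists u.
  by have [w <-] := fs u; have [v <-] := IH w; exists v.
by rewrite -vE; apply: (hN N.+1); rewrite /= vE.
Qed.
End Finiteness.

(** * Commutative artinian rings are noetherian *)

Section ArtinianNoetherian.
Variable R : comPzRingType.
Implicit Types (K : lmodType R) (P : (R^o : lmodType R) -> Prop).

Lemma mulr_linear (r : R) a (x y : R^o) :
  (r * (a *: x + y) : R^o) = a *: (r * x : R^o) + r * y.
Proof. by rewrite mulrDr /GRing.scale /= mulrCA. Qed.

Let fgp P := exists (K : lmodType R) (k : {linear K -> R^o}), finitely_generated K /\
  forall v, P v <-> exists x, k x = v.

Lemma fgp_sub P K (k : {linear K -> R^o}) : fgp P -> injective k ->
  (forall v, P v <-> exists x, k x = v) -> finitely_generated K.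
Proof.
move=> [J [j [fgJ jE]]] ki kE.
have [|h hE] := @factor_inj _ K J R^o k j ki.
  by move=> u; apply/kE/jE; exists u.
apply: (fg_surj (f := h)) fgJ => x.
have /jE[y yE] : P (k x) by apply/kE; exists x.
by exists y; apply: ki; rewrite hE.
Qed.

(* A minimal ideal I that is not finitely generated satisfies rI = I or rI = 0
   for every r, so it is a vector space over the field R / ann I; a maximal
   subspace that avoids x != 0 is finitely generated and, with x, spans I. *)
Lemma artinian_noeth : dcc (R^o : lmodType R) -> noeth (R^o : lmodType R).
Proof.
move=> hdcc; apply: contrapT => hno.
have [||I [[hI nI] Imin]] := @dcc_min R R^o (fun P => submod P /\ ~ fgp P) hdcc.
- by move=> P [].
- apply: contrapT => h; apply: hno => P hP; apply: contrapT => hP'.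
  by apply: h; exists P.
have Ifg P : submod P -> (forall v, P v -> I v) -> ~ (forall v, I v -> P v) ->
    fgp P.
  by move=> hP sub nsub; apply: contrapT => h; apply: nsub; apply: Imin.
(* If rI and the kernel of r on I were both proper in I, minimality would make them finitely
   generated, hence also I, an extension of one by the other. *)
have dich (r : R) : (forall v, I v -> exists2 x, I x & r * x = v) \/
    (forall x, I x -> r * x = 0).
  apply: contrapT => /not_orP[h1 h2]; apply: nI.
  pose mu : {linear R^o -> R^o} := mk_linear (mulr_linear r).
  have sub1 : submod (fun v : R^o => I v /\ mu v = 0).
    have [i0 il] := hI; have [k0 kl] := submod_ker mu.
    by split=> // a u v [? ?] [? ?]; split; [apply: il | apply: kl].
  have /Ifg fg1 := submod_im mu hI.
  have /Ifg fg2 := sub1.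
  have {}fg1 : fgp (fun w : R^o => exists2 v : R^o, I v & mu v = w).
    by apply: fg1 => // v [x Ix <-]; apply: submodZ.
  have {}fg2 : fgp (fun v : R^o => I v /\ mu v = 0).
    by apply: fg2 => [v []//|h]; apply: h2 => x Ix; have [] := h x Ix.
  have [T [t [ti tE]]] := sub_ex hI.
  have [B [b [bi bE]]] := sub_ex (submod_im mu hI).
  have [C [c [ci cE]]] := sub_ex sub1.
  have fgB := fgp_sub fg1 bi bE; have fgC := fgp_sub fg2 ci cE.
  have [|c' c'E] := @factor_inj _ T C R^o t c ti.
    move=> u; apply/tE; have [] // : I (c u) /\ mu (c u) = 0.
    by apply/cE; exists u.
  have [|p pE] := @factor_inj _ B T R^o b (mu \o t : {linear T -> R^o}) bi.
    by move=> u; apply/bE; exists (t u) => //; apply/tE; exists u.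
  exists T, t; split=> //.
  apply: (fg_ext (i := c') (p := p)) fgC fgB.
    move=> x; split=> [px0 | [y <-]].
      have /cE[y yE] : I (t x) /\ mu (t x) = 0.
        split; first by apply/tE; exists x.
        by have := pE x; rewrite px0 linear0 => /= <-.
      by exists y; apply: ti; rewrite c'E.
    apply: bi; rewrite pE linear0 /= c'E.
    by have [] // : I (c y) /\ mu (c y) = 0; apply/cE; exists y.
  move=> y; have /bE[v /tE[x <-] e] : exists x, b x = b y by exists y.
  by exists x; apply: bi; rewrite pE.
have unit (r : R) y : I y -> r * y <> 0 -> exists s : R, forall x, I x -> s * (r * x) = x.
  move=> Iy ry; have [rI | /(_ y Iy)//] := dich r.
  (* The ideals r^n R become stationary, giving r^N = r^(N+1) t; since r^N I = I, the element t
     inverts r on I. *)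
  have [n|n x [y' ->]|N hN] := hdcc (fun n (x : R^o) => exists y, x = r ^+ n * y).
  - split; first by exists 0; rewrite mulr0.
    move=> a u v [u' ->] [v' ->]; exists (a * u' + v').
    by rewrite mulrDr /GRing.scale /= mulrCA.
  - by exists (r * y'); rewrite exprSr mulrA.
  have /(hN N.+1 (leqnSn N))[t tE] : exists y, r ^+ N = r ^+ N * y.
    by exists 1; rewrite mulr1.
  have rnI n : forall x, I x -> exists y, r ^+ n * y = x.
    elim: n => [|n IH] x Ix; first by exists x; rewrite mul1r.
    have [z Iz <-] := rI x Ix; have [w <-] := IH z Iz.
    by exists w; rewrite exprS mulrA.
  exists t => x Ix; have [z <-] := rnI N x Ix.
  by rewrite [in RHS]tE exprS mulrC -!mulrA [z * t]mulrC.
have [x [Ix x0]] : exists x, I x /\ x <> 0.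
  apply: contrapT => h; apply: nI.
  exists ({ffun 'I_0 -> R^o} : lmodType R), \0; split.
    by apply/fgP; exists 0%N, idfun => v; exists v.
  move=> v; split=> [Iv | [w <-]]; last by case: hI.
  by exists 0; apply: contrapT => v0; apply: h; exists v; split=> // e; apply: v0.
(* [PZ] does not ask for 0, so that the union of the empty chain qualifies; [J0] puts 0 back. *)
pose PZ (J : set R) := [/\ forall a u v, J u -> J v -> J (a * u + v),
  forall v, J v -> I v & ~ J x].
have [|J [[Jl JI Jx] Jmax]] := @Zorn_bigcup R PZ.
  move=> F FP Ftot; split.
  - move=> a u v [B FB Bu] [C FC Cv].
    have [BC|CB] := Ftot B C FB FC.
      by exists C => //; have [h _ _] := FP C FC; apply: h => //; apply: BC.
    by exists B => //; have [h _ _] := FP B FB; apply: h => //; apply: CB.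
  - by move=> v [B FB Bv]; have [_ h _] := FP B FB; apply: h.
  - by move=> [B FB Bx]; have [_ _] := FP B FB.
pose J0 (v : R^o) := J v \/ v = 0.
have J0sub : submod J0.
  split; first by right.
  move=> a u v [Ju|->] [Jv|->]; rewrite ?scaler0 ?add0r ?addr0; try by [left|right].
    by left; apply: Jl.
  left; have /= h := Jl (a - 1) u u Ju Ju.
  by have := h; rewrite mulrBl mul1r subrK.
have J0I v : J0 v -> I v by case=> [/JI//|->]; case: hI.
have [|K [k [fgK kE]]] := Ifg J0 J0sub J0I.
  by move=> /(_ x Ix)[].
apply: nI.
have xl a (u v : R^o) : ((a *: u + v) * x : R^o) = a *: (u * x : R^o) + v * x.
  by rewrite mulrDl /GRing.scale /= mulrA.
exists (K * R^o)%type, (copair k (mk_linear xl)); split.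
  by apply: fg_prod => //; apply: fg_regular.
move=> y; split=> [Iy | [[z c] <-]] /=; last first.
  by apply: submodD => //; [apply: J0I; apply/kE; exists z | apply: submodZ].
have [/kE[z zE] | J0y] := EM (J0 y).
  by exists (z, 0); rewrite /= mul0r addr0.
(* For y outside J0, maximality forces x into J0 + R y, say x = j + c y. Then c y is nonzero, so c
   is invertible on I and y lies in J0 + R x. *)
pose Jy (v : R) := exists j c, J0 j /\ v = j + c * y.
have [PJy | nPJy] := EM (PZ Jy).
  case: (Jmax Jy) => //; split.
    by move=> v Jv; exists v, 0; rewrite mul0r addr0; split=> //; left.
  move=> /(_ y) h; apply: J0y; left; apply: h; exists 0, 1.
  by rewrite mul1r add0r; split=> //; right.
have [j [c [J0j xE]]] : Jy x.
  apply: contrapT => nx; apply: nPJy; split=> //.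
    move=> a _ _ [j [c [hj ->]]] [j' [c' [hj' ->]]].
    exists (a * j + j'), (a * c + c'); split; first by apply: J0sub.2.
    by rewrite mulrDr mulrDl !mulrA addrACA.
  move=> _ [j [c [hj ->]]]; apply: submodD => //; first exact: J0I.
  exact: submodZ.
have [|s sE] := unit c y Iy.
  by move=> cy; case: (J0j) => [Jj|j0]; [apply: Jx | apply: x0];
    rewrite xE cy addr0.
have /kE[z zE] : J0 (- s *: j) by apply: submodZ.
exists (z, s); rewrite /= zE xE mulrDr (sE y Iy) /GRing.scale /= mulNr.
by rewrite addKr.
Qed.
End ArtinianNoetherian.

(** * Modules over an artin algebra *)

Section Restriction.
Variables (T S : pzRingType) (f : T -> S).
Hypotheses (f1 : f 1 = 1) (fD : forall a b, f (a + b) = f a + f b)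
  (fM : forall a b, f (a * b) = f a * f b).

(** An alias keeps the structure over T from competing with the one over S; the carrier is
    unchanged, so S-linear functions can be reused as they are. *)
Definition restr_sort (V : lmodType S) : Type := V.

Section One.
Variable V : lmodType S.
HB.instance Definition _ := GRing.Zmodule.on (restr_sort V).
Let scale (a : T) (v : restr_sort V) : restr_sort V := f a *: (v : V).
Let scaleA a b v : scale a (scale b v) = scale (a * b) v.
Proof. by rewrite /scale scalerA fM. Qed.
Let scale1 : left_id 1 scale.
Proof. by move=> v; rewrite /scale f1 scale1r. Qed.
Let scaleDr : right_distributive scale +%R.
Proof. by move=> a u v; rewrite /scale scalerDr. Qed.
Let scaleDl v : {morph scale^~ v : a b / a + b}.
Proof. by move=> a b; rewrite /scale fD scalerDl. Qed.

Definition restr : lmodType T := HB.pack (restr_sort V)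
  (GRing.Zmodule_isLmodule.Build T (restr_sort V) scaleA scale1 scaleDr scaleDl).

Lemma restrZ (a : T) (v : V) : a *: (v : restr) = f a *: v.
Proof. by []. Qed.
End One.

Lemma fg_restr n (g : 'I_n -> S) (V : lmodType S) :
  (forall a, exists c : 'I_n -> T, a = \sum_(i < n) f (c i) * g i) ->
  finitely_generated V -> finitely_generated (restr V).
Proof.
move=> hg [m [w hw]].
apply: (@fg_fin T (restr V) ('I_m * 'I_n)%type (fun k => g k.2 *: w k.1)) => v.
have [c cE] := hw v; have [d dE] := choice (fun j => hg (c j)).
exists (fun k => d k.1 k.2).
rewrite -(pair_bigA _ (fun j i => d j i *: (g i *: w j : restr V))) /= {1}cE.
apply: eq_bigr => j _; rewrite dE scaler_suml; apply: eq_bigr => i _.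
by rewrite restrZ scalerA.
Qed.

Lemma submod_restr (V : lmodType S) (P : V -> Prop) :
  submod P -> @submod T (restr V) P.
Proof. by move=> [h0 h]; split=> // a u v; apply: h. Qed.

Lemma linear_restr_proof (U V : lmodType S) (h : {linear U -> V}) a
    (u v : restr U) : h (a *: u + v) = a *: (h u : restr V) + h v.
Proof. by rewrite !restrZ linearP. Qed.

Definition linear_restr (U V : lmodType S) (h : {linear U -> V}) :
  {linear restr U -> restr V} :=
  @mk_linear T (restr U) (restr V) h (linear_restr_proof h).
End Restriction.

Definition prod_rmod (A : pzRingType) (M N : rmod A) : rmod A :=
  RMod (fg_prod (rmod_fg M) (rmod_fg N)).

Definition free_rmod (A : pzRingType) n : rmod A :=
  RMod (fg_ffun n (fg_regular A^c)).

Definition zero_rmod (A : pzRingType) : rmod A := free_rmod A 0.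

Section ArtinAlgebra.
Variable A : pzRingType.
Hypothesis hA : artin_algebra A.

(** Right modules are left modules over the converse ring, so the structure map must take values in
    [A^c]; centrality makes it multiplicative for the reversed product. *)
Lemma artin_central : exists (R : comPzRingType) (z : R -> A^c),
  [/\ [/\ z 1 = 1, forall a b, z (a + b) = z a + z b &
        forall a b, z (a * b) = z a * z b],
      forall r a, z r * a = a * z r,
      dcc (R^o : lmodType R) /\ noeth (R^o : lmodType R)
    & exists n (g : 'I_n -> A^c), forall a, exists c : 'I_n -> R,
          a = \sum_(i < n) z (c i) * g i].
Proof.
have [R [phi [Rart central [n [g hg]]]]] := hA.
exists R, phi; split.
- split=> [|a b|a b]; [exact: (rmorph1 phi) | exact: (rmorphD phi) |].
  by rewrite (rmorphM phi); apply: central.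
- by move=> r a; exact: (esym (central r a)).
- suff Rd : dcc (R^o : lmodType R) by split=> //; apply: artinian_noeth.
  move=> I hI hd; apply: Rart => // k; split; first by case: (hI k).
    by move=> x y hx hy; exact: (submodD (hI k) hx hy).
  by move=> a x hx; exact: (submodZ a (hI k) hx).
- exists n, g => a; have [c cE] := hg a; exists c.
  rewrite cE; apply: eq_bigr => i _; exact: central.
Qed.

Lemma rmod_dcc (M : rmod A) : dcc M.
Proof.
have [R [z [[z1 zD zM] _ [Rd Rn] [n [g hg]]]]] := artin_central.
have := dcc_fg Rd (fg_restr z1 zD zM hg (rmod_fg M)).
by move=> h I hI; apply: h => k; apply: submod_restr.
Qed.

(** A submodule is finitely generated already over R, and generators over R also generate over A. *)
Lemma rmod_noeth (M : rmod A) : noeth M.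
Proof.
have [R [z [[z1 zD zM] _ [Rd Rn] [n [g hg]]]]] := artin_central.
have hM := noeth_fg Rn (fg_restr z1 zD zM hg (rmod_fg M)).
move=> P hP; have [K [k [[m [w hw]] kE]]] := hM _ (submod_restr z1 zD zM hP).
exists (free_rmod A m), (mk_linear (@of_coords_linear _ m M (fun i => k (w i)))).
split; first exact: rmod_fg.
move=> v; split=> [/kE[x <-] | [c <-]]; last first.
  apply: submod_sum => // i _; apply: submodZ => //.
  by apply/kE; exists (w i).
have [c ->] := hw x; exists [ffun i => z (c i)].
rewrite linear_sum /=; apply: eq_bigr => i _.
by rewrite ffunE linearZ.
Qed.

Lemma sub_rmod (M : rmod A) (P : M -> Prop) : submod P ->
  exists (K : rmod A) (k : {linear K -> M}), injective k /\
    forall v, P v <-> exists x, k x = v.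
Proof.
move=> hP; have [J [j [fgJ jE]]] := rmod_noeth hP.
have [K [k [ki kE]]] := sub_ex hP.
have [|h hE] := @factor_inj _ K J M k j ki.
  by move=> u; apply/kE/jE; exists u.
have fgK : finitely_generated K.
  apply: (fg_surj (f := h)) fgJ => x.
  have /jE[y yE] : P (k x) by apply/kE; exists x.
  by exists y; apply: ki; rewrite hE.
by exists (RMod fgK), k.
Qed.

Lemma kernel_ex (M : rmod A) (N : lmodType A^c) (f : {linear M -> N}) :
  exists (K : rmod A) (k : {linear K -> M}), injective k /\ exact_at k f.
Proof. exact: sub_rmod (submod_ker f). Qed.

Lemma quot_rmod (M : rmod A) (P : M -> Prop) : submod P ->
  exists (Q : rmod A) (q : {linear M -> Q}), surjective q /\
    forall v, q v = 0 <-> P v.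
Proof.
move=> hP; have [Q [q [qs qE]]] := quot_ex hP.
by exists (RMod (fg_surj qs (rmod_fg M))), q.
Qed.

Lemma coker_ex (L : lmodType A^c) (M : rmod A) (f : {linear L -> M}) :
  exists (Q : rmod A) (q : {linear M -> Q}), exact_at f q /\ surjective q.
Proof.
by have [Q [q [qs qE]]] := quot_rmod (submod_range f); exists Q, q.
Qed.

Lemma image_ex (M : rmod A) (N : lmodType A^c) (f : {linear M -> N}) :
  exists (I : rmod A) (e : {linear M -> I}) (m : {linear I -> N}),
    [/\ surjective e, injective m & f =1 m \o e].
Proof.
have [I [m [mi mE]]] := sub_ex (submod_range f).
have [|e eE] := @factor_inj _ I M N m f mi; first by move=> u; apply/mE; exists u.
have es : surjective e.
  move=> y; have /mE[x xE] : exists x, m x = m y by exists y.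
  by exists x; apply: mi; rewrite eE.
by exists (RMod (fg_surj es (rmod_fg M))), e, m; split=> // x; rewrite /= eE.
Qed.

Lemma pullback_ex (X Y : rmod A) (Z : lmodType A^c)
    (f : {linear X -> Z}) (g : {linear Y -> Z}) :
  exists (E : rmod A) (p : {linear E -> X}) (q : {linear E -> Y}),
    [/\ forall e, f (p e) = g (q e),
        forall x y, f x = g y -> exists e, p e = x /\ q e = y
      & forall e, p e = 0 -> q e = 0 -> e = 0].
Proof.
have [K [k [ki kE]]] := @kernel_ex (prod_rmod X Y) Z
  ((f \o fst : {linear (X * Y)%type -> Z}) \- (g \o snd : {linear (X * Y)%type -> Z})).
exists K, (fst \o k : {linear K -> X}), (snd \o k : {linear K -> Y}); split.
- move=> e; have /kE /= : exists x, k x = k e by exists e.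
  by move/eqP; rewrite subr_eq0 => /eqP.
- move=> x y fg; have /kE[e eE] : f (x, y).1 - g (x, y).2 = 0.
    by rewrite /= fg subrr.
  by exists e; rewrite /= eE.
- move=> e /= e1 e2; apply: (ker0 ki).
  by rewrite [k e]surjective_pairing e1 e2.
Qed.

Lemma pushout_ex (X Y : rmod A) (Z : lmodType A^c)
    (f : {linear Z -> X}) (g : {linear Z -> Y}) :
  exists (E : rmod A) (i : {linear X -> E}) (j : {linear Y -> E}),
    [/\ forall z, i (f z) = j (g z),
        forall e, exists x y, e = i x + j y
      & forall x y, i x + j y = 0 -> exists z, x = f z /\ y = - g z].
Proof.
have [E [q [ex qs]]] := @coker_ex Z (prod_rmod X Y) (pairl f (\0 \- g : {linear Z -> Y})).
have iP a (u v : X) : q (a *: u + v, 0) = a *: q (u, 0) + q (v, 0).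
  by rewrite -linearP; congr (q (_, _)); rewrite /= scaler0 addr0.
have jP a (u v : Y) : q (0, a *: u + v) = a *: q (0, u) + q (0, v).
  by rewrite -linearP; congr (q (_, _)); rewrite /= scaler0 addr0.
have qE x y : q (x, y) = q (x, 0) + q (0, y).
  by rewrite -linearD; congr (q (_, _)); rewrite /= ?addr0 ?add0r.
exists E, (mk_linear iP), (mk_linear jP); split.
- move=> z /=; apply/eqP; rewrite -subr_eq0 -linearB; apply/eqP/ex.
  by exists z => /=; congr pair => /=; rewrite ?subr0 ?sub0r.
- by move=> e; have [[x y] <-] := qs e; exists x, y; rewrite /= qE.
- move=> x y /=; rewrite -qE => /ex[z /= [<- <-]]; exists z.
  by rewrite sub0r.
Qed.

(** Replaces induction on length: a counterexample contains a minimal submodule violating [H], and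
    the step applies to it. *)
Lemma rmod_ind (H : rmod A -> Prop) :
  (forall M : rmod A, (forall (N : rmod A) (i : {linear N -> M}), injective i ->
     ~ surjective i -> H N) -> H M) -> forall M, H M.
Proof.
move=> step M; apply: contrapT => hM.
pose Fam (P : M -> Prop) := submod P /\ exists (N : rmod A) (i : {linear N -> M}),
  [/\ injective i, forall v, P v <-> exists x, i x = v & ~ H N].
have [||P [[hP [N [i [ii iE nN]]]] Pmin]] := dcc_min (F := Fam) (@rmod_dcc M).
- by move=> P [].
- exists (fun=> True); split=> //; exists M, idfun; split=> // v.
  by split=> // _; exists v.
apply: nN; apply: step => N' i' i'i i's; apply: contrapT => nN'.
apply: i's => y.
have [|v [x <-]||x /= /ii xy] :=
  Pmin (fun v => exists x, (i \o i' : {linear N' -> M}) x = v) _ _ (i y).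
- split; first exact: submod_range.
  by exists N', (i \o i' : {linear N' -> M}); split=> //; apply: inj_comp.
- by apply/iE; exists (i' x).
- by apply/iE; exists y.
by exists x.
Qed.

Lemma endo_inj_surj (M : rmod A) (f : {linear M -> M}) : injective f -> surjective f.
Proof. exact: inj_endo_surj (@rmod_dcc M). Qed.

(** A homomorphism is determined by its values on m generators of Z, so Hom(Z, N) embeds R-linearly
    in N^m and inherits finiteness. Multiples of a homomorphism are homomorphisms because R is
    central. [ev] decodes elements of [H]. *)
Lemma hom_module (Z N : rmod A) :
  exists (R : comPzRingType) (z : R -> A^c) (H : lmodType R)
    (ev : H -> {linear Z -> N}),
  [/\ forall r h h' x, ev (r *: h + h') x = z r *: ev h x + ev h' x,
      forall h, (forall x, ev h x = 0) -> h = 0,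
      forall f : {linear Z -> N}, exists h, ev h =1 f,
      [/\ finitely_generated H, dcc H & noeth H]
    & forall r a, z r * a = a * z r].
Proof.
have [R [z [[z1 zD zM] central [Rd Rn] [n [g hg]]]]] := artin_central.
have [m [w hw]] := rmod_fg Z.
pose V : lmodType R := {ffun 'I_m -> restr z1 zD zM N}.
have fgV : finitely_generated V by apply/fg_ffun/(fg_restr _ _ _ hg)/rmod_fg.
pose P (v : V) := exists f : {linear Z -> N}, forall i, v i = f (w i).
have zlin r (f f' : {linear Z -> N}) a x y :
    z r *: f (a *: x + y) + f' (a *: x + y) =
    a *: (z r *: f x + f' x) + (z r *: f y + f' y).
  by rewrite !linearP !scalerDr !scalerA central addrACA.
have hP : submod P.
  split; first by exists \0 => i; rewrite ffunE.
  move=> r u v [f fE] [f' f'E]; exists (mk_linear (zlin r f f')) => i.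
  by rewrite !ffunE fE f'E.
have [H [k [ki kE]]] := sub_ex hP.
have fgH : finitely_generated H.
  have [J [j [fgJ jE]]] := noeth_fg Rn fgV hP.
  have [|h hE] := @factor_inj _ H J V k j ki.
    by move=> u; apply/kE/jE; exists u.
  apply: (fg_surj (f := h)) fgJ => x.
  have /jE[y yE] : P (k x) by apply/kE; exists x.
  by exists y; apply: ki; rewrite hE.
have /choice[ev evE] (h : H) : exists f : {linear Z -> N},
    forall i, k h i = f (w i) by apply/kE; exists h.
have gen (f f' : {linear Z -> N}) : (forall i, f (w i) = f' (w i)) -> f =1 f'.
  move=> e x; have [c ->] := hw x; rewrite !linear_sum.
  by apply: eq_bigr => i _; rewrite !linearZ /= e.
exists R, z, H, ev; split=> //.
- move=> r h h' x; apply: (gen _ (mk_linear (zlin r (ev h) (ev h')))) => i /=.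
  by rewrite -!evE linearP !ffunE.
- move=> h h0; apply: (ker0 ki); apply/ffunP => i.
  by rewrite evE h0 ffunE.
- move=> f; have /kE[h hE] : P [ffun i => f (w i)].
    by exists f => i; rewrite ffunE.
  by exists h; apply: gen => i; rewrite -evE hE ffunE.
- by split=> //; [apply: dcc_fg | apply: noeth_fg].
Qed.
End ArtinAlgebra.

(** * Extensions over a hereditary algebra *)

Section Exact.
Variable S : pzRingType.
Implicit Types E F K L M N P Q U V W X Y Z : lmodType S.

Lemma exact0 L M N (i : {linear L -> M}) (p : {linear M -> N}) x :
  exact_at i p -> p (i x) = 0.
Proof. by move=> ex; apply/ex; exists x. Qed.

Lemma projective_lift P M N (g : {linear M -> N}) (h : {linear P -> N}) :
  projective P -> surjective g ->
  exists l : {linear P -> M}, forall x, g (l x) = h x.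
Proof. by move=> pP gs; apply: pP. Qed.

Lemma projective_ext L M N (i : {linear L -> M}) (p : {linear M -> N}) :
  short_exact i p -> projective L -> projective N -> projective M.
Proof.
move=> [ii ex ps] pL pN X Y g h gs.
have [s sE] := projective_lift idfun pN ps.
have [|r rE] := @factor_inj _ L M M i (idfun \- (s \o p : {linear M -> M})) ii.
  by move=> m; apply/ex; rewrite /= linearB (sE (p m)) subrr.
have [a aE] := projective_lift (h \o i : {linear L -> Y}) pL gs.
have [b bE] := projective_lift (h \o s : {linear N -> Y}) pN gs.
exists ((a \o r : {linear M -> X}) \+ (b \o p : {linear M -> X})) => m /=.
by rewrite linearD aE bE /= rE -linearD subrK.
Qed.

Lemma Ext1P X Y : Ext1_zero X Y <->
  forall E (i : {linear Y -> E}) (p : {linear E -> X}), short_exact i p ->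
  exists s : {linear X -> E}, forall x, p (s x) = x.
Proof.
split=> h E i p ses.
  have [phi [/bij_inv[psi [phiK psiK]] _ phi2]] := h E i p ses.
  exists (psi \o pairl \0 idfun : {linear X -> E}) => x /=.
  by rewrite -phi2 psiK.
have [s sE] := h E i p ses; have [ii ex ps] := ses.
have [|r rE] := @factor_inj _ Y E E i (idfun \- (s \o p : {linear E -> E})) ii.
  by move=> m; apply/ex; rewrite /= linearB sE subrr.
have phib : bijective (pairl r p).
  apply: inj_surj_bij => [|[y x]].
    apply: inj0 => e /= [re pe]; have := rE e.
    by rewrite /= re pe !linear0 addr0.
  exists (i y + s x) => /=; have pe : p (i y + s x) = x.
    by rewrite linearD (exact0 _ ex) add0r sE.
  by rewrite pe; congr pair; apply: ii; rewrite rE /= pe addrK.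
exists (pairl r p); split=> // y /=.
rewrite (exact0 _ ex); congr pair; apply: ii.
by rewrite rE /= (exact0 _ ex) linear0 subr0.
Qed.

Lemma section_retraction L M N (i : {linear L -> M}) (p : {linear M -> N})
    (s : {linear N -> M}) : short_exact i p -> (forall x, p (s x) = x) ->
  exists r : {linear M -> L}, (forall y, r (i y) = y) /\
    forall m, i (r m) = m - s (p m).
Proof.
move=> [ii ex ps] sE.
have [|r rE] := @factor_inj _ L M M i (idfun \- (s \o p : {linear M -> M})) ii.
  by move=> m; apply/ex; rewrite /= linearB sE subrr.
exists r; split=> // y; apply: ii.
by rewrite rE /= (exact0 _ ex) linear0 subr0.
Qed.

Lemma Ext1_retraction X Y E (i : {linear Y -> E}) (p : {linear E -> X}) :
  Ext1_zero X Y -> short_exact i p ->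
  exists r : {linear E -> Y}, forall y, r (i y) = y.
Proof.
move=> /Ext1P h ses; have [s sE] := h _ _ _ ses.
by have [r []] := section_retraction ses sE; exists r.
Qed.

Lemma retraction_section L M N (i : {linear L -> M}) (p : {linear M -> N})
    (r : {linear M -> L}) : short_exact i p -> (forall y, r (i y) = y) ->
  exists s : {linear N -> M}, forall x, p (s x) = x.
Proof.
move=> [ii ex ps] rE.
have [|s sE] := @factor_surj _ N M M p (idfun \- (i \o r : {linear M -> M})) ps.
  by move=> m /ex[l <-] /=; rewrite rE subrr.
exists s => x; have [m <-] := ps x.
by rewrite sE /= linearB (exact0 _ ex) subr0.
Qed.

(** Ext^1(X, Y) is the cokernel of restriction Hom(F, Y) -> Hom(L, Y). Projectivity of F describes
    any extension by a map L -> Y, and extending that map to F splits it. *)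
Lemma Ext1_crit2 X Y L F (i : {linear L -> F}) (p : {linear F -> X}) :
  short_exact i p -> projective F ->
  (forall f : {linear L -> Y}, exists g : {linear F -> Y}, forall l, g (i l) = f l) ->
  Ext1_zero X Y.
Proof.
move=> [ii ex ps] pF h; apply/Ext1P => E j q [ji jex qs].
have [t tE] := projective_lift p pF qs.
have [|f fE] := @factor_inj _ Y L E j (t \o i : {linear L -> E}) ji.
  by move=> u; apply/jex; rewrite /= tE (exact0 _ ex).
have [g gE] := h f.
have [|s sE] := @factor_surj _ X F E p (t \- (j \o g : {linear F -> E})) ps.
  by move=> u /ex[l <-] /=; rewrite gE fE subrr.
exists s => x; have [u <-] := ps x.
by rewrite sE /= linearB tE (exact0 _ jex) subr0.
Qed.

Lemma pushout_univ X Y Z E (f : {linear Z -> X}) (g : {linear Z -> Y})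
    (i : {linear X -> E}) (j : {linear Y -> E}) (T : lmodType S)
    (a : {linear X -> T}) (b : {linear Y -> T}) :
  (forall e, exists x y, e = i x + j y) ->
  (forall x y, i x + j y = 0 -> exists z, x = f z /\ y = - g z) ->
  (forall z, a (f z) = b (g z)) ->
  exists h : {linear E -> T}, (forall x, h (i x) = a x) /\ forall y, h (j y) = b y.
Proof.
move=> gen ker ab.
have [e|[x y] /= /ker[z [-> ->]]|h hE] :=
    @factor_surj _ E (X * Y)%type T (copair i j) (copair a b).
- by have [x [y ->]] := gen e; exists (x, y).
- by rewrite linearN ab subrr.
exists h; split=> [x | y].
  by have := hE (x, 0); rewrite /= !linear0 !addr0.
by have := hE (0, y); rewrite /= !linear0 !add0r.
Qed.
End Exact.

(** * Vanishing of Ext^1 over a hereditary artin algebra *)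

Section Hereditary.
Variable A : pzRingType.
Hypotheses (hA : artin_algebra A) (hH : hereditary A).
Implicit Types C D E F K L M N P Q U V W X Y Z : rmod A.

Lemma pushout_ses (L : lmodType A^c) M (N : lmodType A^c) Y
    (i : {linear L -> M}) (p : {linear M -> N}) (f : {linear L -> Y}) :
  short_exact i p ->
  exists E (j : {linear Y -> E}) (t : {linear M -> E}) (q : {linear E -> N}),
  [/\ short_exact j q, forall l, t (i l) = j (f l), forall m, q (t m) = p m
    & forall x y, t x + j y = 0 -> exists l, x = i l /\ y = - f l].
Proof.
move=> [ii ex ps]; have [E [t [j [tj gen ker]]]] := pushout_ex i f.
have [|q [qt qj]] := pushout_univ (a := p) (b := \0) gen ker.
  by move=> l; rewrite (exact0 _ ex).
exists E, j, t, q; split=> //; split.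
- apply: inj0 => y jy; have [|l [/esym/(ker0 ii)-> ->]] := ker 0 y.
    by rewrite linear0 add0r.
  by rewrite linear0 oppr0.
- move=> e; split=> [|[y <-]//]; have [x [y ->]] := gen e.
  rewrite linearD qt qj addr0 => /ex[l <-].
  by exists (f l + y); rewrite tj linearD.
- by move=> n; have [m <-] := ps n; exists (t m).
Qed.

Lemma pullback_ses (L : lmodType A^c) M (N : lmodType A^c) X
    (i : {linear L -> M}) (p : {linear M -> N}) (g : {linear X -> N}) :
  short_exact i p ->
  exists E (j : {linear L -> E}) (q : {linear E -> X}) (t : {linear E -> M}),
  [/\ short_exact j q, forall l, t (j l) = i l, forall e, p (t e) = g (q e),
      forall m x, p m = g x -> exists e, t e = m /\ q e = x
    & forall e, t e = 0 -> q e = 0 -> e = 0].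
Proof.
move=> [ii ex ps]; have [E [t [q [tq gen joint]]]] := pullback_ex hA p g.
have jointi : injective (pairl t q).
  by apply: inj0 => e [te qe]; apply: joint.
have [|j jE] := @factor_inj _ E L (M * X)%type (pairl t q) (pairl i \0) jointi.
  move=> l; have [|e [te qe]] := gen (i l) 0; first by rewrite (exact0 _ ex) linear0.
  by exists e; rewrite /= te qe.
have tj l : t (j l) = i l by have [] := jE l.
have qj l : q (j l) = 0 by have [] := jE l.
exists E, j, q, t; split=> //; split.
- by apply: inj0 => l jl; apply: (ker0 ii); rewrite -tj jl linear0.
- move=> e; split=> [qe | [l <-]//].
  have /ex[l lE] : p (t e) = 0 by rewrite tq qe linear0.
  exists l; apply/eqP; rewrite -subr_eq0; apply/eqP/joint.
    by rewrite linearB tj lE subrr.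
  by rewrite linearB qj qe subrr.
- move=> x; have [m mE] := ps (g x); have [e [_ <-]] := gen _ _ mE.
  by exists e.
Qed.

(** The image of K in one coordinate is a right ideal, hence projective; the kernel lies in a free
    module of smaller rank, and projectivity passes to extensions. *)
Lemma projective_sub_free n (K : lmodType A^c)
    (k : {linear K -> {ffun 'I_n -> (A^c)^o}}) : injective k -> projective K.
Proof.
elim: n K k => [|n IHn] K k ki.
  move=> M N g h gs; exists \0 => x /=; rewrite linear0.
  rewrite (ki x 0) ?linear0//; exact: ffun0_zero.
have [i [p [ii ex ps]]] := ffunS_exact n ((A^c)^o).
pose pk : {linear K -> (A^c)^o} := p \o k.
have [J [j [ji jE]]] := sub_ex (submod_range pk).
have [K0 [k0 [k0i k0E]]] := sub_ex (submod_ker pk).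
have [|e eE] := @factor_inj _ J K (A^c)^o j pk ji.
  by move=> u; apply/jE; exists u.
have [|l lE] := @factor_inj _ {ffun 'I_n -> (A^c)^o} K0 {ffun 'I_n.+1 -> (A^c)^o}
    i (k \o k0 : {linear K0 -> _}) ii.
  by move=> u; apply/ex; apply/k0E; exists u.
apply: (@projective_ext _ K0 K J k0 e).
- split=> //.
  + move=> m; split=> [em | /k0E pkm]; last by apply: ji; rewrite eE pkm linear0.
    by apply/k0E; rewrite -eE em linear0.
  + move=> y; have /jE[x xE] : exists x, j x = j y by exists y.
    by exists x; apply: ji; rewrite eE.
- apply: (IHn _ l); apply: inj0 => x lx; apply: (ker0 k0i); apply: (ker0 ki).
  by rewrite -[k _]lE lx linear0.
- exact: hH ji.
Qed.

Lemma presentation M : exists n L (i : {linear L -> free_rmod A n})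
  (p : {linear free_rmod A n -> M}), short_exact i p.
Proof.
have [n [p ps]] := (fgP M).1 (rmod_fg M).
by have [L [i [ii ex]]] := kernel_ex hA (M := free_rmod A n) p; exists n, L, i, p.
Qed.

(** The pushout along f splits, and its retraction extends f. Here F is arbitrary, unlike in
    [Ext1_crit2]; left approximations rely on this. *)
Lemma Ext1_crit1 (X : lmodType A^c) Y (L : lmodType A^c) F
    (i : {linear L -> F}) (p : {linear F -> X}) :
  short_exact i p -> Ext1_zero X Y ->
  forall f : {linear L -> Y}, exists g : {linear F -> Y}, forall l, g (i l) = f l.
Proof.
move=> ses h f; have [E [j [t [q [ses' tj _ _]]]]] := pushout_ses f ses.
have [r rE] := Ext1_retraction h ses'.
by exists (r \o t : {linear F -> Y}) => l /=; rewrite tj rE.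
Qed.

(** Right exactness of Ext^1(X, -): the relations L of X are projective, so a map L -> N lifts to M,
    where it extends to the free module. *)
Lemma Ext1_quot X M N (g : {linear M -> N}) : surjective g ->
  Ext1_zero X M -> Ext1_zero X N.
Proof.
move=> gs h; have [n [L [i [p ses]]]] := presentation X.
have [ii ex ps] := ses.
apply: (Ext1_crit2 ses); first exact: projective_ffun.
move=> f; have [f' f'E] := projective_lift f (projective_sub_free ii) gs.
have [e eE] := Ext1_crit1 ses h f'.
by exists (g \o e : {linear _ -> N}) => l /=; rewrite eE f'E.
Qed.

(** The preimage of Y in a free cover of D is projective and presents Y with the same relations as
    D, so extensions of maps over the free module restrict to it. *)
Lemma Ext1_sub Y D C (d : {linear Y -> D}) : injective d ->
  Ext1_zero D C -> Ext1_zero Y C.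
Proof.
move=> di h; have [n [L [i [p ses]]]] := presentation D.
have [E [j [q [t [ses' tj pt _ joint]]]]] := pullback_ses d ses.
have ti : injective t.
  apply: inj0 => e te; apply: joint => //.
  by apply: (ker0 di); rewrite -pt te linear0.
apply: (Ext1_crit2 ses'); first exact: (projective_sub_free (n := n) ti).
move=> f; have [g gE] := Ext1_crit1 ses h f.
by exists (g \o t : {linear E -> C}) => l /=; rewrite tj gE.
Qed.

Lemma Ext1_lift (X' : lmodType A^c) X (X'' : lmodType A^c) P
    (i : {linear X' -> X}) (p : {linear X -> X''})
    (h : {linear P -> X''}) : short_exact i p -> Ext1_zero P X' ->
  exists l : {linear P -> X}, forall x, p (l x) = h x.
Proof.
move=> ses /Ext1P e; have [E [j [q [t [ses' tj pt _ _]]]]] := pullback_ses h ses.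
have [s sE] := e _ _ _ ses'.
by exists (t \o s : {linear P -> X}) => x /=; rewrite pt sE.
Qed.

(** A fragment of the long exact sequence: Ext^1(V, Y) lies between Hom(V, U) -> Hom(V, X), which is
    onto, and Ext^1(V, U) = 0. *)
Lemma Ext1_kernel Y U X V (i : {linear Y -> U}) (p : {linear U -> X}) :
  short_exact i p -> Ext1_zero V U ->
  (forall h : {linear V -> X}, exists l : {linear V -> U}, forall v, p (l v) = h v) ->
  Ext1_zero V Y.
Proof.
move=> [ii ex ps] h hl; have [n [L [j [q ses]]]] := presentation V.
have [ji jex qs] := ses.
apply: (Ext1_crit2 ses); first exact: projective_ffun.
move=> f; have [g gE] := Ext1_crit1 ses h (i \o f : {linear L -> U}).
have [|b bE] := @factor_surj _ V (free_rmod A n) X q (p \o g : {linear _ -> X}) qs.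
  by move=> u /jex[l <-] /=; rewrite gE /= (exact0 _ ex).
have [b' b'E] := hl b.
have [|w wE] := @factor_inj _ Y (free_rmod A n) U i
    (g \- (b' \o q : {linear _ -> U})) ii.
  by move=> u; apply/ex; rewrite /= linearB b'E bE subrr.
exists w => l; apply: ii.
by rewrite wE /= gE (exact0 _ jex) linear0 subr0.
Qed.

(* Surjectivity of Ext^1(D, C) -> Ext^1(Y, C) for a submodule Y of D. *)
Lemma extension_extend C Z Y D (c : {linear C -> Z}) (g : {linear Z -> Y})
    (d : {linear Y -> D}) : short_exact c g -> injective d ->
  exists E (j : {linear C -> E}) (q : {linear E -> D}) (w : {linear Z -> E}),
  [/\ short_exact j q, injective w, forall x, w (c x) = j x
    & forall z, q (w z) = d (g z)].
Proof.
move=> [ci cex gs] di; have [n [L [i [p ses]]]] := presentation D.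
have [F [j [q [t [[ji jex qs] tj pt _ joint]]]]] := pullback_ses d ses.
have ti : injective t.
  apply: inj0 => e te; apply: joint => //.
  by apply: (ker0 di); rewrite -pt te linear0.
have [h hE] := projective_lift q (projective_sub_free (n := n) ti) gs.
(* The restriction of [h] to L is a map [a] that classifies the extension Z. As L also gives the
   relations of D, pushing out along [a] over D prolongs Z. *)
have [|a aE] := @factor_inj _ C L Z c (h \o j : {linear L -> Z}) ci.
  by move=> u; apply/cex; rewrite /= hE (exact0 _ jex).
have [E [j' [t' [q' [ses' tj' qt' _]]]]] := pushout_ses a ses.
have [z|[x y] /= e0|w wE] := @factor_surj _ Z (C * F)%type E (copair c h)
    (copair j' (t' \o t : {linear F -> E})).
- have [y yE] := qs (g z).
  have /cex[x xE] : g (z - h y) = 0 by rewrite linearB hE yE subrr.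
  by exists (x, y); rewrite /= xE subrK.
- have := congr1 g e0; rewrite linearD (exact0 _ cex) add0r hE linear0.
  move=> /jex[l lE]; move: e0; rewrite -lE -[h (j l)]aE -linearD.
  move=> /(ker0 ci) /eqP; rewrite addr_eq0 => /eqP->.
  by rewrite tj tj' linearN addNr.
have wc x : w (c x) = j' x by have := wE (x, 0); rewrite /= !linear0 !addr0.
have wh y : w (h y) = t' (t y) by have := wE (0, y); rewrite /= !linear0 !add0r.
have [j'i jex' qs'] := ses'.
have qw z : q' (w z) = d (g z).
  have [y yE] := qs (g z).
  have /cex[x xE] : g (z - h y) = 0 by rewrite linearB hE yE subrr.
  rewrite -[z](subrK (h y)) -xE !linearD wc wh (exact0 _ jex') qt' pt.
  by rewrite (exact0 _ cex) linear0 !add0r hE.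
exists E, j', q', w; split=> //; apply: inj0 => z wz.
have /cex[x xE] : g z = 0 by apply: (ker0 di); rewrite -qw wz linear0.
by rewrite -xE (ker0 j'i (u := x)) ?linear0// -wc xE.
Qed.

Lemma Ext1_prodl X X' Y : Ext1_zero X Y -> Ext1_zero X' Y ->
  Ext1_zero (prod_rmod X X') Y.
Proof.
move=> h h'; apply/Ext1P => E i p ses; have [ii ex ps] := ses.
(* [Ext1_zero] ranges over all modules E, but an extension of finitely generated modules is finitely
   generated and can be packed as an [rmod]. *)
have fgE : finitely_generated E.
  by apply: fg_ext ex ps _ _; exact: rmod_fg.
have [s sE] := @Ext1_lift Y (RMod fgE) _ X i p (pairl idfun \0) ses h.
have [s' s'E] := @Ext1_lift Y (RMod fgE) _ X' i p (pairl \0 idfun) ses h'.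
exists (copair s s') => -[x x'] /=; rewrite linearD sE s'E /=.
by congr pair; rewrite /= ?addr0 ?add0r.
Qed.

Lemma Ext1_prodr X Y Y' : Ext1_zero X Y -> Ext1_zero X Y' ->
  Ext1_zero X (prod_rmod Y Y').
Proof.
move=> h h'; apply/Ext1P => E i p ses; have [ii ex ps] := ses.
have fgE : finitely_generated E.
  by apply: fg_ext ex ps _ _; exact: rmod_fg.
have [r rE] := @Ext1_crit1 X Y _ (RMod fgE) i p ses h fst.
have [r' r'E] := @Ext1_crit1 X Y' _ (RMod fgE) i p ses h' snd.
apply: (retraction_section (r := pairl r r') ses) => -[y y'] /=.
by rewrite rE r'E.
Qed.

Lemma Ext1_iso X X' Y Y' : isomorphic X X' -> isomorphic Y Y' ->
  Ext1_zero X Y -> Ext1_zero X' Y'.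
Proof.
move=> /iso_sym[f fb] [g gb] h; apply: (Ext1_sub (d := f)); first exact: bij_inj.
by apply: (Ext1_quot (g := g)); first exact: bij_surj.
Qed.

Lemma Ext1_zerol (Z : rmod A) Y : is_zero Z -> Ext1_zero Z Y.
Proof.
by move=> h; apply/Ext1P => E i p _; exists \0 => x; rewrite (h x) linear0.
Qed.

Lemma Ext1_zeror (Z : rmod A) Y : is_zero Z -> Ext1_zero Y Z.
Proof.
move=> h; apply/Ext1P => E i p ses; apply: (retraction_section (r := \0) ses) => y.
by rewrite (h y).
Qed.
End Hereditary.

(** * Direct sums and approximations *)

Section DirectSums.
Variable A : pzRingType.
Hypotheses (hA : artin_algebra A) (hH : hereditary A).
Implicit Types C D E F I J K L M N P Q U V W X Y Z : rmod A.

(** Summands without a named complement: these compose directly, while [summand] carries an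
    isomorphism with a product. The two agree by [summandP]. *)
Definition retract (X M : rmod A) : Prop :=
  exists (i : {linear X -> M}) (p : {linear M -> X}), forall x, p (i x) = x.

Lemma retract_refl X : retract X X.
Proof. by exists idfun, idfun. Qed.

Lemma retract_trans Y X Z : retract X Y -> retract Y Z -> retract X Z.
Proof.
move=> [i [p pi]] [j [q qj]].
exists (j \o i : {linear X -> Z}), (p \o q : {linear Z -> X}) => x /=.
by rewrite qj pi.
Qed.

Lemma retract_iso X Y : isomorphic X Y -> retract X Y.
Proof. by move=> [f /bij_inv[g [fg gf]]]; exists f, g. Qed.

Lemma retract_inj X M (i : {linear X -> M}) (p : {linear M -> X}) :
  (forall x, p (i x) = x) -> injective i /\ surjective p.
Proof. by move=> pi; split; [exact: can_inj pi | move=> x; exists (i x)]. Qed.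

Lemma retract_prodl X Y : retract X (prod_rmod X Y).
Proof. by exists (pairl idfun \0 : {linear X -> (X * Y)%type}), fst. Qed.

Lemma retract_prodr X Y : retract Y (prod_rmod X Y).
Proof. by exists (pairl \0 idfun : {linear Y -> (X * Y)%type}), snd. Qed.

Lemma retract_compl X M (i : {linear X -> M}) (p : {linear M -> X}) :
  (forall x, p (i x) = x) ->
  exists Y (j : {linear Y -> M}), [/\ short_exact j p
    & isomorphic (prod_rmod X Y) M].
Proof.
move=> pi; have [Y [j [ji jex]]] := kernel_ex hA p.
exists Y, j; split; first by split=> // x; exists (i x).
exists (copair i j); apply: inj_surj_bij.
  apply: inj0 => -[x y] /= e; have x0 : x = 0.
    by have := congr1 p e; rewrite linearD pi (exact0 _ jex) addr0 linear0.
  by move: e; rewrite x0 linear0 add0r => /(ker0 ji) ->.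
move=> m; have /jex[y yE] : p (m - i (p m)) = 0 by rewrite linearB pi subrr.
by exists (p m, y); rewrite /= yE addrC subrK.
Qed.

Lemma summandP X M : summand X M <-> retract X M.
Proof.
split=> [[Y XY] | [i [p pi]]].
  by apply: (@retract_trans (prod_rmod X Y)); [exact: retract_prodl | exact: retract_iso].
by have [Y [j [_ iso]]] := retract_compl pi; exists Y.
Qed.

Lemma zero_rmod_zero : is_zero (zero_rmod A).
Proof. by move=> x; exact: ffun0_zero. Qed.

Lemma zero_iso X Y : is_zero X -> is_zero Y -> isomorphic X Y.
Proof.
move=> hX hY; apply: (@iso_of _ _ _ (\0 : {linear X -> Y}) (\0 : {linear Y -> X})).
  by move=> x; rewrite (hX x).
by move=> y; rewrite (hY y).
Qed.

Lemma iso_prod X X' Y Y' : isomorphic X X' -> isomorphic Y Y' ->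
  isomorphic (prod_rmod X Y) (prod_rmod X' Y').
Proof.
move=> [f /bij_inv[g [fg gf]]] [f' /bij_inv[g' [fg' gf']]].
apply: (@iso_of _ _ _
  (pairl (f \o fst : {linear (X * Y)%type -> X'}) (f' \o snd : {linear (X * Y)%type -> Y'}))
  (pairl (g \o fst : {linear (X' * Y')%type -> X}) (g' \o snd : {linear (X' * Y')%type -> Y})))
  => -[x y] /=; congr pair => //=; by rewrite ?fg ?fg' ?gf ?gf'.
Qed.

Lemma iso_prodA X Y Z :
  isomorphic (prod_rmod X (prod_rmod Y Z)) (prod_rmod (prod_rmod X Y) Z).
Proof.
apply: (@iso_of _ (prod_rmod X (prod_rmod Y Z)) (prod_rmod (prod_rmod X Y) Z)
  (pairl (pairl fst (fst \o snd : {linear (X * (Y * Z))%type -> Y}))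
         (snd \o snd : {linear (X * (Y * Z))%type -> Z}))
  (pairl (fst \o fst : {linear ((X * Y) * Z)%type -> X})
         (pairl (snd \o fst : {linear ((X * Y) * Z)%type -> Y}) snd))).
  by move=> [x [y z]].
by move=> [[x y] z].
Qed.

Lemma iso_prodC X Y : isomorphic (prod_rmod X Y) (prod_rmod Y X).
Proof.
by apply: (@iso_of _ (prod_rmod X Y) (prod_rmod Y X) (pairl snd fst) (pairl snd fst));
  move=> [].
Qed.

Lemma iso_prod0 X Z : is_zero Z -> isomorphic (prod_rmod Z X) X.
Proof.
move=> hZ.
apply: (@iso_of _ (prod_rmod Z X) X snd (pairl \0 idfun)) => // -[z x] /=.
by rewrite (hZ z).
Qed.

(** Direct sums by recursion on a list, which makes closure properties inductions; [direct_sum_dsum]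
    relates them to the definition by unique decompositions. *)
Definition dsum (I : Type) (F : I -> rmod A) (s : seq I) : rmod A :=
  foldr (fun i M => prod_rmod (F i) M) (zero_rmod A) s.

Lemma dsum_map (I J : Type) (F : I -> rmod A) (g : J -> I) s :
  dsum (F \o g) s = dsum F (map g s).
Proof. by elim: s => //= j s ->. Qed.

Lemma dchoice (I : Type) (B : I -> Type) (P : forall i, B i -> Prop) :
  (forall i, exists b, P i b) -> exists f : forall i, B i, forall i, P i (f i).
Proof. by move=> h; exists (fun i => sval (cid (h i))) => i; apply: svalP. Qed.

Lemma direct_sumP n (F : 'I_n -> rmod A) M : direct_sum F M <->
  exists (iota : forall i, {linear F i -> M}) (pi : forall i, {linear M -> F i}),
  [/\ forall i x, pi i (iota i x) = x,
      forall i j x, i != j -> pi j (iota i x) = 0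
    & forall m, m = \sum_i iota i (pi i m)].
Proof.
split=> [[iota h] | [iota [pi [h1 h2 h3]]]]; last first.
  exists iota => m; exists (fun i => pi i m); split; first exact: h3.
  move=> x mE; apply: functional_extensionality_dep => j.
  rewrite mE linear_sum (bigD1 j)//= h1 big1 ?addr0// => i ij.
  exact: h2.
have uniq (x y : forall i, F i) :
    \sum_i iota i (x i) = \sum_i iota i (y i) -> x = y.
  by move=> e; have [z [_ zu]] := h (\sum_i iota i (x i)); rewrite -(zu x)// (zu y).
have /dchoice[pi piE] (j : 'I_n) : exists p : {linear M -> F j}, forall m,
    exists x, m = \sum_i iota i (x i) /\ x j = p m.
  apply: (@lin_graph _ M (F j) (fun m y => exists x, m = \sum_i iota i (x i) /\ x j = y)).
  - move=> a u u' v v' [x [-> <-]] [x' [-> <-]].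
    exists (fun i => a *: x i + x' i); split=> //.
    by rewrite scaler_sumr -big_split; apply: eq_bigr => i _; rewrite linearP.
  - by move=> m; have [x [xE _]] := h m; exists (x j), x.
  - move=> v [x [e <-]]; rewrite (uniq x (fun i => 0))// -e big1// => i _.
    by rewrite linear0.
have piS (x : forall i, F i) j : pi j (\sum_i iota i (x i)) = x j.
  by have [y [/uniq -> ->]] := piE j (\sum_i iota i (x i)).
have single i (y : F i) : iota i y =
    \sum_j iota j (dfwith (fun j => 0 : F j) y j).
  rewrite (bigD1 i)//= dfwith_in big1 ?addr0// => j ji.
  by rewrite dfwith_out ?linear0// eq_sym.
exists iota, pi; split.
- by move=> i x; rewrite single piS dfwith_in.
- by move=> i j x ij; rewrite single piS dfwith_out.
- move=> m; have [x [-> _]] := h m; apply: eq_bigr => i _.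
  by rewrite piS.
Qed.

Lemma direct_sum0 (F : 'I_0 -> rmod A) M : direct_sum F M <-> is_zero M.
Proof.
split=> [/direct_sumP[iota [pi [_ _ h]]] m | h]; first by rewrite (h m) big_ord0.
apply/direct_sumP; exists (fun _ => \0), (fun _ => \0); split=> [[]//|[]//|m].
by rewrite big_ord0 (h m).
Qed.

Lemma direct_sum_iso n (F : 'I_n -> rmod A) M M' : isomorphic M M' ->
  direct_sum F M -> direct_sum F M'.
Proof.
move=> [f /bij_inv[g [fg gf]]] /direct_sumP[iota [pi [h1 h2 h3]]].
apply/direct_sumP; exists (fun i => f \o iota i : {linear _ -> M'}),
  (fun i => pi i \o g : {linear M' -> _}); split.
- by move=> i x /=; rewrite fg h1.
- by move=> i j x ij /=; rewrite fg h2.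
- by move=> m; rewrite -[LHS]gf {1}(h3 (g m)) linear_sum.
Qed.

Lemma direct_sumS n (F : 'I_n.+1 -> rmod A) M : direct_sum F M ->
  exists M', direct_sum (fun j => F (lift ord0 j)) M' /\
    isomorphic (prod_rmod (F ord0) M') M.
Proof.
move=> /direct_sumP[iota [pi [h1 h2 h3]]].
have [M' [k [[ki kex _] iso]]] := retract_compl (h1 ord0).
exists M'; split=> //.
have nl (j : 'I_n) : ord0 != lift ord0 j by rewrite -val_eqE.
have /dchoice[iota' iE] (j : 'I_n) : exists i' : {linear F (lift ord0 j) -> M'},
    forall x, k (i' x) = iota (lift ord0 j) x.
  by apply: factor_inj => // x; apply/kex/h2; rewrite eq_sym.
apply/direct_sumP; exists iota',
  (fun j => pi (lift ord0 j) \o k : {linear M' -> _}); split.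
- by move=> j x; rewrite /= iE h1.
- by move=> i j x ij; rewrite /= iE h2// (inj_eq lift_inj).
- move=> m; apply: ki; rewrite linear_sum [LHS]h3 big_ord_recl (exact0 _ kex) linear0 add0r.
  by apply: eq_bigr => j _; rewrite /= iE.
Qed.

Lemma direct_sum_cons n (F : 'I_n.+1 -> rmod A) M' M :
  direct_sum (fun j => F (lift ord0 j)) M' ->
  isomorphic (prod_rmod (F ord0) M') M -> direct_sum F M.
Proof.
move=> /direct_sumP[iota [pi [h1 h2 h3]]] iso; apply: direct_sum_iso iso _.
(* Injection and projection are chosen through their properties, since a definition by cases on
   [unlift ord0 i] would need transports in the dependent type [F i]. *)
have /dchoice[ip ipE] (i : 'I_n.+1) : exists ip :
    {linear F i -> prod_rmod (F ord0) M'} * {linear prod_rmod (F ord0) M' -> F i},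
    (forall x, ip.2 (ip.1 x) = x) /\
    match unlift ord0 i with
    | None => (forall x, (ip.1 x).2 = 0) /\ (forall m, ip.1 (ip.2 m) = (m.1, 0)) /\
       (forall m, m.1 = 0 -> ip.2 m = 0)
    | Some j => (forall x, (ip.1 x).1 = 0) /\
       (forall m, ip.1 (ip.2 m) = (0, iota j (pi j m.2))) /\
       (forall m, pi j m.2 = 0 -> ip.2 m = 0) /\
       forall x, exists y, (ip.1 x).2 = iota j y
    end.
  case: unliftP => [j|] ->.
    exists (pairl \0 (iota j) : {linear _ -> (_ * M')%type},
            pi j \o snd : {linear (F ord0 * M')%type -> _}).
    do !split=> //; first exact: h1.
    by move=> x; exists x.
  exists (pairl idfun \0 : {linear _ -> (_ * M')%type},
          fst : {linear (F ord0 * M')%type -> _}).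
  by do !split.
apply/direct_sumP; exists (fun i => (ip i).1), (fun i => (ip i).2); split.
- by move=> i x; have [-> _] := ipE i.
- move=> i j x ij.
  have [_ hj] := ipE j; have [_ hi] := ipE i.
  case: unliftP hj hi => [j'|] jE; case: unliftP => [i'|] iE.
  + move=> [_ [_ [hj _]]] [hi [_ [_ hi2]]]; apply: hj.
    have [y ->] := hi2 x; apply: h2.
    by rewrite -(inj_eq (@lift_inj _ ord0)) -iE -jE.
  + by move=> [_ [_ [hj _]]] [hi _]; apply: hj; rewrite hi linear0.
  + by move=> [_ [_ hj]] [hi _]; apply: hj; rewrite hi.
  + by move=> _ _; case/eqP: ij; rewrite iE jE.
- move=> [x m]; rewrite big_ord_recl.
  have [_] := ipE ord0; rewrite unlift_none => -[_ [-> _]].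
  rewrite (eq_bigr (fun j => (0, iota j (pi j m)))); last first.
    by move=> j _; have [_] := ipE (lift ord0 j); rewrite liftK => -[_ [-> _]].
  have -> : \sum_j ((0, iota j (pi j m)) : prod_rmod (F ord0) M') = (0, m).
    rewrite {2}(h3 m); elim/big_rec2: _ => // j y z _ ->.
    by congr pair; rewrite /= addr0.
  by congr pair; rewrite /= ?addr0 ?add0r.
Qed.

Lemma direct_sum_dsum n (F : 'I_n -> rmod A) M :
  direct_sum F M <-> isomorphic (dsum F (enum 'I_n)) M.
Proof.
elim: n F M => [|n IHn] F M.
  rewrite direct_sum0 (size0nil (size_enum_ord 0)) /=.
  split=> [h | [f /bij_inv[g [_ gf]]] m]; first exact: zero_iso zero_rmod_zero h.
  by rewrite -(gf m) (zero_rmod_zero (g m)) linear0.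
rewrite enum_ordSl /= -dsum_map; split=> [/direct_sumS[M' [h iso]] | h].
  apply: iso_trans _ iso; apply: iso_prod; first exact: iso_refl.
  by apply/IHn.
apply: direct_sum_cons h; apply/IHn; exact: iso_refl.
Qed.

Definition iso_closed (C : rmod A -> Prop) := forall X Y, C X -> isomorphic X Y -> C Y.
Definition prod_closed (C : rmod A -> Prop) :=
  C (zero_rmod A) /\ forall X Y, C X -> C Y -> C (prod_rmod X Y).
Definition retract_closed (C : rmod A -> Prop) := forall X Y, C Y -> retract X Y -> C X.

Lemma retract_iso_closed (C : rmod A -> Prop) : retract_closed C -> iso_closed C.
Proof. by move=> h X Y CX /iso_sym/retract_iso; apply: h. Qed.

Lemma subcategoryP (C : rmod A -> Prop) :
  subcategory C <-> prod_closed C /\ retract_closed C.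
Proof.
split=> [[h1 h2 h3] | [[h0 hp] hr]].
  split; last by move=> X Y CY /summandP; apply: h3.
  split=> [|X Y CX CY].
    apply: (h2 0%N (fun=> zero_rmod A)) => [[]//|].
    by apply/direct_sum0; apply: zero_rmod_zero.
  apply: (h2 2%N (fun i => if i == ord0 then X else Y)).
    by move=> i; case: ifP.
  apply/direct_sum_dsum; rewrite 2!enum_ordSl (size0nil (size_enum_ord 0)).
  rewrite [dsum _ _](_ : _ = prod_rmod X (prod_rmod Y (zero_rmod A)))//.
  apply: iso_prod; first exact: iso_refl.
  apply: iso_trans (iso_prodC _ _) (iso_prod0 _ zero_rmod_zero).
have hi := retract_iso_closed hr.
split=> //; last by move=> X M CM /summandP; apply: hr.
move=> n F M CF /direct_sum_dsum; apply: hi.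
by elim: (enum _) => //= i s; apply: hp.
Qed.

Definition upow n U : rmod A := iter n (prod_rmod U) (zero_rmod A).

Lemma dsum_const (T : Type) U (s : seq T) : dsum (fun=> U) s = upow (size s) U.
Proof. by elim: s => //= i s ->. Qed.

Lemma addP U X : add U X <-> exists n, retract X (upow n U).
Proof.
split=> [[n [M [/direct_sum_dsum iso /summandP XM]]] | [n Xn]].
  exists n; apply: retract_trans XM _; apply/retract_iso/iso_sym.
  by move: iso; rewrite dsum_const size_enum_ord.
exists n, (upow n U); split; last exact/summandP.
by apply/direct_sum_dsum; rewrite dsum_const size_enum_ord; apply: iso_refl.
Qed.

Lemma add_retract U : retract_closed (add U).
Proof.
move=> X Y /addP[n Yn] XY; apply/addP; exists n; exact: retract_trans XY Yn.
Qed.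

Lemma add_self U : add U U.
Proof. by apply/addP; exists 1%N; apply: retract_prodl. Qed.

Lemma retract_prod X X' Y Y' : retract X X' -> retract Y Y' ->
  retract (prod_rmod X Y) (prod_rmod X' Y').
Proof.
move=> [i [p pi]] [j [q qj]].
exists (pairl (i \o fst : {linear (X * Y)%type -> X'}) (j \o snd : {linear (X * Y)%type -> Y'})),
  (pairl (p \o fst : {linear (X' * Y')%type -> X}) (q \o snd : {linear (X' * Y')%type -> Y})).
by move=> [x y] /=; rewrite pi qj.
Qed.

Lemma upowD m n U : isomorphic (prod_rmod (upow m U) (upow n U)) (upow (m + n) U).
Proof.
elim: m => [|m IH] /=; first exact: iso_prod0 zero_rmod_zero.
apply: iso_trans (iso_sym (iso_prodA _ _ _)) _.
apply: iso_prod => //; exact: iso_refl.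
Qed.

Lemma add_prod U : prod_closed (add U).
Proof.
split=> [|X Y /addP[m Xm] /addP[n Yn]]; first by apply/addP; exists 0%N; apply: retract_refl.
apply/addP; exists (m + n)%N; apply: retract_trans _ (retract_iso (upowD _ _ _)).
exact: retract_prod.
Qed.

(** The induction principle for [add U]: a property of all its modules is checked on zero, products,
    retracts and U. *)
Lemma add_min U (C : rmod A -> Prop) : prod_closed C -> retract_closed C -> C U ->
  forall X, add U X -> C X.
Proof.
move=> [C0 Cp] Cr CU X /addP[n]; apply: Cr.
by elim: n => //= n IH; apply: Cp.
Qed.

Lemma add_sub U V : add U V -> forall X, add V X -> add U X.
Proof. by apply: add_min; [apply: add_prod | apply: add_retract]. Qed.

(** The approximation is U^m -> X, with components generating Hom(U, X) over R; a map U -> X factors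
    through it by scalars of R, which are endomorphisms of U. *)
Lemma add_approx U X : exists V (f : {linear V -> X}), add U V /\
  forall W (h : {linear W -> X}), add U W ->
    exists t : {linear W -> V}, forall w, f (t w) = h w.
Proof.
have [R [z [H [ev [evl evi evs [[m [g hg]] _ _] central]]]]] := hom_module hA U X.
have zlin r a (u v : U) : z r *: (a *: u + v) = a *: (z r *: u) + z r *: v.
  by rewrite scalerDr !scalerA central.
have [V [f [fV fE]]] : exists V (f : {linear V -> X}), add U V /\
    forall c : 'I_m -> R, exists t : {linear U -> V}, forall u,
      f (t u) = \sum_i z (c i) *: ev (g i) u.
  elim: m g {hg} => [|m IH] g.
    exists (zero_rmod A), \0; split; first by case: (add_prod U).
    by move=> c; exists \0 => u; rewrite big_ord0.
  have [V [f [fV fE]]] := IH (fun i => g (lift ord0 i)).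
  exists (prod_rmod U V), (copair (ev (g ord0)) f); split.
    by apply: (add_prod U).2 => //; apply: add_self.
  move=> c; have [t tE] := fE (fun i => c (lift ord0 i)).
  exists (pairl (mk_linear (zlin (c ord0))) t) => u.
  by rewrite big_ord_recl /= tE linearZ.
exists V, f; split=> // W + AW; move: W AW; apply: add_min.
- split=> [h | X' Y' hX hY h].
    by exists \0 => w; rewrite (zero_rmod_zero w) !linear0.
  have [t tE] := hX (h \o pairl idfun \0 : {linear X' -> X}).
  have [t' t'E] := hY (h \o pairl \0 idfun : {linear Y' -> X}).
  exists (copair t t') => -[x y] /=; rewrite linearD tE t'E /= -linearD.
  by congr (h (_, _)); rewrite /= ?addr0 ?add0r.
- move=> X' Y' hY [i [p pi]] h.
  have [t tE] := hY (h \o p : {linear Y' -> X}).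
  by exists (t \o i : {linear X' -> V}) => x; rewrite /= tE /= pi.
- move=> h; have [h0 hE] := evs h; have [c cE] := hg h0.
  have [t tE] := fE c; exists t => u; rewrite tE -hE cE.
  elim/big_rec2: _ => [|i x y _ ->]; last by rewrite evl.
  have [e eE] := evs \0; have e0 : e = 0 by apply: evi => v; rewrite eE.
  by have := eE u; rewrite e0.
Qed.

Lemma Ext1_addl U V Y : Ext1_zero U Y -> add U V -> Ext1_zero V Y.
Proof.
move=> h; move: V; apply: add_min => //.
- split=> [|X X']; first by apply: Ext1_zerol; apply: zero_rmod_zero.
  exact: Ext1_prodl.
- move=> X X' h' [i [p /retract_inj[ii _]]]; exact: Ext1_sub ii h'.
Qed.

Lemma Ext1_addr U V X : Ext1_zero X U -> add U V -> Ext1_zero X V.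
Proof.
move=> h; move: V; apply: add_min => //.
- split=> [|Y Y']; first by apply: Ext1_zeror; apply: zero_rmod_zero.
  exact: Ext1_prodr.
- move=> Y Y' h' [i [p /retract_inj[_ ps]]]; exact: Ext1_quot ps h'.
Qed.

(** The class usually written Fac U. *)
Definition gen U X := exists V (f : {linear V -> X}), add U V /\ surjective f.

Lemma gen_quot U X Y (f : {linear X -> Y}) : surjective f -> gen U X -> gen U Y.
Proof.
move=> fs [V [g [aV gs]]]; exists V, (f \o g : {linear V -> Y}); split=> // y.
by have [x <-] := fs y; have [v <-] := gs x; exists v.
Qed.

Lemma gen_add U X : add U X -> gen U X.
Proof. by move=> h; exists X, idfun; split=> // x; exists x. Qed.

Lemma gen_prod U X Y : gen U X -> gen U Y -> gen U (prod_rmod X Y).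
Proof.
move=> [V [f [aV fs]]] [W [g [aW gs]]]; exists (prod_rmod V W),
  (pairl (f \o fst : {linear (V * W)%type -> X}) (g \o snd : {linear (V * W)%type -> Y})).
split; first exact: (add_prod U).2.
by move=> [x y]; have [v <-] := fs x; have [w <-] := gs y; exists (v, w).
Qed.

Lemma gen_trans U U' X : gen U U' -> gen U' X -> gen U X.
Proof.
move=> h [V [f [aV fs]]]; apply: (gen_quot fs); move: V aV {f fs}.
apply: add_min => //.
- split; first by apply: gen_add; case: (add_prod U).
  exact: gen_prod.
- move=> Y Y' h' [i [p /retract_inj[_ ps]]]; exact: gen_quot ps h'.
Qed.

Lemma Ext1_gen X U Y : Ext1_zero X U -> gen U Y -> Ext1_zero X Y.
Proof.
by move=> h [V [f [aV fs]]]; apply: Ext1_quot fs _ => //; apply: Ext1_addr h aV.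
Qed.

(** Since U is rigid and L is generated by U, Ext^1(V, L) = 0 for the cover V of N. The cover lifts
    to M, and L together with V maps onto M. *)
Lemma gen_ext U L M N (i : {linear L -> M}) (p : {linear M -> N}) :
  rigid U -> short_exact i p -> gen U L -> gen U N -> gen U M.
Proof.
move=> rU ses gL [V [f [aV fs]]]; have [ii ex ps] := ses.
have [l lE] := Ext1_lift hA f ses (Ext1_addl (Ext1_gen rU gL) aV).
apply: (@gen_quot U (prod_rmod L V) M (copair i l)); last first.
  by apply: gen_prod => //; apply: gen_add.
move=> m; have [v vE] := fs (p m).
have /ex[y yE] : p (m - l v) = 0 by rewrite linearB lE vE subrr.
by exists (y, v); rewrite /= yE subrK.
Qed.

Lemma gen_approx U X : exists V (f : {linear V -> X}) I (e : {linear V -> I})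
    (m : {linear I -> X}),
  [/\ add U V, surjective e, injective m, f =1 m \o e
    & forall W (h : {linear W -> X}), add U W ->
      exists t : {linear W -> V}, forall w, f (t w) = h w].
Proof.
have [V [f [aV fE]]] := add_approx U X.
by have [I [e [m [es mi fme]]]] := image_ex f; exists V, f, I, e, m.
Qed.

Lemma gen_cover U X : gen U X -> exists V Y (i : {linear Y -> V}) (f : {linear V -> X}),
  [/\ add U V, short_exact i f & forall W (h : {linear W -> X}), add U W ->
      exists t : {linear W -> V}, forall w, f (t w) = h w].
Proof.
move=> [W [g [aW gs]]]; have [V [f [aV fE]]] := add_approx U X.
have [Y [i [ii iex]]] := kernel_ex hA f; exists V, Y, i, f; split=> //.
split=> // x; have [w <-] := gs x; have [t tE] := fE W g aW.
by exists (t w).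
Qed.

Lemma cokP U X : cok U X <-> exists V Y (i : {linear Y -> V}) (q : {linear V -> X}),
  [/\ short_exact i q, add U V & gen U Y].
Proof.
split=> [[U1 [U0 [f [q [a1 a0 ex qs]]]]] | [V [Y [i [q [[ii ex qs] aV [W [f [aW fs]]]]]]]]].
  have [I [e [m [es mi fE]]]] := image_ex f.
  exists U0, I, m, q; split=> //; last by exists U1, e.
  split=> // y; rewrite ex; split=> [[u <-] | [x <-]]; first by exists (e u); rewrite fE.
  by have [u <-] := es x; exists u; rewrite fE.
exists W, V, (i \o f : {linear W -> V}), q; split=> // v; rewrite ex.
by split=> [[y <-] | [w <-]]; [have [w <-] := fs y; exists w | exists (f w)].
Qed.

Lemma cok_gen U X : cok U X -> gen U X.
Proof. by move=> [U1 [U0 [f [q [a1 a0 ex qs]]]]]; exists U0, q. Qed.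

Lemma cok_add U X : add U X -> cok U X.
Proof.
move=> aX; exists (zero_rmod A), X, \0, idfun; split=> //.
- by case: (add_prod U).
- by move=> x; split=> [/= -> | [y <-]//]; exists 0.
- by move=> x; exists x.
Qed.

(** * Kernels of approximations by a rigid module *)

Section Rigid.
Variable P : rmod A.
Hypothesis rP : rigid P.

(** [Ext1_kernel] applies: P is rigid, so W has no extensions by V, and maps from W lift along the
    approximation. *)
Lemma cover_kernel_Ext X V Y (i : {linear Y -> V}) (f : {linear V -> X}) :
  add P V -> short_exact i f ->
  (forall W (h : {linear W -> X}), add P W ->
      exists t : {linear W -> V}, forall w, f (t w) = h w) ->
  forall W, add P W -> Ext1_zero W Y.
Proof.
move=> aV ses fE W aW; apply: (Ext1_kernel hA ses).
  by apply: Ext1_addl aW; apply: Ext1_addr aV.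
by move=> h; apply: fE.
Qed.

(* With E the preimage of X in a cover U of Z, the fibre product of E and V
   over X is an extension of E by Y and of V by a module in gen P; both split,
   the first because E embeds in U, so Y is a quotient of a module in gen P. *)
Lemma cover_kernel_gen X Z V Y (i : {linear Y -> V}) (f : {linear V -> X})
    (m : {linear X -> Z}) :
  cok P Z -> injective m -> add P V -> short_exact i f ->
  (forall W (h : {linear W -> X}), add P W ->
      exists t : {linear W -> V}, forall w, f (t w) = h w) ->
  gen P Y.
Proof.
move=> /cokP[U [Z' [j [q [sesZ aU gZ']]]]] mi aV ses fE.
have [E [j' [q' [t [sesE tj qt joint0 joint]]]]] := pullback_ses hA m sesZ.
have ti : injective t.
  apply: inj0 => e te; apply: joint => //.
  by apply: (ker0 mi); rewrite -qt te linear0.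
have EY : Ext1_zero E Y.
  apply: (Ext1_sub hA hH ti).
  by apply: (cover_kernel_Ext aV ses fE).
have [F [a [b [c [sesF ca fc fib jointF]]]]] := pullback_ses hA q' ses.
have [r rE] := Ext1_retraction EY sesF.
have rs : surjective r by move=> y; exists (a y); rewrite rE.
apply: (gen_quot rs).
have [_ exE _] := sesE.
have [|t0 t0E] := Ext1_lift hA (m \o f : {linear V -> Z}) sesZ.
  by apply: Ext1_addl aV; apply: Ext1_gen gZ'.
have [|s sE] := @factor_inj _ E V U t t0 ti.
  by move=> v; have [e [<- _]] := joint0 _ _ (t0E v); exists e.
have q's v : q' (s v) = f v by apply: mi; rewrite -qt sE t0E.
have bci : injective (pairl b c) by apply: inj0 => x [bx cx]; apply: jointF.
have [[z v]|g gE] := @factor_inj _ F (Z' * V)%type (E * V)%type (pairl b c)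
    (pairl (copair j' s) snd) bci.
  have [|x [cx bx]] := fib v (j' z + s v); last by exists x; rewrite /= cx bx.
  by rewrite linearD (exact0 _ exE) add0r q's.
apply: (@gen_quot P (prod_rmod Z' V) F g _ (gen_prod gZ' (gen_add aV))) => x.
have /exE[z zE] : q' (b x - s (c x)) = 0.
  by rewrite linearB q's fc subrr.
by exists (z, c x); apply: bci; rewrite gE /= zE subrK.
Qed.
End Rigid.
End DirectSums.

(** * Rigid modules and wide hulls *)

Section RigidModules.
Variable A : pzRingType.
Hypotheses (hA : artin_algebra A) (hH : hereditary A).
Implicit Types C D E F I J K L M N P Q U V W X Y Z : rmod A.

Section Rigid.
Variable P : rmod A.
Hypothesis rP : rigid P.

Lemma cok_sub X Z (m : {linear X -> Z}) :
  gen P X -> cok P Z -> injective m -> cok P X.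
Proof.
move=> gX cZ mi; have [V [Y [i [f [aV ses fE]]]]] := gen_cover hA gX.
apply/cokP; exists V, Y, i, f; split=> //.
exact: (cover_kernel_gen hA hH rP cZ mi aV ses fE).
Qed.

(** [cover_kernel_gen] with X itself as the ambient object gives Y in [gen P]; since Y embeds in V,
    it even lies in [cok P], which yields enough Ext-projectives. *)
Lemma cok_cover X : cok P X -> exists V Y (i : {linear Y -> V}) (f : {linear V -> X}),
  [/\ add P V, short_exact i f & cok P Y].
Proof.
move=> cX; have [V [Y [i [f [aV ses fE]]]]] := gen_cover hA (cok_gen cX).
exists V, Y, i, f; split=> //.
have gY : gen P Y.
  by apply: (cover_kernel_gen hA hH rP (m := idfun : {linear X -> X}) cX _ aV ses fE).
by have [ii _ _] := ses; apply: (cok_sub gY (cok_add hA aV) ii).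
Qed.

(** Horseshoe argument, with Ext^1(V', X) = 0 in place of projectivity of V'. The kernel of the
    combined cover is an extension of Y' by Y, so [gen_ext] applies. *)
Lemma cok_closed_extensions : closed_extensions (cok P).
Proof.
move=> X E Z f g /cokP[V [Y [i [p [sX aV gY]]]]]
  /cokP[V' [Y' [i' [p' [sZ aV' gY']]]]] ses.
have [ii iex ps] := sX; have [ii' iex' ps'] := sZ; have [fi fex gs] := ses.
have [|l lE] := Ext1_lift hA p' ses.
  by apply: (Ext1_addl hA hH _ aV'); apply: (Ext1_gen hA hH rP); exists V, p.
pose q := copair (f \o p : {linear V -> E}) l.
have qs : surjective q.
  move=> e; have [v' v'E] := ps' (g e).
  have /fex[x xE] : g (e - l v') = 0 by rewrite linearB lE v'E subrr.
  by have [v vE] := ps x; exists (v, v'); rewrite /= vE xE subrK.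
have [K [k [ki kex]]] := @kernel_ex A hA (prod_rmod V V') E q.
have kq x : q (k x) = 0 by apply: exact0 kex.
have gqE v : g (q v) = p' v.2 by rewrite /= linearD lE (exact0 _ fex) add0r.
have [|b bE] := @factor_inj _ Y' K V' i' (snd \o k : {linear K -> V'}) ii'.
  by move=> x; apply/iex'; rewrite -[LHS]gqE kq linear0.
have [|a aE] := @factor_inj _ K Y (V * V')%type k (pairl i \0) ki.
  by move=> y; apply/kex; rewrite /= (exact0 _ iex) !linear0 addr0.
apply/cokP; exists (prod_rmod V V'), K, k, q; split=> //.
  by apply: (add_prod hA P).2.
apply: (gen_ext hA hH rP (i := a) (p := b) _ gY gY'); split.
- apply: inj0 => y ay; apply: (ker0 ii).
  by have := aE y; rewrite ay linear0 => -[].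
- move=> x; split=> [bx | [y <-]]; last first.
    by apply: ii'; rewrite bE linear0 /= aE.
  have kx2 : (k x).2 = 0 by have := bE x; rewrite bx linear0.
  have /iex[y yE] : p (k x).1 = 0.
    by apply: (ker0 fi); have := kq x; rewrite /= kx2 linear0 addr0.
  by exists y; apply: ki; rewrite aE /= yE -kx2 -surjective_pairing.
- move=> y'; have /fex[x xE] : g (l (i' y')) = 0 by rewrite lE (exact0 _ iex').
  have [v vE] := ps (- x).
  have /kex[z zE] : q (v, i' y') = 0.
    by rewrite /= vE linearN xE addNr.
  by exists z; apply: ii'; rewrite bE /= zE.
Qed.

Lemma cok_prod_closed : prod_closed (cok P).
Proof.
split; first by apply: cok_add => //; case: (add_prod hA P).
move=> X Y cX cY; apply: (@cok_closed_extensions X (prod_rmod X Y) Y (pairl idfun \0) snd) => //.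
split.
- by move=> x x' /= [].
- by move=> [x y]; split=> /= [-> | [x' [_ <-]]//]; exists x.
- by move=> y; exists (0, y).
Qed.

Lemma cok_retract_closed : retract_closed (cok P).
Proof.
move=> X Y cY [i [p /retract_inj[ii ps]]].
by apply: (cok_sub _ cY ii); apply: (gen_quot ps); apply: cok_gen.
Qed.

Lemma cok_ICE : ICE_closed (cok P).
Proof.
split.
- by apply/(subcategoryP hA); split; [exact: cok_prod_closed | exact: cok_retract_closed].
- move=> X I Y f e m cX cY es mi _; apply: (cok_sub _ cY mi).
  by apply: (gen_quot es); apply: cok_gen.
- move=> X Y Z f q cX /cokP[V [Y' [i [p [sY aV gY']]]]] ex qs.
  have [ii iex ps] := sY.
  have [I [e [m [es mi fE]]]] := image_ex f.
  (* The kernel of V -> Y -> Z is an extension of the image of f by the kernel Y' of V -> Y, and P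
     generates both. *)
  have [K [k [ki kex]]] := kernel_ex hA (q \o p : {linear V -> Z}).
  apply/cokP; exists V, K, k, (q \o p : {linear V -> Z}); split=> //.
    split=> // z; have [y <-] := qs z; have [v <-] := ps y.
    by exists v.
  have [|a aE] := @factor_inj _ K Y' V k i ki.
    by move=> y; apply/kex; rewrite /= (exact0 _ iex) linear0.
  have [|b bE] := @factor_inj _ I K Y m (p \o k : {linear K -> Y}) mi.
    move=> x /=; have /ex[x' <-] : q (p (k x)) = 0 by apply/kex; exists x.
    by exists (e x'); rewrite fE.
  apply: (gen_ext hA hH rP (i := a) (p := b) _ gY').
    split.
    + by apply: inj0 => y ay; apply: (ker0 ii); rewrite -aE ay linear0.
    + move=> x; split=> [bx | [y <-]].
        have /iex[y yE] : p (k x) = 0 by rewrite -[LHS](bE x) bx linear0.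
        by exists y; apply: ki; rewrite aE.
      by apply: mi; rewrite bE /= aE (exact0 _ iex) linear0.
    + move=> x; have [v vE] := ps (m x).
      have /kex[w wE] : q (p v) = 0.
        by rewrite vE; apply/ex; have [x' <-] := es x; exists x'; rewrite fE.
      by exists w; apply: mi; rewrite bE /= wE.
  by apply: (gen_quot es); apply: cok_gen.
- exact: cok_closed_extensions.
Qed.

Lemma cok_Ext_projective X : add P X -> Ext_projective (cok P) X.
Proof.
move=> aX; split; first exact: cok_add.
by move=> Y cY; apply: (Ext1_addl hA hH _ aX); apply: (Ext1_gen hA hH rP); apply: cok_gen.
Qed.

Lemma cok_progenerator : Ext_progenerator (cok P) P.
Proof.
split; first exact/cok_add/add_self.
  move=> X; split; first exact: cok_Ext_projective.
  move=> [cX Xproj]; have [V [Y [i [f [aV ses cY]]]]] := cok_cover cX.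
  have [s sE] := (Ext1P X Y).1 (Xproj _ cY) _ _ _ ses.
  by apply: (@add_retract A hA P X V aV); exists s, f.
move=> X /cok_cover[V [Y [i [f [aV ses cY]]]]]; exists Y, V, i, f; split=> //.
exact: cok_Ext_projective.
Qed.
End Rigid.

(** * Kernels of epimorphisms in an ICE-closed subcategory *)

Definition hull (C : rmod A -> Prop) X : Prop :=
  exists C0 C1 (i : {linear X -> C0}) (p : {linear C0 -> C1}),
    [/\ C C0, C C1 & short_exact i p].

Section Hull.
Variable C : rmod A -> Prop.
Hypothesis hC : ICE_closed C.

Lemma ICE_prod : prod_closed C.
Proof. by case: hC => /(subcategoryP hA)[]. Qed.

Lemma ICE_retract : retract_closed C.
Proof. by case: hC => /(subcategoryP hA)[]. Qed.

Lemma ICE_ext X Y Z (f : {linear X -> Y}) (g : {linear Y -> Z}) :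
  C X -> C Z -> short_exact f g -> C Y.
Proof. by case: hC => _ _ _; apply. Qed.

Lemma ICE_coker X Y Z (f : {linear X -> Y}) (q : {linear Y -> Z}) :
  C X -> C Y -> exact_at f q -> surjective q -> C Z.
Proof. by case: hC => _ _ + _; apply. Qed.

Lemma ICE_image X Y I (e : {linear X -> I}) (m : {linear I -> Y}) :
  C X -> C Y -> surjective e -> injective m -> C I.
Proof.
case: hC => _ h _ _ CX CY es mi.
exact: (h _ _ _ (m \o e : {linear X -> Y}) e m).
Qed.

Lemma hull_sub X : C X -> hull C X.
Proof.
move=> CX; exists X, (zero_rmod A), idfun, \0; split=> //.
  exact: ICE_prod.1.
split=> //; first by move=> x; split=> // _; exists x.
by move=> z; exists 0; rewrite (zero_rmod_zero z).
Qed.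

(** The pushout of X -> D0 along X -> C0 is an extension of C1 by D0, hence in C. It gives a map t
    from C0 between objects of C with the same kernel as f, so K is the kernel of C0 onto the image
    of t. *)
Lemma hull_kernel X Y K (k : {linear K -> X}) (f : {linear X -> Y}) :
  hull C X -> hull C Y -> injective k -> exact_at k f -> hull C K.
Proof.
move=> [C0 [C1 [i [p [CC0 CC1 ses]]]]] [D0 [D1 [d [e [CD0 CD1 ses']]]]] ki kex.
have [di dex es] := ses'; have [ii iex ps] := ses.
have [E [j [t [q [sesE tj qt ker]]]]] := pushout_ses (d \o f : {linear X -> D0}) ses.
have CE : C E by apply: ICE_ext sesE.
have [I [u [m [us mi tE]]]] := image_ex t.
exists C0, I, (i \o k : {linear K -> C0}), u; split=> //.
  exact: ICE_image us mi.
split=> //; first exact: inj_comp.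
move=> c; split=> [uc | [x <-]].
  have [|x [-> fx]] := ker c 0; first by rewrite tE /= uc !linear0 addr0.
  have /kex[y <-] : f x = 0; last by exists y.
  by apply: (ker0 di); apply/eqP; rewrite -oppr_eq0 -fx.
apply: mi; rewrite -[LHS]tE /= tj /= (exact0 _ kex) !linear0 //.
Qed.

(** The cokernel G of t is D0 modulo the image of X and lies in C. It contains Z = Y/X, with
    quotient D0/Y = D1. *)
Lemma hull_coker_inj X Y Z (f : {linear X -> Y}) (g : {linear Y -> Z}) :
  hull C X -> hull C Y -> short_exact f g -> hull C Z.
Proof.
move=> [C0 [C1 [i [p [CC0 CC1 ses]]]]] [D0 [D1 [d [e [CD0 CD1 ses']]]]] [fi fex gs].
have [di dex es] := ses'; have [ii iex ps] := ses.
have [E [j [t [q [sesE tj qt ker]]]]] := pushout_ses (d \o f : {linear X -> D0}) ses.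
have CE : C E by apply: ICE_ext sesE.
have [ji jex qs] := sesE.
have [G [r [rex rs]]] := coker_ex t.
have CG : C G by apply: ICE_coker rex rs.
have gen x : exists c v, x = t c + j v.
  have [c cE] := ps (q x).
  have /jex[v vE] : q (x - t c) = 0 by rewrite linearB qt cE subrr.
  by exists c, v; rewrite vE addrC subrK.
have [|a aE] := @factor_surj _ Z Y G g (r \o (j \o d) : {linear Y -> G}) gs.
  by move=> y /fex[x <-] /=; rewrite -tj (exact0 _ rex).
have [|||l [lt lj]] := @pushout_univ _ C0 D0 X E i (d \o f : {linear X -> D0}) t j D1 \0 e.
- exact: gen.
- exact: ker.
- by move=> x /=; rewrite (exact0 _ dex).
have [|b bE] := @factor_surj _ G E D1 r l rs.
  by move=> x /rex[c <-]; rewrite lt.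
exists G, D1, a, b; split=> //; split.
- apply: inj0 => z; have [y <-] := gs z; rewrite aE /= => /rex[c cE].
  have [|x [_ /eqP]] := ker c (- d y); first by rewrite linearN -cE subrr.
  rewrite eqr_opp => /eqP/di->.
  exact: exact0 fex.
- move=> z; split=> [bz | [z' <-]]; last first.
    by have [y <-] := gs z'; rewrite aE bE lj (exact0 _ dex).
  have [x xE] := rs z; have [c [v cv]] := gen x; move: bz.
  rewrite -xE bE cv linearD lt lj add0r => /dex[y <-].
  by exists (g y); rewrite aE linearD (exact0 _ rex) add0r.
- by move=> v; have [v' <-] := es v; exists (r (j v')); rewrite bE lj.
Qed.
End Hull.
End RigidModules.

(** * Wideness of the hull and torsion classes *)

Section WideHull.
Variable A : pzRingType.
Hypotheses (hA : artin_algebra A) (hH : hereditary A).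
Implicit Types C D E F I J K L M N P Q U V W X Y Z : rmod A.

Section Hull.
Variable C : rmod A -> Prop.
Hypothesis hC : ICE_closed C.

(** Z is pushed out to an extension of Y by C0 and then prolonged to an extension E of D0 by C0. The
    quotient E/Z is an extension of D1 by C1, so E and E/Z exhibit Z in the hull. *)
Lemma hull_ext X Z Y (f : {linear X -> Z}) (g : {linear Z -> Y}) :
  hull C X -> hull C Y -> short_exact f g -> hull C Z.
Proof.
move=> [C0 [C1 [i [p [CC0 CC1 ses]]]]] [D0 [D1 [d [e [CD0 CD1 ses']]]]] sesZ.
have [di dex es] := ses'; have [ii iex ps] := ses; have [fi fex gs] := sesZ.
have [Z' [c [t [g' [sesZ' tf g't ker]]]]] := pushout_ses i sesZ.
have [E [j [q [w [sesE wi wc qw]]]]] := extension_extend hA hH sesZ' di.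
have CE : C E by apply: (ICE_ext hC) sesE.
have [ci cex g's] := sesZ'; have [ji jex qs] := sesE.
have ti : injective t.
  apply: inj0 => z tz; have [|x [-> x0]] := ker z 0; first by rewrite tz linear0 addr0.
  have ix : i x = 0 by apply/eqP; rewrite -oppr_eq0 -x0.
  by rewrite (ker0 ii ix) linear0.
pose z := w \o t : {linear Z -> E}.
have zf x : z (f x) = j (i x) by rewrite /= tf wc.
have qz y : q (z y) = d (g y) by rewrite /= qw g't.
have [G [r [rex rs]]] := coker_ex z.
have [|a aE] := @factor_surj _ C1 C0 G p (r \o j : {linear C0 -> G}) ps.
  by move=> u /iex[x <-] /=; rewrite -zf (exact0 _ rex).
have [|b bE] := @factor_surj _ G E D1 r (e \o q : {linear E -> D1}) rs.
  by move=> u /rex[x <-]; rewrite [LHS]/= qz (exact0 _ dex).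
have sesG : short_exact a b.
  split.
  - apply: inj0 => x; have [u <-] := ps x; rewrite aE /= => /rex[y yE].
    have /fex[x' x'E] : g y = 0 by apply: (ker0 di); rewrite -qz yE (exact0 _ jex).
    have -> : u = i x' by apply: ji; rewrite -zf x'E yE.
    exact: exact0 iex.
  - move=> x; split=> [bx | [u <-]]; last first.
      by have [v <-] := ps u; rewrite aE bE /= (exact0 _ jex) linear0.
    have [u uE] := rs x; move: bx; rewrite -uE bE /= => /dex[y yE].
    have [y' y'E] := gs y.
    have /jex[v vE] : q (u - z y') = 0 by rewrite linearB qz y'E yE subrr.
    by exists (p v); rewrite aE /= vE linearB (exact0 _ rex) subr0.
  - by move=> v; have [v' <-] := es v; have [u <-] := qs v'; exists (r u); rewrite bE.
exists E, G, z, r; split=> //; first exact: (ICE_ext hC) sesG.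
by split=> //; apply: inj_comp.
Qed.

Lemma hull_coker X Y Z (f : {linear X -> Y}) (q : {linear Y -> Z}) :
  hull C X -> hull C Y -> exact_at f q -> surjective q -> hull C Z.
Proof.
move=> hX hY ex qs; have [I [e [m [es mi fE]]]] := image_ex f.
have [K [k [ki kex]]] := kernel_ex hA f.
have hK := hull_kernel hC hX hY ki kex.
have hI : hull C I.
  apply: (hull_coker_inj hC (f := k) (g := e) hK hX); split=> // x.
  rewrite -kex fE; split=> [/= -> | /(ker0 mi)//]; exact: linear0.
apply: (hull_coker_inj hC (f := m) (g := q) hI hY); split=> // y.
rewrite ex; split=> [[x <-] | [x <-]]; first by exists (e x); rewrite fE.
by have [u <-] := es x; exists u; rewrite fE.
Qed.

Lemma hull_wide : wide (hull C).
Proof.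
split.
- apply/(subcategoryP hA); split; first split.
  + by apply: (hull_sub hA hC); exact: (ICE_prod hA hC).1.
  + move=> X Y hX hY; apply: (@hull_ext X (prod_rmod X Y) Y (pairl idfun \0) snd) => //.
    split; first by move=> x x' /= [].
      by move=> [x y]; split=> /= [-> | [x' [_ <-]]//]; exists x.
    by move=> y; exists (0, y).
  + move=> X M hM [i [p pi]].
    (* A summand is the kernel of the complementary idempotent 1 - ip. *)
    apply: (hull_kernel hC hM hM (k := i)
      (f := idfun \- (i \o p : {linear M -> M}))); first exact: can_inj pi.
    move=> m; split=> /= [/eqP | [x <-]]; last by rewrite pi subrr.
    by rewrite subr_eq0 => /eqP->; exists (p m).
- move=> K X Y k f; exact: hull_kernel.
- move=> X Y Z f q; exact: hull_coker.
- move=> X Y Z f g hX hZ; exact: hull_ext.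
Qed.

(** A quotient in D of X in C embeds in some C0, so it is the image of a map X -> C0. Allowing any D
    below the hull covers both the hull itself and [wide_generated P]. *)
Lemma hull_torsion (D : rmod A -> Prop) :
  (forall X, C X -> D X) -> (forall X, D X -> hull C X) -> torsion_class D C.
Proof.
move=> CD Dh; split=> //; first by case: hC.
- move=> X Y q CX /Dh[C0 [C1 [i [p [CC0 CC1 [ii _ _]]]]]] qs.
  exact: (ICE_image hC CX CC0 qs ii).
- by move=> X Y Z f g CX _ CZ; apply: (ICE_ext hC CX CZ).
Qed.
End Hull.

Lemma wide_add P (D : rmod A -> Prop) : wide D -> D P -> forall X, add P X -> D X.
Proof.
move=> [/(subcategoryP hA)[hp hr] _ _ _] DP; exact: add_min.
Qed.

Lemma cok_torsion P : rigid P -> torsion_class (wide_generated P) (cok P).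
Proof.
move=> rP; have hC := cok_ICE hA hH rP.
apply: (hull_torsion hC) => X.
  move=> [U1 [U0 [f [q [a1 a0 ex qs]]]]] D wD DP.
  by have [_ _ hc _] := wD; apply: hc ex qs; apply: wide_add DP _ _.
move=> /(_ (hull (cok P))); apply; first exact: hull_wide.
by apply: hull_sub => //; apply: cok_add => //; apply: add_self.
Qed.

Lemma torsion_ICE (D C : rmod A -> Prop) : wide D -> torsion_class D C -> ICE_closed C.
Proof.
move=> [Dsub Dk Dc De] [Csub CD Cq Ce]; split=> //.
- move=> X I Y f e m CX CY es mi fE; apply: (Cq _ _ _ CX _ es).
  (* The image of f is the kernel of Y -> coker f, hence in D, and it is a quotient of X. *)
  have [Q [q [qex qs]]] := coker_ex f.
  have DQ := Dc _ _ _ _ _ (CD _ CX) (CD _ CY) qex qs.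
  apply: (Dk _ _ _ m q) => //; first exact: CD.
  move=> y; rewrite qex; split=> [[x <-] | [x <-]]; first by exists (e x); rewrite fE.
  by have [u <-] := es x; exists u; rewrite fE.
- move=> X Y Z f q CX CY ex qs; apply: (Cq _ _ _ CY _ qs).
  by apply: (Dc _ _ _ _ _ _ _ ex qs); apply: CD.
- move=> X Y Z f g CX CZ ses; apply: (Ce _ _ _ _ _ CX _ CZ ses).
  by apply: (De _ _ _ _ _ _ _ ses); apply: CD.
Qed.

Lemma ICE_iff_torsion (C : rmod A -> Prop) :
  ICE_closed C <-> exists D : rmod A -> Prop, wide D /\ torsion_class D C.
Proof.
split=> [hC | [D [wD tD]]]; last exact: torsion_ICE tD.
exists (hull C); split; first exact: hull_wide.
by apply: (hull_torsion hC) => // X; apply: hull_sub.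
Qed.
End WideHull.

(** * Krull-Schmidt theory *)

Section KrullSchmidt.
Variable A : pzRingType.
Hypotheses (hA : artin_algebra A).
Implicit Types E F G I J K L M N P Q U V W X Y Z : rmod A.

(** Past the stabilisation of kernels and images, M is the sum of the kernel and the image of a
    power of f; only what the vanishing of either summand says about f is recorded. *)
Lemma fitting M (f : {linear M -> M}) : exists n K I,
  [/\ isomorphic (prod_rmod K I) M,
      is_zero K -> forall x, iter n.+1 f x = 0 -> x = 0
    & is_zero I -> forall x, iter n.+1 f x = 0].
Proof.
have [k|k x [y yE]|a ha] := rmod_dcc hA (I := fun n (v : M) => exists x, iter n f x = v).
- have [g gE] := iter_lin f k; have [g0 gl] := submod_range g.
  split; first by have [x xE] := g0; exists x; rewrite -gE.
  move=> c u w [x <-] [y <-]; rewrite -!gE.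
  by have [||z zE] := gl c (g x) (g y); [exists x | exists y | exists z; rewrite -gE].
- by exists (f y); rewrite -iterSr.
have [k|k x /= ->|b hb] := noeth_acc (I := fun n x => iter n f x = 0) (rmod_noeth hA (M := M)).
- have [g gE] := iter_lin f k; have [g0 gl] := submod_ker g.
  by split=> [|c x y]; rewrite -!gE//; apply: gl.
- exact: linear0.
(* The exponent is a successor so that f x = 0 makes the power vanish at x; [indecomposable_endo]
   derives injectivity of f from this. *)
pose n := (maxn a b).+1; have [g gE] := iter_lin f n.
have g2 x : g (g x) = 0 -> g x = 0.
  rewrite !gE -iterD => /hb h; rewrite /n maxnC maxnE addnC -addSn iterD h.
  by have [g' <-] := iter_lin f (a - b).+1; rewrite ?linear0.
have gim x : exists y, g (g y) = g x.
  have /(ha (n + n)%N) : (a <= n + n)%N by rewrite (leq_trans (leqW (leq_maxl a b))) ?leq_addr.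
  move=> /(_ (g x))[_]; case; last by move=> y; rewrite iterD -!gE => h; exists y.
  apply/(ha n (leqW (leq_maxl _ _))); by exists x; rewrite gE.
have [K [k [ki kex]]] := kernel_ex hA g.
have [I [e [m [es mi gme]]]] := image_ex g.
exists (maxn a b), K, I; split.
- exists (copair k m); apply: inj_surj_bij => [|x].
    apply: inj0 => -[x y] /= e0; have [u uE] := es y.
    have mu : m y = g u by rewrite gme /= uE.
    have gu : g u = 0.
      apply: g2; have := congr1 g e0.
      by rewrite linearD (exact0 _ kex) add0r mu linear0.
    have y0 : y = 0 by apply: (ker0 mi); rewrite mu.
    by move: e0; rewrite y0 linear0 addr0 => /(ker0 ki)->.
  have [y yE] := gim x.
  have /kex[z zE] : g (x - g y) = 0 by rewrite linearB yE subrr.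
  by exists (z, e y); rewrite /= zE -[m _]gme subrK.
- move=> K0 x; rewrite -gE => /kex[y <-].
  by rewrite (K0 y) linear0.
- by move=> I0 x; rewrite -gE gme /= (I0 (e x)) linear0.
Qed.

Lemma indecomposable_endo X (f : {linear X -> X}) : indecomposable X ->
  bijective f \/ exists n, forall x, iter n f x = 0.
Proof.
move=> [_ hX]; have [n [K [I [/hX h hK hI]]]] := fitting f.
case: h => [/hK h | /hI h]; last by right; exists n.+1.
left; have fi : injective f.
  apply: inj0 => x fx; apply: h.
  by rewrite iterSr fx; have [g <-] := iter_lin f n; rewrite linear0.
exact: inj_surj_bij fi (endo_inj_surj hA fi).
Qed.

Lemma indecomposable_local X (f g : {linear X -> X}) : indecomposable X ->
  (forall x, f x + g x = x) -> bijective f \/ bijective g.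
Proof.
move=> iX fg; case: (indecomposable_endo f iX) => [|[n nil]]; first by left.
right; have gi : injective g.
  apply: inj0 => x gx; rewrite -(nil x).
  have fx : f x = x by rewrite -[RHS]fg gx addr0.
  by elim: n {nil} => //= n <-.
exact: inj_surj_bij gi (endo_inj_surj hA gi).
Qed.

(** The identity of X is the sum of its composites through M and through N; by locality one of these
    is bijective, and its inverse corrects the projection. *)
Lemma indecomposable_retract_prod X M N : indecomposable X ->
  retract X (prod_rmod M N) -> retract X M \/ retract X N.
Proof.
move=> iX [i [p pi]].
pose f := p \o pairl (fst \o i : {linear X -> M}) \0 : {linear X -> X}.
pose g := p \o pairl \0 (snd \o i : {linear X -> N}) : {linear X -> X}.
have fg x : f x + g x = x.
  rewrite -[RHS]pi /f /g /= -linearD; congr (p _); rewrite [RHS]surjective_pairing.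
  by congr pair; rewrite /= ?addr0 ?add0r.
case: (indecomposable_local iX fg) => /bij_inv[h [fh hf]]; [left | right].
  exists (fst \o i : {linear X -> M}),
    (h \o (p \o pairl idfun \0) : {linear M -> X}) => x.
  exact: fh.
exists (snd \o i : {linear X -> N}),
  (h \o (p \o pairl \0 idfun) : {linear N -> X}) => x.
exact: fh.
Qed.

Lemma indecomposable_not_zero X Z : indecomposable X -> is_zero Z -> ~ retract X Z.
Proof.
move=> [nX _] Z0 [i [p pi]]; apply: nX => x.
by rewrite -(pi x) (Z0 (i x)) linear0.
Qed.

(** Membership is [List.In] because modules carry no decidable equality. *)
Lemma indecomposable_retract_dsum (T : Type) (F : T -> rmod A) X s :
  indecomposable X -> retract X (dsum F s) ->
  exists i, List.In i s /\ retract X (F i).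
Proof.
move=> iX; elim: s => [|i s IH] /=.
  by move/(indecomposable_not_zero iX (@zero_rmod_zero A)).
case/(indecomposable_retract_prod iX) => [Xi | /IH[j [js Xj]]].
  by exists i; split=> //; left.
by exists j; split=> //; right.
Qed.

Lemma indecomposable_retract_add U X : indecomposable X -> add U X -> retract X U.
Proof.
move=> iX /(addP hA)[n]; elim: n => [|n IH] /=.
  by move/(indecomposable_not_zero iX (@zero_rmod_zero A)).
by case/(indecomposable_retract_prod iX).
Qed.

Lemma indecomposable_retract_iso X Y : indecomposable X -> indecomposable Y ->
  retract X Y -> isomorphic X Y.
Proof.
move=> [nX _] [_ iY] [i [p pi]]; have [Z [j [_ iso]]] := retract_compl hA pi.
case: (iY _ _ iso) => // Z0; apply: iso_trans iso.
by apply: iso_sym; apply: iso_trans (iso_prodC _ _) (iso_prod0 _ Z0).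
Qed.

Lemma dsum_cat (T : Type) (F : T -> rmod A) s t :
  isomorphic (prod_rmod (dsum F s) (dsum F t)) (dsum F (s ++ t)).
Proof.
elim: s => [|i s IH]; first by apply: iso_prod0; apply: zero_rmod_zero.
apply: iso_trans (iso_sym (iso_prodA _ _ _)) _.
by apply: iso_prod => //; apply: iso_refl.
Qed.

Lemma dsum_perm (T : eqType) (F : T -> rmod A) s t : perm_eq s t ->
  isomorphic (dsum F s) (dsum F t).
Proof.
move=> st; apply: (catCA_perm_ind (P := fun u => isomorphic (dsum F s) (dsum F u)) _ st);
  last exact: iso_refl.
move=> u v w h; apply: iso_trans h _.
apply: iso_trans (iso_sym (dsum_cat _ _ _)) _; apply: iso_trans _ (dsum_cat _ _ _).
apply: iso_trans (iso_prod (iso_refl _) (iso_sym (dsum_cat _ _ _))) _.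
apply: iso_trans _ (iso_prod (iso_refl _) (dsum_cat _ _ _)).
apply: iso_trans (iso_prodA _ _ _) _; apply: iso_trans _ (iso_sym (iso_prodA _ _ _)).
by apply: iso_prod; [apply: iso_prodC | apply: iso_refl].
Qed.

Lemma decomposition M : exists s, (forall X, List.In X s -> indecomposable X) /\
  isomorphic (dsum id s) M.
Proof.
elim/(rmod_ind hA): M => M IH.
have [M0 | nM0] := EM (is_zero M).
  by exists [::]; split=> //; apply: zero_iso => //; apply: zero_rmod_zero.
have [iM | niM] := EM (indecomposable M).
  exists [:: M]; split; first by move=> X [<-|[]].
  by apply: iso_trans (iso_prodC _ _) (iso_prod0 _ _); apply: zero_rmod_zero.
have [X [Y [iso [nX nY]]]] : exists X Y, isomorphic (X * Y)%type M /\
    ~ is_zero X /\ ~ is_zero Y.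
  apply: contrapT => h; apply: niM; split=> // X Y iso.
  apply: contrapT => /not_orP h'; apply: h; by exists X, Y.
have [f fb] := iso; have fi := bij_inj fb.
have [||s [hs isos]] := IH X (f \o pairl idfun \0 : {linear X -> M}).
- by move=> x y /fi [].
- move=> surj; apply: nY => y; have [x /fi[_ ->//]] := surj (f (0, y)).
have [||t [ht isot]] := IH Y (f \o pairl \0 idfun : {linear Y -> M}).
- by move=> x y /fi [].
- move=> surj; apply: nX => x; have [y /fi[->//]] := surj (f (x, 0)).
exists (s ++ t); split.
  by move=> Z h; case: (List.in_app_or s t Z h); [apply: hs | apply: ht].
apply: iso_trans (iso_sym (dsum_cat _ _ _)) _.
apply: iso_trans iso; exact: iso_prod.
Qed.

Lemma dsum_closed (T : Type) (F : T -> rmod A) (C : rmod A -> Prop) s :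
  prod_closed C -> (forall i, List.In i s -> C (F i)) -> C (dsum F s).
Proof.
move=> [C0 Cp]; elim: s => [|i s IH] h //=.
apply: Cp; first by apply: h; left.
by apply: IH => j js; apply: h; right.
Qed.

Lemma retract_dsum (T : Type) (F : T -> rmod A) i s :
  List.In i s -> retract (F i) (dsum F s).
Proof.
elim: s => //= j s IH [-> | /IH h]; first exact: retract_prodl.
apply: retract_trans h _; exact: retract_prodr.
Qed.

Lemma In_mem (T : eqType) (x : T) s : x \in s -> List.In x s.
Proof.
by elim: s => //= y s IH; rewrite inE => /orP[/eqP->|/IH]; [left | right].
Qed.

Lemma In_enum n (i : 'I_n) : List.In i (enum 'I_n).
Proof. by apply: In_mem; rewrite mem_enum. Qed.

Lemma add_dsum (T : Type) (F : T -> rmod A) s X :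
  (forall i, List.In i s -> add X (F i)) -> add X (dsum F s).
Proof. by move=> h; apply: dsum_closed => //; apply: add_prod. Qed.

Lemma add_iso U V X : isomorphic U V -> add X U -> add X V.
Proof. by move=> /iso_sym/retract_iso UV /(add_retract hA); apply. Qed.

(* Keeping one representative of each isomorphism class of summands of M. *)
Lemma basic_part M : exists n (F : 'I_n -> rmod A),
  [/\ forall i, indecomposable (F i),
      forall i j, isomorphic (F i) (F j) -> i = j,
      add M (dsum F (enum 'I_n))
    & add (dsum F (enum 'I_n)) M].
Proof.
have [s [hs iso]] := decomposition M.
suff [n [F [F1 F2 F3 F4]]] : exists n (F : 'I_n -> rmod A),
    [/\ forall i, indecomposable (F i),
      forall i j, isomorphic (F i) (F j) -> i = j,
      forall i, List.In (F i) s
    & forall X, List.In X s -> exists i, isomorphic (F i) X].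
  exists n, F; split=> //.
    apply: add_dsum => i _; apply: (@add_retract A hA M _ _ (add_self hA M)).
    apply: retract_trans (retract_iso iso); exact: (@retract_dsum _ id).
  apply: (add_iso iso); apply: add_dsum => X /F4[i Xi].
  apply: (add_iso Xi); apply: (@add_retract A hA _ _ _ (add_self hA _)).
  exact/retract_dsum/In_enum.
elim: s hs {iso} => [|X s IH] hs.
  by exists 0%N, (fun=> zero_rmod A); split=> // -[].
have [|n [F [F1 F2 F3 F4]]] := IH; first by move=> Y Ys; apply: hs; right.
have [[i Xi] | nX] := EM (exists i, isomorphic (F i) X).
  exists n, F; split=> //; first by move=> j; right.
  by move=> Y [<-|/F4//]; exists i.
exists n.+1, (fun i => if unlift ord0 i is Some j then F j else X); split.
- by move=> i; case: unliftP => [j|] _ //; apply: hs; left.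
- move=> i j; case: unliftP => [i'|] ->; case: unliftP => [j'|] -> //.
  + by move/F2->.
  + by move=> h; case: nX; exists i'.
  + by move=> /iso_sym h; case: nX; exists j'.
- by move=> i; case: unliftP => [j|] _; [right | left].
- move=> Y [<-|/F4[i Yi]]; first by exists ord0; rewrite unlift_none; apply: iso_refl.
  by exists (lift ord0 i); rewrite liftK.
Qed.

Lemma basicP M : basic M <-> exists n (F : 'I_n -> rmod A),
  [/\ forall i, indecomposable (F i),
      forall i j, isomorphic (F i) (F j) -> i = j
    & isomorphic (dsum F (enum 'I_n)) M].
Proof.
by split=> -[n [F [h1 h2 h3]]]; exists n, F; split=> //;
  apply/(direct_sum_dsum hA).
Qed.

(** Each indecomposable summand of one module is isomorphic to one of the other. Pairwise
    non-isomorphism makes both assignments injective, so they are bijections of index sets. *)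
Lemma basic_unique U V : basic U -> basic V -> add U V -> add V U -> isomorphic U V.
Proof.
move=> /basicP[m [F [F1 F2 isoF]]] /basicP[n [G [G1 G2 isoG]]] UV VU.
have key p q (F' : 'I_p -> rmod A) (G' : 'I_q -> rmod A) U' V' :
    (forall i, indecomposable (F' i)) -> (forall i, indecomposable (G' i)) ->
    isomorphic (dsum F' (enum 'I_p)) U' -> isomorphic (dsum G' (enum 'I_q)) V' ->
    add V' U' -> forall i, exists j, isomorphic (F' i) (G' j).
  move=> iF iG isoU isoV VU' i.
  have /(indecomposable_retract_add (iF i)) h : add V' (F' i).
    apply: (@add_retract A hA _ _ _ VU'); apply: retract_trans (retract_iso isoU).
    exact/retract_dsum/In_enum.
  have := retract_trans h (retract_iso (iso_sym isoV)).
  case/(indecomposable_retract_dsum (iF i)) => j [_ FG]; exists j.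
  exact: indecomposable_retract_iso.
have /choice[phi phiE] := key _ _ _ _ _ _ F1 G1 isoF isoG VU.
have /choice[psi psiE] := key _ _ _ _ _ _ G1 F1 isoG isoF UV.
have phi_inj : injective phi.
  by move=> i j e; apply: F2; apply: iso_trans (phiE i) _; rewrite e; apply: iso_sym.
have psi_inj : injective psi.
  by move=> i j e; apply: G2; apply: iso_trans (psiE i) _; rewrite e; apply: iso_sym.
have emn : m = n.
  have := leq_card _ phi_inj; have := leq_card _ psi_inj; rewrite !card_ord => h1 h2.
  by apply/eqP; rewrite eqn_leq h1 h2.
subst n; apply: iso_trans (iso_sym isoF) _; apply: iso_trans _ isoG.
apply: (@iso_trans _ _ (dsum (G \o phi) (enum 'I_m))).
  by elim: (enum _) => [|i s IH]; [apply: iso_refl | apply: iso_prod].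
rewrite dsum_map; apply: dsum_perm; apply: uniq_perm; rewrite ?enum_uniq//.
  by rewrite map_inj_uniq ?enum_uniq.
move=> j; rewrite mem_enum; apply/mapP; have [g _ gK] := injF_bij phi_inj.
by exists (g j); rewrite ?mem_enum ?gK.
Qed.
End KrullSchmidt.

(** * Existence of Ext-progenerators *)

Section Euler.
Variable A : pzRingType.
Hypotheses (hA : artin_algebra A) (hH : hereditary A).
Implicit Types E F G I J K L M N P Q U V W X Y Z : rmod A.

Definition Hom_zero X N := forall f : {linear X -> N}, forall x, f x = 0.

(* The R-length of Hom(F, N) minus that of Hom(L, N) does not depend on the
   presentation; equality of lengths is replaced here by an endomorphism of
   Hom(F' + L, N), which is injective if and only if it is surjective. *)
Lemma euler_transfer X Y L F L' F' (i : {linear L -> F}) (p : {linear F -> X})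
    (i' : {linear L' -> F'}) (p' : {linear F' -> Y}) N :
  short_exact i p -> short_exact i' p' -> projective F' ->
  isomorphic (prod_rmod F' L) (prod_rmod F L') ->
  Hom_zero X N -> Ext1_zero X N -> (Hom_zero Y N <-> Ext1_zero Y N).
Proof.
move=> ses ses' pF' /iso_sym[sg /bij_inv[sg' [sgK sgK']]] HX EX.
have [ii iex ps] := ses; have [ii' iex' ps'] := ses'.
have ext := Ext1_crit1 ses EX.
have uniq (g : {linear F -> N}) : (forall l, g (i l) = 0) -> forall x, g x = 0.
  move=> g0; have [|h hE] := factor_surj ps (f := g); first by move=> u /iex[l <-].
  by move=> x; rewrite -hE HX.
have HY : Hom_zero Y N <->
    forall g : {linear F' -> N}, (forall l, g (i' l) = 0) -> forall x, g x = 0.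
  split=> [h0 g g0 | h f y].
    have [|h hE] := factor_surj ps' (f := g); first by move=> u /iex'[l <-].
    by move=> x; rewrite -hE h0.
  have [u <-] := ps' y; apply: (h (f \o p' : {linear F' -> N})) => l /=.
  by rewrite (exact0 _ iex') linear0.
have EY : Ext1_zero Y N <-> forall f : {linear L' -> N},
    exists g : {linear F' -> N}, forall l, g (i' l) = f l.
  by split; [exact: (Ext1_crit1 ses') | exact: (Ext1_crit2 ses' pF')].
rewrite HY EY {HY EY}.
have [R [z [H [ev [evl evi evs [fgH dH nH] central]]]]] :=
  hom_module hA (prod_rmod F' L) N.
have zlin (U : rmod A) r (f f' : {linear U -> N}) a x y :
    z r *: f (a *: x + y) + f' (a *: x + y) =
    a *: (z r *: f x + f' x) + (z r *: f y + f' y).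
  by rewrite !linearP !scalerDr !scalerA central addrACA.
have ev0 x : ev 0 x = 0.
  have [e eE] := evs \0; have e0 : e = 0 by apply: evi => v; rewrite eE.
  by have := eE x; rewrite e0.
(* [Gr] is the graph of the endomorphism: extend the L-part of h uniquely to g on F, which is
   possible as Hom(X, N) = Ext^1(X, N) = 0, restrict the F'-part to L', and transport by [sg]. Thus
   it behaves like restriction from F' to L', which is injective when Hom(Y, N) = 0 and onto when
   Ext^1(Y, N) = 0. *)
pose Gr (h h2 : H) := exists g : {linear F -> N},
  (forall l, g (i l) = ev h (0, l)) /\
  forall x l', ev h2 (sg (x, l')) = g x + ev h (i' l', 0).
have Grl a h h' h2 h2' : Gr h h2 -> Gr h' h2' -> Gr (a *: h + h') (a *: h2 + h2').
  move=> [g [g1 g2]] [g' [g1' g2']]; exists (mk_linear (zlin _ a g g')); split.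
    by move=> l; rewrite /= g1 g1' evl.
  by move=> x l' /=; rewrite !evl g2 g2' scalerDr addrACA.
have Gr0 h2 : Gr 0 h2 -> h2 = 0.
  move=> [g [g1 g2]]; apply: evi => y; rewrite -(sgK' y).
  case: (sg' y) => x l'; rewrite g2 ev0 addr0; apply: uniq => l.
  by rewrite g1 ev0.
have [|th thE] := lin_graph Grl _ Gr0.
  move=> h; have [g gE] := ext (ev h \o pairl \0 idfun : {linear L -> N}).
  have [h2 h2E] := evs (copair g (ev h \o (pairl i' \0 : {linear L' -> prod_rmod F' L})
      : {linear L' -> N}) \o sg' : {linear prod_rmod F' L -> N}).
  exists h2, g; split; first exact: gE.
  by move=> x l'; rewrite h2E /= sgK.
have thU h h2 : Gr h h2 -> th h = h2.
  move=> hh2; have := Grl (-1) _ _ _ _ hh2 (thE h).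
  by rewrite !scaleN1r addNr => /Gr0/eqP; rewrite addrC subr_eq0 => /eqP.
split=> [inj' f' | surj' g' g'0].
  have thi : injective th.
    apply: inj0 => h th0; have [g [g1 g2]] := thE h; rewrite th0 in g2.
    have h1 y : ev h (y, 0) = 0.
      apply: (inj' (ev h \o pairl idfun \0 : {linear F' -> N})) => l' /=.
      by have := g2 0 l'; rewrite ev0 linear0 add0r => <-.
    have h2 l : ev h (0, l) = 0.
      rewrite -g1; have := g2 (i l) 0; rewrite ev0 h1 addr0 => <- //.
    apply: evi => -[y l].
    have -> : (y, l) = (y, 0) + (0, l) :> prod_rmod F' L.
      by congr pair; rewrite ?addr0 ?add0r.
    by rewrite linearD h1 h2 addr0.
  have [h2 h2E] := evs (f' \o snd \o sg' : {linear prod_rmod F' L -> N}).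
  have [h hE] := inj_endo_surj dH thi h2; have [g [g1 g2]] := thE h.
  exists (ev h \o pairl idfun \0 : {linear F' -> N}) => l' /=.
  have := g2 0 l'; rewrite linear0 add0r => <-.
  by rewrite hE h2E /= sgK.
have ths : surjective th.
  move=> h2.
  have [g gE] := surj' (ev h2 \o (sg \o pairl \0 idfun) : {linear L' -> N}).
  pose gx := ev h2 \o (sg \o pairl idfun \0) : {linear F -> N}.
  have [h hE] := evs (copair g (gx \o i) : {linear prod_rmod F' L -> N}).
  exists h; apply: thU; exists gx; split=> [l | x l'].
    by rewrite hE /= linear0 add0r.
  rewrite hE /= gE !linear0 addr0 -!linearD.
  by congr (ev h2 (sg (_, _))); rewrite /= ?addr0 ?add0r.
have [h hE] := evs (copair g' \0 : {linear prod_rmod F' L -> N}).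
have th0 : th h = 0.
  apply: thU; exists \0; split=> [l | x l']; first by rewrite hE /= linear0 addr0.
  by rewrite ev0 hE /= g'0 addr0 add0r.
have h0 : h = 0 by apply: (surj_endo_inj nH ths); rewrite th0 linear0.
move=> x; have := hE (x, 0); rewrite h0 ev0 /= addr0.
by move=> <-.
Qed.

(** The trace left by equality of Euler forms: where both terms vanish for X, the terms for Y have
    equal length, so they vanish together. *)
Definition euler_le X Y := forall N,
  Hom_zero X N -> Ext1_zero X N -> (Hom_zero Y N <-> Ext1_zero Y N).

Lemma Hom_zero_add X V N : Hom_zero X N -> add X V -> Hom_zero V N.
Proof.
move=> h; move: V; apply: (add_min hA) => //.
  split=> [f x | Y Z hY hZ f [y z]]; first by rewrite (zero_rmod_zero x) linear0.
  have -> : (y, z) = (y, 0) + (0, z) :> prod_rmod Y Z.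
    by congr pair; rewrite ?addr0 ?add0r.
  rewrite linearD.
  have := hY (f \o pairl idfun \0) y; rewrite /= => ->.
  by have := hZ (f \o pairl \0 idfun) z; rewrite /= => ->; rewrite addr0.
move=> Y Z hZ [i [p pi]] f y; rewrite -(pi y).
exact: (hZ (f \o p : {linear Z -> N})).
Qed.

(* Q is M modulo the trace of X. *)
Lemma trace_quot X M : rigid X -> Ext1_zero X M ->
  exists I (m : {linear I -> M}) Q (q : {linear M -> Q}),
    [/\ gen X I, short_exact m q, Hom_zero X Q & Ext1_zero X Q].
Proof.
move=> rX XM; have [V [f [I [e [m [aV es mi fE fac]]]]]] := gen_approx hA X M.
have gI : gen X I by exists V, e.
have [Q [q [qex qs]]] := coker_ex m.
exists I, m, Q, q; split=> //; last exact: Ext1_quot qs XM.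
move=> h x; have ses : short_exact m q by [].
have [l lE] := Ext1_lift hA h ses (Ext1_gen hA hH rX gI).
have [t tE] := fac X l (add_self hA X).
by rewrite -lE -tE fE /= (exact0 _ qex).
Qed.

(** Let Q be Y modulo the trace of X. Hom and Ext^1 from X to Q vanish, and Ext^1(Y, Q) = 0 since Y
    is rigid, so Hom(Y, Q) = 0. But Y maps onto Q, hence Q = 0. *)
Lemma gen_of_euler X Y : rigid X -> rigid Y -> Ext1_zero X Y ->
  euler_le X Y -> gen X Y.
Proof.
move=> rX rY XY eul; have [I [m [Q [q [gI [mi qex qs] HX EX]]]]] := trace_quot rX XY.
have /(eul Q HX EX) HY : Ext1_zero Y Q by apply: (Ext1_quot hA hH qs).
apply: (gen_quot (f := m)) gI => y; apply/qex; exact: HY.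
Qed.

(** It suffices to split the X-approximation V -> Y with kernel K. For Q = K modulo the trace of X,
    Hom(Y, Q) = 0 because V covers Y, so Ext^1(Y, Q) = 0 and K -> Q extends to V, where it is zero.
    Thus X, and then Y, generates K, and Ext^1(Y, K) = 0. *)
Lemma add_of_euler X Y : rigid X -> rigid Y -> Ext1_zero X Y -> Ext1_zero Y X ->
  euler_le X Y -> euler_le Y X -> add X Y.
Proof.
move=> rX rY XY YX eXY eYX.
have gY := gen_of_euler rX rY XY eXY; have gX := gen_of_euler rY rX YX eYX.
have [V [K [k [f [aV ses fac]]]]] := gen_cover hA gY.
have XK : Ext1_zero X K.
  exact: (cover_kernel_Ext hA hH rX aV ses fac (add_self hA X)).
have [I [m [Q [q [gI [mi qex qs] HX EX]]]]] := trace_quot rX XK.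
have HV : Hom_zero V Q := Hom_zero_add HX aV.
have HY : Hom_zero Y Q.
  move=> h y; have [v <-] : exists v, f v = y by case: ses => _ _; apply.
  exact: (HV (h \o f : {linear V -> Q})).
have /(Ext1_crit1 ses)/(_ q)[g gE] := (eXY Q HX EX).1 HY.
have gK : gen X K.
  apply: (gen_quot (f := m)) gI => y; apply/qex.
  by rewrite -gE; apply: HV.
have YK : Ext1_zero Y K := Ext1_gen hA hH rY (gen_trans hA gX gK).
have [s sE] := (Ext1P Y K).1 YK _ _ _ ses.
by apply: (@add_retract A hA X _ _ aV); exists s, f.
Qed.
End Euler.

(** * Classes of projective presentations and Ext-progenerators *)

Section Classes.
Variable A : pzRingType.
Hypotheses (hA : artin_algebra A) (hH : hereditary A).
Implicit Types E F G I J K L M N P Q U V W X Y Z : rmod A.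

Definition regular_rmod : rmod A := RMod (fg_regular A^c).

Lemma projective_regular : projective regular_rmod.
Proof. by apply: (@hH _ idfun). Qed.

Lemma free_upow n : isomorphic (upow n regular_rmod) (free_rmod A n).
Proof.
elim: n => [|n IH]; first exact: iso_refl.
have [i [p ses]] := ffunS_exact n ((A^c)^o); have [ii ex ps] := ses.
have [s sE] := projective_lift (P := regular_rmod) idfun projective_regular ps.
have [r [rE1 rE2]] := section_retraction ses sE.
apply: iso_trans (iso_prod (iso_refl regular_rmod) IH) _.
apply: (@iso_of _ (prod_rmod regular_rmod (free_rmod A n)) (free_rmod A n.+1)
  (copair s i) (pairl p r)) => [[x y] | v] /=; last by rewrite rE2 addrC subrK.
have px : p (s x + i y) = x by rewrite linearD sE (exact0 _ ex) addr0.
by rewrite px; congr pair; apply: ii; rewrite rE2 px addrC addKr.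
Qed.

Lemma projective_retract M : projective M -> add regular_rmod M.
Proof.
move=> pM; have [n [L [i [p [_ _ ps]]]]] := presentation hA M.
have [s sE] := projective_lift idfun pM ps.
apply/(addP hA); exists n; apply: retract_trans (retract_iso (iso_sym (free_upow n))).
by exists s, p.
Qed.

Lemma projective_prod X Y : projective X -> projective Y -> projective (prod_rmod X Y).
Proof.
move=> pX pY; apply: (@projective_ext _ X (prod_rmod X Y) Y (pairl idfun \0) snd) => //.
split; first by move=> x x' /= [].
  by move=> [x y]; split=> /= [-> | [x' [_ <-]]//]; exists x.
by move=> y; exists (0, y).
Qed.

Lemma projective_list : exists n (Q : 'I_n -> rmod A), forall Z, projective Z ->
  exists l, isomorphic (dsum Q l) Z.
Proof.
have [n [Q [Q1 _ _ Q2]]] := basic_part hA regular_rmod.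
exists n, Q => Z /projective_retract/(add_sub hA Q2) aZ.
have [s [hs iso]] := decomposition hA Z.
have aX X : List.In X s -> exists i, isomorphic (Q i) X.
  move=> Xs; have iX := hs X Xs.
  have : add (dsum Q (enum 'I_n)) X.
    apply: (@add_retract A hA _ _ _ aZ); apply: retract_trans (retract_iso iso).
    exact: (@retract_dsum _ _ id).
  case/(indecomposable_retract_add hA iX)/(indecomposable_retract_dsum hA iX).
  move=> i [_ Xi]; exists i; apply: iso_sym.
  exact: (indecomposable_retract_iso hA).
suff [l lE] : exists l, isomorphic (dsum Q l) (dsum id s).
  by exists l; apply: iso_trans lE iso.
elim: s aX {hs iso} => [|X s IH] aX; first by exists [::]; apply: iso_refl.
have [|l lE] := IH; first by move=> Y Ys; apply: aX; right.
have [|i iE] := aX X; first by left.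
by exists (i :: l); apply: iso_prod.
Qed.

Lemma short_exact_prod X Y Z X' Y' Z' (i : {linear X -> Y}) (p : {linear Y -> Z})
    (i' : {linear X' -> Y'}) (p' : {linear Y' -> Z'}) :
  short_exact i p -> short_exact i' p' ->
  exists (j : {linear prod_rmod X X' -> prod_rmod Y Y'})
    (q : {linear prod_rmod Y Y' -> prod_rmod Z Z'}), short_exact j q.
Proof.
move=> [ii ex ps] [ii' ex' ps'].
exists (pairl (i \o fst : {linear (X * X')%type -> Y}) (i' \o snd : {linear (X * X')%type -> Y'})),
  (pairl (p \o fst : {linear (Y * Y')%type -> Z}) (p' \o snd : {linear (Y * Y')%type -> Z'})).
split.
- by move=> [x x'] [y y'] /= [/ii-> /ii'->].
- move=> [y y']; split=> /= [[/ex[x <-] /ex'[x' <-]] | [[x x'] [<- <-]]].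
    by exists (x, x').
  by rewrite /= (exact0 _ ex) (exact0 _ ex').
- move=> [z z']; have [y <-] := ps z; have [y' <-] := ps' z'.
  by exists (y, y').
Qed.

Section Fixed.
Variables (n : nat) (Q : 'I_n -> rmod A).
Hypothesis hQ : forall Z, projective Z -> exists l, isomorphic (dsum Q l) Z.

(* The class [F] - [L] of a projective presentation of X, as two vectors of
   multiplicities of the indecomposable projectives Q j. *)
Definition proj_class X (a b : 'I_n -> nat) := exists L F (i : {linear L -> F})
    (p : {linear F -> X}) s t,
  [/\ short_exact i p, projective F, isomorphic (dsum Q s) F, isomorphic (dsum Q t) L
    & forall j, count_mem j s = a j /\ count_mem j t = b j].

Lemma proj_class_ex X : exists a b, proj_class X a b.
Proof.
have [m [L [i [p ses]]]] := presentation hA X; have [ii _ _] := ses.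
have pF : projective (free_rmod A m) by exact: projective_ffun.
have [s sE] := hQ pF; have [t tE] := hQ (projective_sub_free hH ii).
by exists (fun j => count_mem j s), (fun j => count_mem j t), L, (free_rmod A m), i, p, s, t.
Qed.

Lemma proj_class_zero : proj_class (zero_rmod A) (fun=> 0%N) (fun=> 0%N).
Proof.
exists (zero_rmod A), (zero_rmod A), \0, idfun, [::], [::]; split=> //; try exact: iso_refl.
  split; last by move=> x; exists x.
    by move=> x y _; rewrite (zero_rmod_zero x) (zero_rmod_zero y).
  by move=> x; split=> [/= -> | [y <-]//]; exists 0.
exact: projective_ffun.
Qed.

Lemma proj_class_prod X Y a b c d : proj_class X a b -> proj_class Y c d ->
  proj_class (prod_rmod X Y) (fun j => a j + c j)%N (fun j => b j + d j)%N.
Proof.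
move=> [L [F [i [p [s [t [ses pF sF tL cnt]]]]]]]
  [L' [F' [i' [p' [s' [t' [ses' pF' sF' tL' cnt']]]]]]].
have [j [q sesj]] := short_exact_prod ses ses'.
exists (prod_rmod L L'), (prod_rmod F F'), j, q, (s ++ s'), (t ++ t'); split=> //.
- exact: projective_prod.
- apply: iso_trans (iso_sym (dsum_cat _ _ _)) _; exact: iso_prod.
- apply: iso_trans (iso_sym (dsum_cat _ _ _)) _; exact: iso_prod.
- move=> k; rewrite !count_cat; have [-> ->] := cnt k.
  by have [-> ->] := cnt' k.
Qed.

Lemma proj_class_eq X a b c d : a =1 c -> b =1 d -> proj_class X a b -> proj_class X c d.
Proof.
move=> ac bd [L [F [i [p [s [t [ses pF sF tL cnt]]]]]]].
exists L, F, i, p, s, t; split=> // j; have [-> ->] := cnt j.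
by rewrite ac bd.
Qed.

Lemma proj_class_upow X a b m : proj_class X a b ->
  proj_class (upow m X) (fun j => m * a j)%N (fun j => m * b j)%N.
Proof.
move=> h; elim: m => [|m IH] /=; first exact: proj_class_zero.
apply: proj_class_eq (proj_class_prod h IH) => j; by rewrite mulSn.
Qed.

Lemma proj_class_dsum (T : Type) (X : T -> rmod A) a b s :
  (forall i, proj_class (X i) (a i) (b i)) ->
  proj_class (dsum X s) (fun j => \sum_(i <- s) a i j)%N (fun j => \sum_(i <- s) b i j)%N.
Proof.
move=> h; elim: s => [|i s IH] /=.
  by apply: proj_class_eq proj_class_zero => j; rewrite big_nil.
by apply: proj_class_eq (proj_class_prod (h i) IH) => j; rewrite big_cons.
Qed.

(** The equation says [F] + [L'] = [F'] + [L]; equal multiplicities make the two sums isomorphic, as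
    [euler_transfer] requires. *)
Lemma euler_class X Y a b c d : proj_class X a b -> proj_class Y c d ->
  (forall j, a j + d j = c j + b j)%N -> euler_le X Y.
Proof.
move=> [L [F [i [p [s [t [ses pF sF tL cnt]]]]]]]
  [L' [F' [i' [p' [s' [t' [ses' pF' sF' tL' cnt']]]]]]] e N.
apply: (euler_transfer hA ses ses' pF').
apply: iso_trans (iso_sym (iso_prod sF' tL)) _; apply: iso_trans _ (iso_prod sF tL').
apply: iso_trans (dsum_cat _ _ _) _; apply: iso_trans _ (iso_sym (dsum_cat _ _ _)).
apply: dsum_perm; apply/allP => j _ /=; rewrite !count_cat.
have [-> ->] := cnt j; have [-> ->] := cnt' j; by rewrite e.
Qed.
End Fixed.

Lemma Ext_projective_prod (C : rmod A -> Prop) : ICE_closed C ->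
  prod_closed (Ext_projective C).
Proof.
move=> hC; have [C0 Cp] := ICE_prod hA hC; split; first split=> //.
  by move=> Y _; apply: Ext1_zerol; apply: zero_rmod_zero.
move=> X Y [CX hX] [CY hY]; split; first exact: Cp.
by move=> Z CZ; apply: (Ext1_prodl hA); [apply: hX | apply: hY].
Qed.

Lemma Ext_projective_retract (C : rmod A -> Prop) : ICE_closed C ->
  retract_closed (Ext_projective C).
Proof.
move=> hC X Y [CY hY] XY; split; first exact: (ICE_retract hA hC) XY.
move=> Z CZ; have [i [p /retract_inj[ii _]]] := XY.
by apply: (Ext1_sub hA hH ii); apply: hY.
Qed.

(** The product [c] of all denominators clears them, and signs are moved across the equation:
    natural coefficients are needed because they become multiplicities of summands. *)
Lemma rat_relation k n (M : 'M[rat]_(k, n)) (v : 'rV[rat]_n) : (v <= M)%MS ->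
  exists c (p q : 'I_k -> nat), (0 < c)%N /\
    forall j, c%:R * v 0 j + \sum_i (q i)%:R * M i j = \sum_i (p i)%:R * M i j.
Proof.
move=> /submxP[w ->].
have int_num (m : int) : exists pq : nat * nat, m%:~R = pq.1%:R - pq.2%:R :> rat.
  case: m => m; first by exists (m, 0%N); rewrite subr0.
  by exists (0%N, m.+1); rewrite sub0r NegzE mulrNz.
pose c := (\prod_i `|denq (w 0%R i)|)%N.
have c_gt0 : (0 < c)%N by apply: prodn_gt0 => i; rewrite absz_gt0 denq_neq0.
have /choice[pq pqE] (i : 'I_k) : exists pq : nat * nat,
    c%:R * w 0 i = pq.1%:R - pq.2%:R.
  have [pq pqE] := int_num ((\prod_(i' | i' != i) `|denq (w 0%R i')|)%N%:Z * numq (w 0 i)).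
  exists pq; rewrite -pqE /c (bigD1 i)//= natrM intrM numqE.
  have -> : (`|denq (w 0%R i)|%N)%:R = (denq (w 0 i))%:~R :> rat.
    by rewrite pmulrn absz_denq.
  by rewrite [_%:~R * _%:R]mulrC -mulrA [_%:~R * w 0 i]mulrC.
exists c, (fun i => (pq i).1), (fun i => (pq i).2); split=> // j.
rewrite mxE mulr_sumr -big_split; apply: eq_bigr => i _ /=.
by rewrite mulrA pqE mulrBl subrK.
Qed.

Lemma upow_closed (C : rmod A -> Prop) U n : prod_closed C -> C U -> C (upow n U).
Proof. by move=> [C0 Cp] CU; elim: n => //= n IH; apply: Cp. Qed.

Section Progenerator.
Variable C : rmod A -> Prop.
Hypotheses (hC : ICE_closed C) (hE : enough_Ext_projectives C).

(* The vectors of classes of Ext-projectives span a finite-dimensional space;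
   Ext-projectives whose classes span it generate all the others, since a
   relation c[Z] + sum q_i [X_i] = sum p_i [X_i] between classes makes the two
   sides, as modules, summands of powers of each other. *)
Lemma progenerator_ex : exists P, Ext_progenerator C P.
Proof.
have [n [Q hQ]] := projective_list.
pose vec (a b : 'I_n -> nat) : 'rV[rat]_n := \row_j ((a j)%:R - (b j)%:R).
(* Families of Ext-projectives are compared by the rank of their class vectors, which is at most n;
   one of maximal rank is used. *)
pose fam r := exists k (X : 'I_k -> rmod A) (a b : 'I_k -> 'I_n -> nat),
  (forall i, Ext_projective C (X i) /\ proj_class Q (X i) (a i) (b i)) /\
  \rank (\matrix_i vec (a i) (b i)) = r.
have ub r : `[< fam r >] -> (r <= n)%N.
  by move=> /asboolP[k [X [a [b [_ <-]]]]]; apply: rank_leq_col.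
have ex0 : exists r, `[< fam r >].
  eexists; apply/asboolP; exists 0%N, (fun=> zero_rmod A), (fun _ _ => 0%N), (fun _ _ => 0%N).
  by split=> [[]//|].
case: (ex_maxnP ex0 ub) => _ /asboolP[k [X [a [b [XE <-]]]]] rmax {ex0 ub}.
set M := \matrix_i _ in rmax.
have Eprod := Ext_projective_prod hC; have Eret := Ext_projective_retract hC.
have Eij Y Z : Ext_projective C Y -> Ext_projective C Z -> Ext1_zero Y Z.
  by move=> [_ h] [CZ _]; apply: h.
pose P := dsum X (enum 'I_k).
have EP : Ext_projective C P by apply: dsum_closed => // i _; case: (XE i).
have PX i : add P (X i).
  by apply: (@add_retract A hA P _ _ (add_self hA P)); apply/retract_dsum/In_enum.
suff key Z : Ext_projective C Z -> add P Z.
  exists P; split=> //; first by case: EP.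
  by move=> Z; split=> [|/key//]; apply: add_min.
move=> EZ; have [c [d Zcd]] := proj_class_ex hQ Z.
(* Adjoining Z to the family cannot raise the rank, so its class is in the row space. *)
have vM : (vec c d <= M)%MS.
  pose X' (i : 'I_k.+1) := if unlift ord0 i is Some j then X j else Z.
  pose a' (i : 'I_k.+1) := if unlift ord0 i is Some j then a j else c.
  pose b' (i : 'I_k.+1) := if unlift ord0 i is Some j then b j else d.
  pose M' := \matrix_i vec (a' i) (b' i).
  have MM' : (M <= M')%MS.
    apply/row_subP => i; rewrite rowK.
    have -> : vec (a i) (b i) = row (lift ord0 i) M' by rewrite rowK /a' /b' liftK.
    exact: row_sub.
  have r' : \rank M' = \rank M.
    apply/eqP; rewrite eqn_leq (mxrankS MM') andbT; apply: rmax; apply/asboolP.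
    exists k.+1, X', a', b'; split=> // i; rewrite /X' /a' /b'.
    by case: unliftP => [j|] _.
  have M'M : (M' <= M)%MS by rewrite -(mxrank_leqif_sup MM') r'.
  have -> : vec c d = row ord0 M' by rewrite rowK /a' /b' unlift_none.
  exact: submx_trans (row_sub _ _) M'M.
have [m [p [q [m_gt0 rel]]]] := rat_relation vM.
(* The two sides of the relation as modules; both are Ext-projective, hence without extensions in
   either direction, and have the same class. *)
pose X' := dsum (fun i => upow (p i) (X i)) (enum 'I_k).
pose Y := prod_rmod (upow m Z) (dsum (fun i => upow (q i) (X i)) (enum 'I_k)).
have EX' : Ext_projective C X'.
  by apply: dsum_closed => // i _; apply: upow_closed => //; case: (XE i).
have EY : Ext_projective C Y.
  apply: Eprod.2; first exact: upow_closed.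
  by apply: dsum_closed => // i _; apply: upow_closed => //; case: (XE i).
have clX' := proj_class_dsum (enum 'I_k)
  (fun i => proj_class_upow (p i) (XE i).2).
have clY := proj_class_prod (proj_class_upow m Zcd)
  (proj_class_dsum (enum 'I_k) (fun i => proj_class_upow (q i) (XE i).2)).
have bal j : (\sum_(i <- enum 'I_k) p i * a i j +
     (m * d j + \sum_(i <- enum 'I_k) q i * b i j) =
   (m * c j + \sum_(i <- enum 'I_k) q i * a i j) +
     \sum_(i <- enum 'I_k) p i * b i j)%N.
  rewrite !big_enum /=; apply/eqP; rewrite -(eqr_nat rat) !natrD !natr_sum !natrM.
  have split (f : 'I_k -> nat) : \sum_i (f i)%:R * M i j =
      \sum_i (f i * a i j)%N%:R - \sum_i (f i * b i j)%N%:R :> rat.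
    by rewrite -sumrB; apply: eq_bigr => i _; rewrite !mxE mulrBr !natrM.
  have := rel j; rewrite !split !mxE => h; apply/eqP; move: h; lra.
have : add P Y.
  apply: (@add_sub A hA P X').
    by apply: add_dsum => // i _; apply: upow_closed => //; apply: add_prod.
  apply: (add_of_euler hA hH); try exact: Eij.
    exact: (euler_class clX' clY bal).
  by apply: (euler_class clY clX') => j; rewrite bal.
move=> PY; apply: (@add_retract A hA P _ _ PY).
(* Since m is positive, Z is a summand of Y. *)
case: m m_gt0 @Y {rel EY clY bal PY} => // m _ Y.
exact: retract_trans (retract_prodl _ _) (retract_prodl _ _).
Qed.
End Progenerator.
End Classes.

(** * Basic Ext-progenerators and the two bijections *)

Section Bijections.
Variable A : pzRingType.
Hypotheses (hA : artin_algebra A) (hH : hereditary A).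
Implicit Types C D K : rmod A -> Prop.
Implicit Types E F G I J L M N P Q U V W X Y Z : rmod A.

Lemma add_iso_add U V : isomorphic U V -> add U V.
Proof. by move=> UV; apply: (add_iso hA UV); apply: add_self. Qed.

Lemma progenerator_add C P U : Ext_progenerator C P -> add P U -> add U P ->
  Ext_progenerator C U.
Proof.
move=> [CP hP hE] PU UP; split=> //; first by case: (hP U) => /(_ PU)[].
by move=> X; rewrite -hP; split; apply: add_sub.
Qed.

Lemma progenerator_mutual C U V : Ext_progenerator C U -> Ext_progenerator C V ->
  add U V.
Proof.
move=> [CU hU _] [CV hV _]; apply/hU/hV; exact: add_self.
Qed.

Lemma basic_iso U V : isomorphic U V -> basic U -> basic V.
Proof.
move=> UV /(basicP hA)[n [F [F1 F2 iso]]]; apply/(basicP hA); exists n, F; split=> //.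
exact: iso_trans iso UV.
Qed.

Lemma basic_progenerator_class C U : basic U -> Ext_progenerator C U ->
  same (P_class C) (iso_class U).
Proof.
move=> bU pU V; split=> [[bV pV] | UV].
  by apply: (basic_unique hA) => //; apply: progenerator_mutual; eassumption.
split; first exact: basic_iso UV bU.
by apply: (progenerator_add pU); apply: add_iso_add => //; apply: iso_sym.
Qed.

Lemma basic_progenerator_ex C : ice_p C -> exists U, basic U /\ Ext_progenerator C U.
Proof.
move=> [hC hE]; have [P pP] := progenerator_ex hA hH hC hE.
have [n [F [F1 F2 aU aP]]] := basic_part hA P.
exists (dsum F (enum 'I_n)); split; last exact: progenerator_add pP aU aP.
by apply/(basicP hA); exists n, F; split=> //; apply: iso_refl.
Qed.

Lemma progenerator_rigid C U : Ext_progenerator C U -> rigid U.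
Proof. by move=> [CU hU _]; apply: ((hU U).1 (add_self hA U)).2. Qed.

(** Two steps of an Ext-projective resolution present an object of C by modules in [add U]. *)
Lemma cok_progenerated C U : ICE_closed C -> Ext_progenerator C U ->
  forall X, cok U X <-> C X.
Proof.
move=> hC [CU hU hE] X.
have aC Y : add U Y -> C Y by move=> /hU[].
split=> [[U1 [U0 [f [q [/aC C1 /aC C0 ex qs]]]]] | CX].
  exact: (ICE_coker hC) ex qs.
have [Y [P [f [g [CY /hU aP ses]]]]] := hE X CX.
have [_ [P' [_ [g' [_ /hU aP' [_ _ g's]]]]]] := hE Y CY.
by apply/cokP; exists P, Y, f, g; split=> //; exists P', g'.
Qed.

Lemma cok_iso U V X : isomorphic U V -> cok U X -> cok V X.
Proof.
move=> UV [U1 [U0 [f [q [a1 a0 ex qs]]]]]; exists U1, U0, f, q.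
have VU : add V U by apply: add_iso_add; apply: iso_sym.
by split=> //; apply: add_sub VU _ _.
Qed.

Lemma cok_class_iso (K : rmod A -> Prop) U :
  same K (iso_class U) -> cok_class K = cok U.
Proof.
move=> KU; apply: funext => X; apply: propext; split.
  by move=> [V /KU UV]; apply: cok_iso; apply: iso_sym.
by move=> cX; exists U => //; apply/KU; apply: iso_refl.
Qed.

Lemma rigid_class_ice_p K : rigid_class K -> ice_p (cok_class K).
Proof.
move=> [U [bU rU /cok_class_iso->]]; split; first exact: cok_ICE.
by case: (cok_progenerator hA hH rU).
Qed.

Lemma ice_p_rigid_class C : ice_p C -> rigid_class (P_class C).
Proof.
move=> /basic_progenerator_ex[U [bU pU]]; exists U; split=> //.
  exact: progenerator_rigid pU.
exact: basic_progenerator_class.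
Qed.

Lemma P_class_cok K : rigid_class K -> same (P_class (cok_class K)) K.
Proof.
move=> [U [bU rU KU]] V; rewrite (cok_class_iso KU) KU.
by apply: basic_progenerator_class => //; apply: cok_progenerator.
Qed.

Lemma cok_P_class C : ice_p C -> same (cok_class (P_class C)) C.
Proof.
move=> hC; have [U [bU pU]] := basic_progenerator_ex hC.
rewrite (cok_class_iso (basic_progenerator_class bU pU)).
by apply: cok_progenerated => //; case: hC.
Qed.
End Bijections.

(** * The wide hull as a module category *)

Section Approximations.
Variable A : pzRingType.
Hypotheses (hA : artin_algebra A) (hH : hereditary A).
Implicit Types E F G I J L M N P Q U V W X Y Z : rmod A.
Variable C : rmod A -> Prop.
Hypotheses (hC : ICE_closed C) (hE : enough_Ext_projectives C).

(** The approximation is the trace of P in M. It is in C as the image of a map V -> C0, and it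
    receives all maps from C because every object of C is a quotient of one in [add P]. *)
Lemma hull_contravariantly_finite : contravariantly_finite (hull C) C.
Proof.
move=> M [C0 [C1 [i [p [CC0 CC1 [ii _ _]]]]]].
have [P [CP hP _]] := progenerator_ex hA hH hC hE.
have [V [f [I [e [m [aV es mi fE fac]]]]]] := gen_approx hA P M.
have CV : C V by have [] := (hP V).1 aV.
exists I, m; split.
  apply: (ICE_image hC (m := i \o m : {linear I -> C0}) CV CC0 es).
  exact: inj_comp.
move=> X g CX; apply: factor_inj => // x.
have [Y [P' [k [q [_ EP' [_ _ qs]]]]]] := hE CX; have aP' := (hP P').2 EP'.
have [x' <-] := qs x; have [t tE] := fac _ (g \o q : {linear P' -> M}) aP'.
by exists (e (t x')); rewrite -[LHS]fE tE.
Qed.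

(** Pull an Ext-projective cover P -> C1 back along C0 -> C1. The result E is an extension of C0 by
    Y, hence in C, and of P by M, so maps from M to C extend to E. *)
Lemma hull_covariantly_finite : covariantly_finite (hull C) C.
Proof.
move=> M [C0 [C1 [i [p [CC0 CC1 ses]]]]].
have [Y [P [k [g [CY [CP hP] [ki kex gs]]]]]] := hE CC1.
have [E [j [q [t [sesE tj pt fib joint]]]]] := pullback_ses hA g ses.
have joint_inj : injective (pairl t q).
  by apply: inj0 => u [tu qu]; apply: joint.
have [|k' k'E] := @factor_inj _ E Y (C0 * P)%type (pairl t q) (pairl \0 k) joint_inj.
  move=> y; have [|u [tu qu]] := fib 0 (k y); last by exists u; rewrite /= tu qu.
  by rewrite (exact0 _ kex) linear0.
have tk y : t (k' y) = 0 by have [] := k'E y.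
have qk y : q (k' y) = k y by have [] := k'E y.
have CE : C E.
  apply: (ICE_ext hC (f := k') (g := t) CY CC0); split.
  - by apply: inj0 => y k0; apply: (ker0 ki); rewrite -qk k0 linear0.
  - move=> u; split=> [tu | [y <-]]; last exact: tk.
    have /kex[y yE] : g (q u) = 0 by rewrite -pt tu linear0.
    by exists y; apply: joint_inj; rewrite /= tk qk tu yE.
  - move=> c; have [x xE] := gs (p c); have [|u [<- _]] := fib c x; first by rewrite xE.
    by exists u.
exists E, j; split=> // X h CX.
have [l lE] := Ext1_crit1 sesE (hP X CX) h; exists l; exact: lE.
Qed.

(** v is the tuple, in a power of P, of generators of P over the central ring R. As scalars of R are
    endomorphisms of P, v can be sent to any element of P, then of [add P] and of its quotients in
    C. *)
Lemma approx_regular : exists V (v : V), C V /\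
  forall X, C X -> forall x : X, exists h : {linear V -> X}, h v = x.
Proof.
have [P [CP hP hgen]] := progenerator_ex hA hH hC hE.
have [R [z [[z1 zD zM] central [Rd Rn] [n [g hg]]]]] := artin_central hA.
have [m [w hw]] := fg_restr z1 zD zM hg (rmod_fg P).
have zlin r a (u v : P) : z r *: (a *: u + v) = a *: (z r *: u) + z r *: v.
  by rewrite scalerDr !scalerA central.
have [V [v [aV vE]]] : exists V (v : V), add P V /\ forall c : 'I_m -> R,
    exists h : {linear V -> P}, h v = \sum_i z (c i) *: (w i : P).
  elim: m w {hw} => [|m IH] w.
    exists (zero_rmod A), (0 : zero_rmod A); split; first by case: (add_prod hA P).
    by move=> c; exists \0; rewrite big_ord0.
  have [V [v [aV vE]]] := IH (fun i => w (lift ord0 i)).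
  exists (prod_rmod P V), ((w ord0 : P, v) : prod_rmod P V); split.
    by apply: (add_prod hA P).2 => //; apply: add_self.
  move=> c; have [h hE'] := vE (fun i => c (lift ord0 i)).
  exists (copair (mk_linear (zlin (c ord0))) h).
  by rewrite big_ord_recl /= hE'.
exists V, v; split; first by case: ((hP V).1 aV).
have addV X : add P X -> forall x : X, exists h : {linear V -> X}, h v = x.
  move: X; apply: (add_min hA).
  - split; first by move=> x; exists \0; rewrite (zero_rmod_zero x).
    move=> X Y hX hY -[x y].
    have [h <-] := hX x; have [h' <-] := hY y.
    by exists (pairl h h').
  - move=> X Y hY [i [p pi]] x; have [h hx] := hY (i x).
    by exists (p \o h : {linear V -> X}); rewrite /= hx pi.
  - move=> x; have [c cE] := hw x; have [h hE'] := vE c.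
    by exists h; rewrite hE' cE.
move=> X CX x; have [Y [P' [k [q [_ EP' [_ _ qs]]]]]] := hgen X CX.
have [x' <-] := qs x; have [h <-] := addV P' ((hP P').2 EP') x'.
by exists (q \o h : {linear V -> X}).
Qed.

(* The reflection of the regular module in the wide hull: the smallest object
   of the hull inside V that contains the distinguished element v. *)
Lemma reflection_ex : exists Q (e : Q), [/\ hull C Q,
    forall X, hull C X -> forall x : X, exists h : {linear Q -> X}, h e = x
  & forall X, hull C X -> forall h h' : {linear Q -> X}, h e = h' e -> h =1 h'].
Proof.
have [V [v [CV vE]]] := approx_regular.
pose Fam (S : V -> Prop) := submod S /\ exists N (i : {linear N -> V}),
  [/\ injective i, forall u, S u <-> exists x, i x = u, hull C N & S v].
have [||S [[hS [Q [i [ii iE hQ Sv]]]] Smin]] := dcc_min (F := Fam) (rmod_dcc hA (M := V)).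
- by move=> S [].
- exists (fun=> True); split=> //; exists V, idfun; split=> //.
    by move=> u; split=> // _; exists u.
  exact: (hull_sub hA hC).
have [e eE] := (iE v).1 Sv.
(* The kernel of h is a hull object containing e, so by minimality it is all of Q. *)
have ker_all X (h : {linear Q -> X}) : hull C X -> h e = 0 -> forall x, h x = 0.
  move=> hX he0 x; have [K [k [ki kex]]] := kernel_ex hA h.
  have hK := hull_kernel hC hQ hX ki kex.
  have [|||y /ii e1] := Smin (fun u => exists y, (i \o k : {linear K -> V}) y = u) _ _ (i x).
  - split; first exact: submod_range.
    exists K, (i \o k : {linear K -> V}); split=> //; first exact: inj_comp.
    by have /kex[y yE] := he0; exists y; rewrite /= yE.
  - by move=> _ [y <-]; apply/iE; exists (k y).
  - by apply/iE; exists x.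
  by apply/kex; exists y.
exists Q, e; split=> //.
  move=> X hX x; have [C0 [C1 [j [p [CC0 CC1 [ji jex ps]]]]]] := hX.
  (* A map to the ambient object C0 exists; its composite to C1 kills e, hence all of Q, so the map
     lands in X. *)
  have [h0 h0E] := vE C0 CC0 (j x).
  have [|h hE'] := factor_inj (f := h0 \o i : {linear Q -> C0}) ji.
    move=> u; apply/jex.
    apply: (ker_all C1 (p \o (h0 \o i) : {linear Q -> C1})).
      exact: (hull_sub hA hC).
    by rewrite /= eE h0E (exact0 _ jex).
  by exists h; apply: ji; rewrite hE' /= eE h0E.
move=> X hX h h' hh x; apply/eqP; rewrite -subr_eq0; apply/eqP.
by apply: (ker_all X (h \- h' : {linear Q -> X})) => //=; rewrite hh subrr.
Qed.
End Approximations.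

(** * The reflection as a ring and its module category *)

Section ReflectionRing.
Variable A : pzRingType.
Hypotheses (hA : artin_algebra A) (hH : hereditary A).
Implicit Types E F G I J L M N P U V X Y Z : rmod A.
Variables (W : rmod A -> Prop) (Q : rmod A) (e : Q).
Hypotheses (wW : wide W) (WQ : W Q)
  (refl_ex : forall X, W X -> forall x : X, exists h : {linear Q -> X}, h e = x)
  (refl_eq : forall X, W X -> forall h h' : {linear Q -> X}, h e = h' e -> h =1 h').

(* Right multiplication by b : Q on a module X of W sends x to h b, where
   h : Q -> X is the map with h e = x. *)
Definition act X (WX : W X) (x : X) : {linear Q -> X} := sval (cid (refl_ex WX x)).

Lemma act_e X (WX : W X) x : act WX x e = x.
Proof. exact: svalP (cid (refl_ex WX x)). Qed.

Lemma act_uniq X (WX : W X) (h : {linear Q -> X}) x : h e = x -> act WX x =1 h.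
Proof. by move=> he; apply: refl_eq => //; rewrite act_e. Qed.

Lemma act_natural X Y (WX : W X) (WY : W Y) (f : {linear X -> Y}) x b :
  f (act WX x b) = act WY (f x) b.
Proof.
by rewrite (act_uniq WY (h := f \o act WX x : {linear Q -> Y})) //= act_e.
Qed.

Lemma act_linear X (WX : W X) a x y b :
  act WX (a *: x + y) b = act WX (a *: x) b + act WX y b.
Proof.
by rewrite (act_uniq WX (h := act WX (a *: x) \+ act WX y)) //= !act_e.
Qed.

Lemma actD X (WX : W X) x y b : act WX (x + y) b = act WX x b + act WX y b.
Proof. by have := act_linear WX 1 x y b; rewrite scale1r. Qed.

Definition reflring_sort : Type := Q.
HB.instance Definition _ := GRing.Zmodule.on reflring_sort.

(** Composition in End(Q), transported along evaluation at e. *)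
Let mul (b c : reflring_sort) : reflring_sort := act WQ b c.

Let mulA : associative mul.
Proof. by move=> a b c; rewrite /mul -act_natural. Qed.
Let mul1 : left_id (e : reflring_sort) mul.
Proof. by move=> b; rewrite /mul (act_uniq WQ (h := idfun)). Qed.
Let mulr1 : right_id (e : reflring_sort) mul.
Proof. by move=> b; apply: act_e. Qed.
Let mulDl : left_distributive mul +%R.
Proof. by move=> a b c; apply: actD. Qed.
Let mulDr : right_distributive mul +%R.
Proof. by move=> a b c; apply: linearD. Qed.

Definition reflring : pzRingType := HB.pack reflring_sort
  (GRing.Zmodule_isPzRing.Build reflring_sort mulA mul1 mulr1 mulDl mulDr).
Local Notation B := reflring.

Definition refl_map (a : A^c) : B^c := a *: e.

Lemma refl_mulE (b c : B) : b * c = act WQ b c :> Q.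
Proof. by []. Qed.

Lemma act_map X (WX : W X) x a : act WX x (refl_map a) = a *: x.
Proof. by rewrite linearZ act_e. Qed.

Lemma refl_map1 : refl_map 1 = 1.
Proof. exact: scale1r. Qed.
Lemma refl_mapD a b : refl_map (a + b) = refl_map a + refl_map b.
Proof. exact: scalerDl. Qed.
Lemma refl_mapM a b : refl_map (a * b) = refl_map a * refl_map b.
Proof.
rewrite /refl_map -scalerA -[RHS]/(act WQ (b *: e) (a *: e)).
by rewrite linearZ act_e.
Qed.

Lemma refl_gen : exists n (g : 'I_n -> B^c), forall b, exists c : 'I_n -> A^c,
  b = \sum_(i < n) refl_map (c i) * g i.
Proof.
have [n [g hg]] := rmod_fg Q; exists n, g => b.
have [c cE] := hg b; exists c; rewrite [LHS]cE; apply: eq_bigr => i _.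
by rewrite -[RHS]/(act WQ (g i) (refl_map (c i))) act_map.
Qed.

(** R maps to B through multiples of e, centrally because uniqueness makes [act] commute with
    scalars of R, and Q is finitely generated over R. *)
Lemma reflring_artin : artin_algebra B.
Proof.
have [R [z [[z1 zD zM] central [Rd Rn] [n [g hg]]]]] := artin_central hA.
pose phi (r : R) : B := z r *: e.
have act_z X (WX : W X) r b x : act WX (z r *: x) b = z r *: act WX x b.
  have zlin a (u v : Q) : z r *: act WX x (a *: u + v) =
      a *: (z r *: act WX x u) + z r *: act WX x v.
    by rewrite linearP scalerDr !scalerA central.
  by rewrite (act_uniq WX (h := mk_linear zlin)) //= act_e.
have phiD : {morph phi : r s / r + s} by move=> r s; rewrite /phi zD scalerDl.
have phi0 : phi 0 = 0.
  by apply: (addrI (phi 0)); rewrite -phiD !addr0.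
have phiM : monoid_morphism phi.
  split=> [|r s]; first by rewrite /phi z1 scale1r.
  by rewrite refl_mulE act_z linearZ act_e scalerA -zM.
pose phiR : {rmorphism R -> B} := HB.pack phi
  (GRing.isNmodMorphism.Build R B phi (conj phi0 phiD))
  (GRing.isMonoidMorphism.Build R B phi phiM).
exists R, phiR; split.
- move=> I hI hd; have [||N hN] := Rd I; last by exists N.
    by move=> k; have [h0 hD hZ] := hI k; split=> // a u v hu hv; apply: hD => //; apply: hZ.
  exact: hd.
- by move=> r b; rewrite !refl_mulE act_z linearZ act_e (act_uniq WQ (h := idfun)).
have [m [w hw]] := fg_restr z1 zD zM hg (rmod_fg Q).
exists m, w => b; have [c cE] := hw b; exists c; rewrite [LHS]cE.
apply: eq_bigr => i _; rewrite refl_mulE -[phiR _]/(z (c i) *: e) act_z.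
by rewrite (act_uniq WQ (h := idfun)).
Qed.

Section Extend.
Variables (X : rmod A) (WX : W X).

Definition ext_sort : Type := X.
HB.instance Definition _ := GRing.Zmodule.on ext_sort.
Let scale (b : B^c) (x : ext_sort) : ext_sort := act WX x b.
Let scaleA a b v : scale a (scale b v) = scale (a * b) v.
Proof. by rewrite /scale -[RHS]/(act WX v (act WQ b a)) act_natural. Qed.
Let scale1 : left_id 1 scale.
Proof. by move=> v; apply: act_e. Qed.
Let scaleDr : right_distributive scale +%R.
Proof. by move=> a u v; apply: actD. Qed.
Let scaleDl v : {morph scale^~ v : a b / a + b}.
Proof. by move=> a b; apply: linearD. Qed.

Definition ext_mod : lmodType B^c := HB.pack ext_sort
  (GRing.Zmodule_isLmodule.Build B^c ext_sort scaleA scale1 scaleDr scaleDl).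

Lemma ext_modZ (b : B^c) (x : X) : b *: (x : ext_mod) = act WX x b.
Proof. by []. Qed.

Lemma ext_fg : finitely_generated ext_mod.
Proof.
have [n [g hg]] := rmod_fg X; exists n, g => x; have [c cE] := hg x.
exists (refl_map \o c); rewrite [LHS]cE; apply: eq_bigr => i _.
by rewrite ext_modZ act_map.
Qed.

Definition ext_rmod : rmod B := RMod ext_fg.
End Extend.

Lemma ext_linear_proof X Y (WX : W X) (WY : W Y) (f : {linear X -> Y}) (b : B^c)
    (x y : ext_mod WX) : f (b *: x + y) = b *: (f x : ext_mod WY) + f y.
Proof. by rewrite linearD ext_modZ act_natural. Qed.

Definition ext_linear X Y (WX : W X) (WY : W Y) (f : {linear X -> Y}) :
  {linear ext_rmod WX -> ext_rmod WY} :=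
  @mk_linear B^c (ext_rmod WX) (ext_rmod WY) f (@ext_linear_proof X Y WX WY f).

Local Notation restrB := (restr refl_map1 refl_mapD refl_mapM).

Lemma restrB_fg (N : rmod B) : finitely_generated (restrB N).
Proof. by have [n [g hg]] := refl_gen; apply: (fg_restr _ _ _ hg); apply: rmod_fg. Qed.

Definition restr_rmod (N : rmod B) : rmod A := RMod (restrB_fg N).

Definition restr_linear (N N' : rmod B) (f : {linear N -> N'}) :
  {linear restr_rmod N -> restr_rmod N'} :=
  linear_restr refl_map1 refl_mapD refl_mapM f.

Lemma restr_short_exact (L M N : rmod B) (f : {linear L -> M}) (g : {linear M -> N}) :
  short_exact f g -> short_exact (restr_linear f) (restr_linear g).
Proof. by []. Qed.

Lemma restr_regular : isomorphic Q (restr_rmod (regular_rmod B)).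
Proof.
have lin a (u v : Q) : (a *: u + v : restr_rmod (regular_rmod B)) =
    a *: (u : restr_rmod (regular_rmod B)) + v.
  rewrite restrZ; congr (_ + _).
  by rewrite -[RHS]/(act WQ u (refl_map a)) act_map.
exists (@mk_linear A^c Q (restr_rmod (regular_rmod B)) id lin).
by exists id.
Qed.

Lemma W_prod : prod_closed W.
Proof. by have [/(subcategoryP hA)[]] := wW. Qed.

Lemma W_iso : iso_closed W.
Proof. by have [/(subcategoryP hA)[_ /retract_iso_closed]] := wW. Qed.

Lemma restr_free n : W (restr_rmod (free_rmod B n)).
Proof.
elim: n => [|n IH].
  apply: (W_iso W_prod.1); apply: zero_iso; first exact: zero_rmod_zero.
  by move=> x; apply: ffun0_zero.
have [i [p ses]] := ffunS_exact n ((B^c)^o).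
have [_ _ _ We] := wW.
apply: (We _ _ _ (@restr_linear (free_rmod B n) (free_rmod B n.+1) i)
  (@restr_linear (free_rmod B n.+1) (regular_rmod B) p)) => //.
exact: W_iso WQ restr_regular.
Qed.

(** Free B-modules restrict to sums of copies of Q, and N is the cokernel of a map between two of
    them. *)
Lemma restr_W (N : rmod B) : W (restr_rmod N).
Proof.
have [n [L [i [p [ii ex ps]]]]] := presentation reflring_artin N.
have [m [L' [i' [p' [_ _ ps']]]]] := presentation reflring_artin L.
have [_ _ Wc _] := wW.
apply: (Wc _ _ _ (@restr_linear (free_rmod B m) (free_rmod B n) (i \o p'))
  (@restr_linear (free_rmod B n) N p)) => //; try exact: restr_free.
move=> x; rewrite -[X in X = 0 <-> _]/(p x) ex; split=> [[y <-] | [y <-]].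
  by have [u <-] := ps' y; exists u.
by exists (p' y).
Qed.

(** Both sides, as functions of b, are A-linear maps from Q sending e to x. Hence the A-structure
    determines the B-structure, and restriction is full. *)
Lemma act_restr (N : rmod B) (x : N) (b : B^c) : act (restr_W N) x b = b *: x.
Proof.
have lin a (u v : Q) : ((a *: u + v : Q) : B^c) *: (x : N) =
    a *: ((u : B^c) *: x : restr_rmod N) + ((v : B^c) *: x : N).
  rewrite -[RHS]/(refl_map a *: ((u : B^c) *: x) + (v : B^c) *: x) scalerA -scalerDl.
  congr ((_ + _) *: _).
  by rewrite -[RHS]/(act WQ u (refl_map a)) act_map.
rewrite (act_uniq (restr_W N) (h := @mk_linear A^c Q (restr_rmod N)
  (fun b => (b : B^c) *: (x : N)) lin)) //.
exact: (scale1r (x : N)).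
Qed.

Lemma restr_full (N N' : rmod B) (f : {linear restr_rmod N -> restr_rmod N'})
    (b : B^c) (x : N) : f (b *: x) = b *: (f x : N').
Proof. by rewrite -!act_restr; apply: act_natural. Qed.

(** Both functors keep carriers and underlying functions, so the functor laws hold by computation
    and identity functions serve as the natural isomorphisms. *)
Definition equiv_functor : functor W (fun _ : rmod B => True) :=
  @Functor A B W (fun _ => True)
    (fun X : {X | W X} => exist (fun _ : rmod B => True) (ext_rmod (proj2_sig X)) I)
    (fun (X Y : {X | W X}) f => ext_linear (proj2_sig X) (proj2_sig Y) f)
    (fun _ _ => erefl) (fun _ _ _ _ _ _ => erefl).

Definition equiv_inverse : functor (fun _ : rmod B => True) W :=
  @Functor B A (fun _ => True) W
    (fun N : {N : rmod B | True} => exist W (restr_rmod (sval N)) (restr_W (sval N)))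
    (fun (N N' : {N : rmod B | True}) f => restr_linear f)
    (fun _ _ => erefl) (fun _ _ _ _ _ _ => erefl).

Lemma reflring_equivalent : equivalent W (fun _ : rmod B => True).
Proof.
exists equiv_functor, equiv_inverse; split.
- have lin (X0 : {X | W X}) a (u v : sval X0) :
     (a *: u + v : restr_rmod (ext_rmod (proj2_sig X0))) =
      a *: (u : restr_rmod (ext_rmod (proj2_sig X0))) + v.
    by rewrite restrZ ext_modZ act_map.
  exists (fun X0 : {X | W X} =>
    @mk_linear A^c (sval X0) (restr_rmod (ext_rmod (proj2_sig X0))) id (lin X0)).
  by split=> [X0 | X0 Y0 f x]; first by exists id.
- have lin (N : {N : rmod B | True}) (b : B^c) (u v : sval N) :
     (b *: u + v : ext_rmod (restr_W (sval N))) =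
      b *: (u : ext_rmod (restr_W (sval N))) + v.
    by rewrite ext_modZ act_restr.
  exists (fun N : {N : rmod B | True} =>
    @mk_linear B^c (sval N) (ext_rmod (restr_W (sval N))) id (lin N)).
  by split=> [N | N N' f x]; first by exists id.
Qed.

(** An extension of Q by X is again in W, so e has a preimage hit by a map from Q; that map is a
    section by uniqueness. *)
Lemma W_projective X : W X -> Ext1_zero Q X.
Proof.
move=> WX; apply/Ext1P => E i p ses; have [ii ex ps] := ses.
have fgE : finitely_generated E by apply: fg_ext ex ps _ _; apply: rmod_fg.
have WE : W (RMod fgE).
  by have [_ _ _ We] := wW; apply: (We X (RMod fgE) Q i p).
have [e' e'E] := ps e; have [h hE] := refl_ex WE e'.
exists h; apply: (refl_eq WQ (h := p \o h : {linear Q -> Q}) (h' := idfun)).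
by rewrite /= hE.
Qed.

(** A right ideal of B restricts to a submodule of Q, so it has no extensions by modules of W over
    A. Its free cover splits A-linearly, and by fullness B-linearly. *)
Lemma reflring_hereditary : hereditary B.
Proof.
move=> I f fi.
(* The ideal comes as an arbitrary module; the noetherian property shows that it is finitely
   generated. *)
have [K [k [ki kE]]] := sub_rmod reflring_artin (M := regular_rmod B) (submod_range f).
have [|h hE] := @factor_inj _ I K ((B^c)^o) f k fi; first by move=> x; apply/kE; exists x.
have [|h' h'E] := @factor_inj _ K I ((B^c)^o) k f ki; first by move=> x; apply/kE; exists x.
have hh' x : h (h' x) = x by apply: fi; rewrite hE h'E.
have hs : surjective h by move=> x; exists (h' x).
pose J : rmod B := RMod (fg_surj hs (rmod_fg K)).
have [n [L [i [p ses]]]] := presentation reflring_artin J.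
have EJ : Ext1_zero (restr_rmod J) (restr_rmod L).
  apply: (Ext1_sub hA hH (d := @restr_linear J (regular_rmod B) f)) => //.
  apply: (Ext1_iso hA hH restr_regular (iso_refl _)).
  exact/W_projective/restr_W.
have [s sE] := (Ext1P _ _).1 EJ _ _ _ (restr_short_exact ses).
have slin (b : B^c) (u v : J) : (s (b *: u + v) : free_rmod B n) =
    b *: (s u : free_rmod B n) + (s v : free_rmod B n).
  by rewrite -restr_full -linearD.
pose sB := @mk_linear B^c J (free_rmod B n) s slin.
move=> M N g t gs.
have [l lE] := projective_lift (t \o p : {linear free_rmod B n -> N})
  (projective_ffun (S := B^c) (n := n)) gs.
exists (l \o sB : {linear I -> M}) => x /=.
by rewrite lE /= [p (s x)](sE x).
Qed.
End ReflectionRing.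

Theorem corollary5p2 (A : pzRingType)
    (hartin : artin_algebra A) (hher : hereditary A) :
  [/\ forall P : rmod A, rigid P ->
        [/\ torsion_class (wide_generated P) (cok P),
            ICE_closed (cok P)
          & Ext_progenerator (cok P) P],

      [/\ forall K : rmod A -> Prop, rigid_class K -> ice_p (cok_class K),
          forall C : rmod A -> Prop, ice_p C -> rigid_class (P_class C),
          forall K : rmod A -> Prop, rigid_class K ->
            same (P_class (cok_class K)) K
        & forall C : rmod A -> Prop, ice_p C ->
            same (cok_class (P_class C)) C],

      forall C : rmod A -> Prop, ICE_closed C -> enough_Ext_projectives C ->
        exists W : rmod A -> Prop,
          [/\ wide W, torsion_class W C, functorially_finite W C
            & exists B : pzRingType,
                [/\ artin_algebra B, hereditary B
                  & equivalent W (fun _ : rmod B => True)]]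
    & representation_finite A ->
      forall C : rmod A -> Prop, subcategory C ->
        (ICE_closed C <->
         exists W : rmod A -> Prop, wide W /\ torsion_class W C)].
Proof.
split.
- move=> P rP; split.
  + exact: cok_torsion.
  + exact: cok_ICE.
  + exact: cok_progenerator.
- split.
  + exact: (rigid_class_ice_p hartin hher).
  + exact: (ice_p_rigid_class hartin hher).
  + exact: (P_class_cok hartin hher).
  + exact: (cok_P_class hartin hher).
- move=> C hC hE; exists (hull C).
  have wW := hull_wide hartin hher hC.
  have [Q [e [WQ ex uniq]]] := reflection_ex hartin hher hC hE.
  split=> //.
  + by apply: (hull_torsion hC) => // X; apply: hull_sub.
  + split; first exact: hull_covariantly_finite.
    exact: hull_contravariantly_finite.
  + exists (reflring WQ ex uniq); split.
    * exact: reflring_artin.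
    * exact: reflring_hereditary.
    * exact: reflring_equivalent.
- by move=> _ C _; apply: ICE_iff_torsion.
Qed.
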